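(* Let $k\in\{0,1,2,\dots\}$, let $\beta_2>\beta_1>0$ and let $s$ satisfy $\frac{1}{4k+3}\le s\le\frac{4k+2}{4k+3}$. Then $$\beta_1^{s}\,TW_{\beta_1,k}\ \succeq\ \beta_2^{s}\,TW_{\beta_2,k}.$$
   Context: Let $W$ be a standard Brownian motion on $[0,\infty)$. Let $L^*$ be the space of continuous functions $f:[0,\infty)\to\mathbb{R}$ with $f(0)=0$ and $\int_0^\infty\big[(f')^2(x)+x^{\frac{1}{2k+1}}f^2(x)\big]dx<\infty$. For $\beta>0$ and $k\in\{0,1,2,\dots\}$, the $k$-th higher order Tracy–Widom random variable is $$TW_{\beta,k}:=\sup_{f\in L^*,\ \|f\|_{L^2}=1}\left\{\frac{2}{\sqrt\beta}\int_0^\infty f^2(x)\,x^{-\frac{k}{2k+1}}\,dW_x-\int_0^\infty\big[(f')^2(x)+x^{\frac{1}{2k+1}}f^2(x)\big]dx\right\},$$ which is almost surely well defined and equals minus the ground state eigenvalue of the stochastic operator $S_{\beta,k}=-\frac{d^2}{dx^2}+x^{\frac{1}{2k+1}}+\frac{2}{\sqrt\beta}x^{-\frac{k}{2k+1}}W'(x)$ on $(0,\infty)$ with Dirichlet condition at $0$ (for $k=0$ this is the Tracy–Widom$_\beta$ law). For real random variables $X,Y$, $X\succeq Y$ means $\mathbb{P}(X>t)\ge\mathbb{P}(Y>t)$ for all $t\in\mathbb{R}$. *)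

(* Defs.v *)
From HB Require Import structures.
From mathcomp Require Import all_boot all_order all_algebra.
From mathcomp Require Import all_classical all_reals all_analysis.
Set Implicit Arguments. Unset Strict Implicit. Unset Printing Implicit Defensive.
Import Order.TTheory GRing.Theory Num.Theory.
Import numFieldNormedType.Exports.
Local Open Scope classical_set_scope.
Local Open Scope ring_scope.

Section TW.
Context {R : realType}.
Notation mu := (@lebesgue_measure R).

Definition brownian_motion {d} {Omega : measurableType d}
    (P : probability Omega R) (W : R -> Omega -> R) : Prop :=
  [/\ (forall t, measurable_fun setT (W t)),
      (forall w, W 0 w = 0),
      (forall w, {within `[0%R, +oo[, continuous (fun t => W t w)}),
      (forall s t, 0 <= s -> s < t -> forall A : set R, measurable A ->
          P [set w | W t w - W s w \in A] = normal_prob 0 (Num.sqrt (t - s)) A) &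
      (* independent increments: product rule over any finite partition
         0 <= t_0 < t_1 < ... < t_n (subfamilies by taking A_i = setT) *)
      (forall (n : nat) (tt : nat -> R) (A : nat -> set R),
          0 <= tt 0%N -> (forall i, tt i < tt i.+1) ->
          (forall i, measurable (A i)) ->
          P (\bigcap_(i in [set i | (i < n)%N])
                [set w | W (tt i.+1) w - W (tt i) w \in A i]) =
          (\prod_(i < n) P [set w | (W (tt i.+1) w - W (tt i) w)%R \in A i])%E)].

Definition ak (k : nat) : R := k%:R / (2 * k + 1)%:R.
Definition gk (k : nat) (x : R) : R := x `^ (- ak k).
Definition dgk (k : nat) (x : R) : R := - ak k * x `^ (- ak k - 1).
Definition pot (k : nat) (x : R) : R := x `^ ((2 * k + 1)%:R^-1).

Definition Lstar (k : nat) (f df : R -> R) : Prop :=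
  (forall x, 0 <= x ->
     mu.-integrable `[0, x] (fun y => (df y)%:E) /\
     f x = \int[mu]_(y in `[0, x]) df y) /\
  (\int[mu]_(x in `[0%R, +oo[) ((df x) ^+ 2 + pot k x * (f x) ^+ 2)%:E < +oo)%E.

Definition energy (k : nat) (f df : R -> R) : R :=
  \int[mu]_(x in `[0%R, +oo[) ((df x) ^+ 2 + pot k x * (f x) ^+ 2).

Definition L2norm1 (f : R -> R) : Prop :=
  (\int[mu]_(x in `[0%R, +oo[) ((f x) ^+ 2)%:E = 1)%E.

(* ---- pathwise Wiener integral  int_0^oo f^2(x) x^{-k/(2k+1)} dW_x ----
   Ramirez-Rider-Virag style: with Wbar(x) = int_x^{x+1} W, and phi = f^2 gk,
   int phi dW = int phi (W(x+1)-W(x)) dx - int phi' (W - Wbar) dx. *)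
Definition Wbar (W : R -> R) (x : R) : R := \int[mu]_(y in `[x, x + 1]) W y.

Definition stoch_int (k : nat) (f df : R -> R) (W : R -> R) : R :=
  \int[mu]_(x in `]0%R, +oo[) ((f x) ^+ 2 * gk k x * (W (x + 1) - W x))
  - \int[mu]_(x in `]0%R, +oo[)
      ((2 * f x * df x * gk k x + (f x) ^+ 2 * dgk k x) * (W x - Wbar W x)).

Definition TW (k : nat) (beta : R) (W : R -> R) : \bar R :=
  ereal_sup [set y : \bar R | exists f df : R -> R,
     [/\ Lstar k f df, L2norm1 f &
         y = ((2 / Num.sqrt beta) * stoch_int k f df W - energy k f df)%:E]].

End TW.

(* Main.v *)
Require Import Defs.
From HB Require Import structures.
From mathcomp Require Import all_boot all_order all_algebra.
From mathcomp Require Import all_classical all_reals all_analysis.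
From mathcomp Require Import measurable_realfun ring lra.
Set Implicit Arguments. Unset Strict Implicit. Unset Printing Implicit Defensive.
Import Order.TTheory GRing.Theory Num.Theory.
Import numFieldNormedType.Exports.
Local Open Scope classical_set_scope.
Local Open Scope ring_scope.

(* Write alpha = k/(2k+1).  On a test function f supported away from 0 and
   infinity the pathwise integral is -int (f^2 x^(-alpha))' W, so with
   c = (beta1/beta2)^((s-1/2)/(alpha+1/2)) the substitution f(x/c),
   sqrt c * W(x/c) multiplies the noise term of beta2^s TW_(beta2,k) exactly by
   the factor c that turns it into that of beta1^s TW_(beta1,k), while the two
   bounds on s say that the kinetic and the potential terms do not get worse.
   As sqrt c * W(x/c) is again a Brownian motion, the tail events are nested up
   to equality in law.

   Outer probabilities of nonmeasurable sets are out of control, so the tail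
   events have to be shown measurable.  The functional is a sum of two
   integrals, which have the junk value 0 when they diverge.  Classify f by
   which of the two converge: the event that some f of a given class beats the
   threshold is equivalent, by truncation in one direction and by gluing
   countably many small bumps in the other, to countably many conditions on
   bumps, each open for locally uniform convergence of paths.  Almost surely
   int_1^oo x^-2 (W(x+1)-W(x))^6 dx and its analogue for W - Wbar are finite;
   this makes both integrals converge for every f, so that only the bumps of the
   first paragraph matter. *)

(** Scaling by c gives the kinetic, potential and L2 terms the factors c^(-1), c^(1+1/(2k+1)) and c,
    so that everything is compared with the factor c of the norm. The noise has no sign and must
    match exactly, which fixes c; the kinetic term then asks for (beta1/beta2)^s <= c^2 and the
    potential for beta1^s c^(1/(2k+1)) <= beta2^s.

    The unit window of the moving average does not scale. Hence the detour through bumps, on which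
    an integration by parts removes the average.

    The supremum runs over an uncountable family, which is harmless for open conditions: unions of
    open sets are open, and an open set of paths is a countable union of measurable tubes.
    Convergence of an integral is not an open condition, and this is why classes and small bumps are
    needed.

    The delicate point of truncation is that the second integrand is a sum of two terms which may
    diverge separately while the sum converges. The truncation is therefore applied to x^(-alpha/2)
    f, whose square has the coefficient of that integrand as its derivative. *)

Section RealIntegrable.
Context d (T : measurableType d) {R : realType} (nu : {measure set T -> \bar R}).
Context (D : set T).
Hypothesis mD : measurable D.
Implicit Types f g : T -> R.
Local Notation rint f := (nu.-integrable D (EFin \o f)).

Lemma rint_measurable f : rint f -> measurable_fun D f.
Proof. by move/(measurable_int nu)/measurable_EFinP. Qed.

Lemma rintD f g : rint f -> rint g -> rint (fun x => f x + g x).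
Proof. exact: integrableD. Qed.

Lemma rintB f g : rint f -> rint g -> rint (fun x => f x - g x).
Proof. exact: integrableB. Qed.

Lemma rintZl (c : R) f : rint f -> rint (fun x => c * f x).
Proof. exact: integrableZl. Qed.

Lemma rint_le f g : measurable_fun D f ->
  (forall x, D x -> `|f x| <= g x) -> rint g -> rint f.
Proof.
move=> mf fg; apply: le_integrable => //; first exact/measurable_EFinP.
by move=> x Dx /=; rewrite lee_fin (le_trans (fg _ Dx))// ler_norm.
Qed.

Lemma eq_rint f g : (forall x, D x -> f x = g x) -> rint f -> rint g.
Proof. by move=> fg; apply: eq_integrable => // x; rewrite inE/= => /fg ->. Qed.

Lemma rint_ltyP f : measurable_fun D f -> (forall x, D x -> 0 <= f x) ->
  rint f <-> (\int[nu]_(x in D) (f x)%:E < +oo)%E.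
Proof.
move=> mf f0; split=> [|h]; first exact: integrable_lty.
apply/integrableP; split; first exact/measurable_EFinP.
rewrite (eq_integral (EFin \o f))// => x; rewrite inE => Dx.
by rewrite /= ger0_norm// f0.
Qed.

Lemma EFin_Rintegral f : rint f ->
  (\int[nu]_(x in D) f x)%:E = (\int[nu]_(x in D) (f x)%:E)%E.
Proof. by move=> rf; rewrite /Rintegral fineK//; exact: integrable_fin_num. Qed.

End RealIntegrable.

(** * Absolutely continuous functions *)

Section AbsolutelyContinuous.
Context {R : realType}.
Notation mu := (@lebesgue_measure R).
Implicit Types (F G p q : R -> R) (x y b : R).

(** The derivative is an explicit integrable witness, a version and not a limit of difference
    quotients, so that the calculus below needs no differentiation almost everywhere. *)
Definition ac F p := forall x, 0 <= x ->
  mu.-integrable `[0, x] (EFin \o p) /\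
  F x = F 0 + \int[mu]_(y in `[0, x]) p y.

Lemma ac_integrable F p x : ac F p -> mu.-integrable `[0, x] (EFin \o p).
Proof.
move=> a; have [x0|x0] := leP 0 x; first by have [] := a _ x0.
rewrite set_itv_ge -?leNgt ?bnd_simp -?ltNge//; exact: integrable_set0.
Qed.

Lemma ac_integrable_oc F p x y : 0 <= x -> ac F p ->
  mu.-integrable `]x, y] (EFin \o p).
Proof.
move=> x0 a; apply: integrableS (ac_integrable y a) => //.
by move=> z /=; rewrite !in_itv/= => /andP[xz ->]; rewrite (le_trans x0 (ltW xz)).
Qed.

Lemma ac_sub F p x y : 0 <= x -> x <= y -> ac F p ->
  F y - F x = \int[mu]_(t in `]x, y]) p t.
Proof.
move=> x0 xy a; have [iy ->] := a y (le_trans x0 xy); have [_ ->] := a x x0.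
by rewrite -(Rintegral_itvB iy)//; last by rewrite opprD addrACA subrr add0r.
Qed.

Lemma ac_norm F p : ac F p ->
  ac (fun x => \int[mu]_(y in `[0, x]) `|p y|) (fun x => `|p x|).
Proof.
move=> a x x0; split; first exact/integrable_norm/(ac_integrable x a).
by rewrite set_itv1 Rintegral_set1 add0r.
Qed.

Lemma ac_continuous F p b : ac F p -> {within `[0, b], continuous F}.
Proof.
move=> a; have [b0|b0] := leP 0 b; last first.
  by rewrite set_itv_ge -?leNgt ?bnd_simp -?ltNge//; exact: continuous_subspace0.
have h := parameterized_integral_continuous b0 (ac_integrable b a).
apply: (@subspace_eq_continuous _ _ _ (fun x => F 0 + \int[mu]_(y in `[0, x]) p y)).
  move=> x; rewrite inE/= in_itv/= => /andP[x0 _].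
  exact/esym/(a x x0).2.
apply: (@within_continuous_comp _ _ _ _ (fun x => \int[mu]_(y in `[0, x]) p y) (fun z => F 0 + z)) h.
by move=> z _; apply: cvgD; [exact: cvg_cst|exact: cvg_id].
Qed.

(** Cut [0, b] by the intermediate value theorem into n pieces on each of which [I] grows by the
    same d = (I b - I 0)/n. The increments of [H] add up to at most n L d^2 = L (I b - I 0)^2 / n,
    which tends to 0. *)
Lemma quadratic_increment_cst (H I : R -> R) (L b : R) : 0 <= b ->
  {within `[0, b], continuous I} ->
  {in `[0, b] &, {homo I : x y / x <= y}} ->
  (forall x y, 0 <= x -> x <= y -> y <= b ->
     `|H y - H x| <= L * (I y - I x) ^+ 2) -> H b = H 0.
Proof.
move=> b0 cI ndI HI.
have I0b : I 0 <= I b by apply: ndI; rewrite ?in_itv/= ?lexx ?b0.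
have key n (d : R) : 0 <= d -> forall c, 0 <= c -> c <= b ->
    I c = I 0 + n%:R * d -> `|H c - H 0| <= n%:R * (L * d ^+ 2).
  move=> d0; elim: n => [|n IH] c c0 cb Ic.
    by apply: le_trans (HI _ _ (lexx 0) c0 cb) _; rewrite Ic; lra.
  have cIc : {within `[0, c], continuous I}.
    apply: continuous_subspaceW cI => z /=; rewrite !in_itv/= => /andP[-> zc].
    exact: le_trans zc cb.
  have nd0 : 0 <= n%:R * d by rewrite mulr_ge0.
  have [] := @IVT _ I 0 c (I 0 + n%:R * d) c0 cIc.
    rewrite Ic -natr1 ge_min le_max; apply/andP; split; apply/orP.
      by left; lra.
    by right; lra.
  move=> c'; rewrite in_itv/= => /andP[c'0 c'c] Ic'.
  have h1 := IH c' c'0 (le_trans c'c cb) Ic'.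
  have h2 := HI _ _ c'0 c'c cb.
  have e : I c - I c' = d by rewrite Ic Ic' -natr1; lra.
  rewrite e in h2.
  have -> : H c - H 0 = (H c - H c') + (H c' - H 0) by lra.
  by apply: le_trans (ler_normD _ _) _; rewrite -natr1; lra.
apply/eqP; rewrite -subr_eq0 -normr_le0; apply/ler_addgt0Pl => e e0; rewrite addr0.
pose D := I b - I 0; have D0 : 0 <= D by rewrite subr_ge0.
pose n := (Num.truncn (`|L| * D ^+ 2 / e)).+1.
have n0 : 0 < n%:R :> R by rewrite ltr0n.
have h := key n (D / n%:R) (divr_ge0 D0 (ltW n0)) b b0 (lexx b).
apply: (le_trans (h _)); first by rewrite mulrCA divff ?gt_eqF// mulr1 /D; lra.
have -> : n%:R * (L * (D / n%:R) ^+ 2) = L * D ^+ 2 / n%:R.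
  by field; rewrite gt_eqF.
rewrite ler_pdivrMr//.
have : `|L| * D ^+ 2 / e < n%:R by rewrite /n; apply: truncnS_gt.
rewrite ltr_pdivrMr// => h2.
have : L * D ^+ 2 <= `|L| * D ^+ 2 by rewrite ler_wpM2r ?sqr_ge0// ler_norm.
lra.
Qed.

Lemma integrable_mul_within (h p : R -> R) b :
  {within `[0, b], continuous h} -> mu.-integrable `[0, b] (EFin \o p) ->
  mu.-integrable `[0, b] (EFin \o (fun x => h x * p x)).
Proof.
move=> ch ip.
have [b0|b0] := leP 0 b; last first.
  by rewrite set_itv_ge -?leNgt ?bnd_simp -?ltNge//; exact: integrable_set0.
have mh : measurable_fun `[0, b] h.
  exact: subspace_continuous_measurable_fun.
have hb : [bounded h x | x in `[0, b]%classic].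
  have := continuous_compact ch (@segment_compact _ 0 b).
  move/compact_bounded => [M [Mr hM]]; exists M; split => // x Mx y /= yb.
  by apply: hM Mx _ _; exists y.
exact: (@integrableMr _ _ _ mu _ _ h (EFin \o p) mh hb ip).
Qed.

(** The defect [K] between T(F) and the integral of T'(F) p has increments quadratic in those of
    [I], the integral of |p|: one part by the Taylor bound on T, the other because T'(F) varies by
    at most L (I y - I x) on []x, y]]. So [K] is constant. *)
Lemma ac_chain (T T' : R -> R) (L : R) F p :
  (forall x y, `|T y - T x - T' x * (y - x)| <= L * (y - x) ^+ 2) ->
  (forall x y, `|T' y - T' x| <= L * `|y - x|) ->
  ac F p -> ac (T \o F) (fun x => T' (F x) * p x).
Proof.
move=> hT hT' a b b0.
have L0 : 0 <= L.
  by have := le_trans (normr_ge0 _) (hT' 0 1); rewrite subr0 normr1 mulr1.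
have cT' : continuous T'.
  move=> x; apply/cvgrPdist_le => /= e e0.
  near=> t; rewrite (le_trans (hT' _ _))//.
  apply: (@le_trans _ _ ((L + 1) * `|x - t|)).
    by rewrite ler_wpM2r// lerDl.
  rewrite mulrC -ler_pdivlMr ?ltr_wpDl//.
  near: t; apply: cvgr_dist_le; first exact: cvg_id.
  by rewrite divr_gt0// ltr_wpDl.
have ci c : mu.-integrable `[0, c] (EFin \o (fun x => T' (F x) * p x)).
  apply: (@integrable_mul_within (fun x => T' (F x))); last exact: ac_integrable a.
  apply: (@within_continuous_comp _ _ _ _ F T'); last exact: ac_continuous a.
  by move=> z _; exact: cT'.
split=> //.
pose I x := \int[mu]_(y in `[0, x]) `|p y|.
pose K x := T (F x) - \int[mu]_(y in `[0, x]) (T' (F y) * p y).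
have aI : ac I (fun x => `|p x|) by exact: ac_norm a.
have IE x y : 0 <= x -> x <= y -> I y - I x = \int[mu]_(t in `]x, y]) `|p t|.
  by move=> x0 xy; exact: ac_sub aI.
have FI x y : 0 <= x -> x <= y -> `|F y - F x| <= I y - I x.
  move=> x0 xy; rewrite (ac_sub x0 xy a) IE//.
  by apply: le_normr_Rintegral => //; exact: ac_integrable_oc a.
suff : K b = K 0 by rewrite /K set_itv1 Rintegral_set1 /=; lra.
apply: (@quadratic_increment_cst K I (2 * L)) => //.
- exact: ac_continuous aI.
- move=> x y; rewrite !in_itv/= => /andP[x0 _] _ xy.
  by rewrite -subr_ge0 (le_trans _ (FI _ _ x0 xy)).
move=> x y x0 xy yb.
have y0 := le_trans x0 xy.
have ip := ac_integrable_oc y x0 a.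
have ib : mu.-integrable `]x, y] (EFin \o (fun t => T' (F t) * p t)).
    apply: integrableS (ci y) => // z /=; rewrite !in_itv/= => /andP[xz ->].
    by rewrite (le_trans x0 (ltW xz)).
have -> : K y - K x = (T (F y) - T (F x) - T' (F x) * (F y - F x)) +
    \int[mu]_(t in `]x, y]) ((T' (F x) - T' (F t)) * p t).
  have -> : \int[mu]_(t in `]x, y]) ((T' (F x) - T' (F t)) * p t) =
     T' (F x) * (F y - F x) - \int[mu]_(t in `]x, y]) (T' (F t) * p t).
    under eq_Rintegral do rewrite mulrBl.
    rewrite RintegralB//=; last exact: rintZl.
    by rewrite RintegralZl// (ac_sub x0 xy a).
  rewrite -(@Rintegral_itvB _ _ (BLeft 0) (BRight y) x (ci y)) ?bnd_simp//.
  by rewrite /K; lra.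
apply: le_trans (ler_normD _ _) _.
have h1 : `|T (F y) - T (F x) - T' (F x) * (F y - F x)| <= L * (I y - I x) ^+ 2.
  apply: le_trans (hT _ _) _; rewrite ler_wpM2l// -(real_normK (num_real (F y - F x))).
  by rewrite lerXn2r ?nnegrE ?normr_ge0 ?FI// (le_trans _ (FI _ _ x0 xy)).
have h2 : `|\int[mu]_(t in `]x, y]) ((T' (F x) - T' (F t)) * p t)| <= L * (I y - I x) ^+ 2.
  have ic : mu.-integrable `]x, y] (EFin \o (fun t => (T' (F x) - T' (F t)) * p t)).
    apply: (@eq_rint _ _ _ mu _ _ (fun t => T' (F x) * p t - T' (F t) * p t)) => //.
      by move=> t _; rewrite mulrBl.
    by apply: rintB => //; apply: rintZl.
  apply: le_trans (le_normr_Rintegral _ ic) _ => //.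
  have -> : L * (I y - I x) ^+ 2 = \int[mu]_(t in `]x, y]) (L * (I y - I x) * `|p t|).
    rewrite RintegralZl//; last exact: integrable_norm.
    by rewrite -IE//; ring.
  apply: le_Rintegral => //.
  - exact: integrable_norm.
  - by apply: rintZl => //; exact: integrable_norm.
  move=> t /=; rewrite in_itv/= => /andP[xt ty].
  rewrite normrM ler_wpM2r//; apply: le_trans (hT' _ _) _; rewrite ler_wpM2l// distrC.
  apply: le_trans (FI _ _ x0 (ltW xt)) _; rewrite lerB//.
  by rewrite -subr_ge0 (le_trans _ (FI _ _ (le_trans x0 (ltW xt)) ty)).
by move: h1 h2; lra.
Unshelve. all: by end_near. Qed.

Lemma eq_ac F p G q : (forall x, 0 <= x -> F x = G x) ->
  (forall x, 0 <= x -> p x = q x) -> ac F p -> ac G q.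
Proof.
move=> FG pq a x x0; have [ip Fx] := a x x0.
have pq' : {in `[0, x]%classic, p =1 q}.
  by move=> y; rewrite inE/= in_itv/= => /andP[y0 _]; rewrite pq.
split; first by apply: (eq_rint _ _ ip) => // y yx; rewrite pq'// inE.
by rewrite -!FG// Fx; congr (_ + _); exact: eq_Rintegral.
Qed.

Lemma ac_cst (c : R) : ac (cst c) (cst 0).
Proof.
move=> x x0; split; first exact: integrable0.
by rewrite /cst /Rintegral integral0 addr0.
Qed.

Lemma ac_lin (c e : R) F p G q : ac F p -> ac G q ->
  ac (fun x => c * F x + e * G x) (fun x => c * p x + e * q x).
Proof.
move=> aF aG x x0; have [ip ->] := aF x x0; have [iq ->] := aG x x0.
split; first by apply: rintD => //; exact: rintZl.
rewrite RintegralD//; [|exact: rintZl|exact: rintZl].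
by rewrite !RintegralZl//; ring.
Qed.

Lemma ac_add F p G q : ac F p -> ac G q ->
  ac (fun x => F x + G x) (fun x => p x + q x).
Proof.
move=> aF aG; apply: eq_ac (ac_lin 1 1 aF aG) => x _; by rewrite !mul1r.
Qed.

Lemma ac_sqr F p : ac F p -> ac (fun x => F x ^+ 2) (fun x => 2 * F x * p x).
Proof.
apply: (@ac_chain (fun z => z ^+ 2) (fun z => 2 * z) 2) => x y.
  rewrite (_ : _ - _ = (y - x) ^+ 2); last by ring.
  by rewrite ger0_norm ?sqr_ge0// ler_peMl ?sqr_ge0// ler1n.
by rewrite -mulrBr normrM ger0_norm.
Qed.

(** Polarization reduces the product to squares. *)
Lemma ac_mul F p G q : ac F p -> ac G q ->
  ac (fun x => F x * G x) (fun x => p x * G x + F x * q x).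
Proof.
move=> aF aG; have aFG := ac_sqr (ac_add aF aG).
have := ac_lin (2^-1) (- 2^-1) aFG (ac_add (ac_sqr aF) (ac_sqr aG)).
by apply: eq_ac => x _; field.
Qed.

(** Freezing the power below l > 0 keeps it absolutely continuous on the half line whatever the sign
    of a. The uses look only above l, meet a factor that vanishes below, or want a constant
    there. *)
Lemma ac_powR_max (l a : R) : 0 < l ->
  ac (fun x => Num.max x l `^ a) (fun x => if l < x then a * x `^ (a - 1) else 0).
Proof.
move=> l0 x x0.
pose q y : R := a * y `^ (a - 1).
have pE : (fun y => if l < y then q y else 0) = q \_ `]l, +oo[.
  apply/funext => y; rewrite patchE; case: ifPn => ly; case: ifPn => //.
    by rewrite notin_setE/= in_itv/= ly.
  by rewrite inE/= in_itv/= (negbTE ly).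
rewrite (_ : (fun y => if _ < y then _ else _) = q \_ `]l, +oo[); last exact: pE.
have setE : `[0, x] `&` `]l, +oo[ = `]l, x]%classic :> set R.
  apply/seteqP; split => y /=; rewrite !in_itv/= ?andbT.
    by move=> [/andP[_ ->] ->].
  by move=> /andP[ly ->]; rewrite ly (ltW (lt_trans l0 ly)).
rewrite -Rintegral_mkcondr setE.
have max0 : Num.max 0 l = l by apply/max_idPr; exact: ltW.
rewrite max0 -restrict_EFin; have [xl|lx] := leP x l.
  have ->: `]l, x]%classic = set0 :> set R.
    by apply/seteqP; split => y//=; rewrite in_itv/= => /andP[ly yx]; lra.
  rewrite Rintegral_set0 addr0; split => //.
  apply/integrable_restrict => //; rewrite setE.
  have ->: `]l, x]%classic = set0 :> set R.
    by apply/seteqP; split => y//=; rewrite in_itv/= => /andP[ly yx]; lra.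
  exact: integrable_set0.
have cq : {within `[l, x], continuous q}.
  apply: derivable_within_continuous => y; rewrite in_itv/= => /andP[ly yx].
  apply: derivableM => //; apply: derivable_powR.
  by rewrite in_itv/= andbT (lt_le_trans l0).
have iq : mu.-integrable `[l, x] (EFin \o q).
  exact: continuous_compact_integrable (@segment_compact _ l x) cq.
have iq' : mu.-integrable `]l, x] (EFin \o q).
  by apply: integrableS iq => //; exact: subset_itv_oc_cc.
split; first by apply/integrable_restrict => //; rewrite setE.
rewrite Rintegral_itv_obnd_cbnd// /Rintegral.
rewrite (@continuous_FTC2 _ q (fun y => y `^ a) _ _ lx cq).
- by rewrite -EFinB/=; ring.
- have d y : 0 < y -> derivable (fun y => y `^ a) y 1.
    by move=> y0; apply: derivable_powR; rewrite in_itv/= andbT.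
  have c y : 0 < y -> {for y, continuous (fun y => y `^ a)}.
    by move=> y0; apply/differentiable_continuous/derivable1_diffP/d.
  split.
  + by move=> y; rewrite in_itv/= => /andP[ly _]; exact: d (lt_trans l0 ly).
  + exact/cvg_at_right_filter/c.
  + exact/cvg_at_left_filter/c/(lt_trans l0).
- move=> y; rewrite in_itv/= => /andP[ly _].
  by rewrite powR_derive1// in_itv/= andbT (lt_trans l0).
Qed.

End AbsolutelyContinuous.

(** * Increments and moving averages of continuous paths *)

Section Paths.
Context {R : realType}.
Notation mu := (@lebesgue_measure R).
Implicit Types (w v : R -> R) (x y M e : R).

Definition step1 w x := w (x + 1) - w x.
Definition osc1 w x := w x - Wbar w x.

Lemma continuous_rint w x y : continuous w -> mu.-integrable `[x, y] (EFin \o w).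
Proof.
move=> cw; apply: continuous_compact_integrable; first exact: segment_compact.
exact: continuous_subspaceT.
Qed.

Lemma continuous_bounded_segment w M : continuous w ->
  exists2 C : R, 0 <= C & forall x, 0 <= x <= M -> `|w x| <= C.
Proof.
move=> cw; have [M0|M0] := leP 0 M; last first.
  by exists 0 => // x /andP[x0 xM]; have := le_trans x0 xM; rewrite leNgt M0.
have cn : {within `[0, M], continuous (fun x => `|w x|)}.
  apply: continuous_subspaceT => x.
  by apply: continuous_comp; [exact: cw|exact: norm_continuous].
have [c _ hc] := EVT_max M0 cn.
by exists `|w c| => // x xM; apply: hc; rewrite in_itv.
Qed.

(** This link between the two integrands of [stoch_int] is what later lets them be merged by parts.
    The derivative comes from writing the average as a difference of two values of a primitive
    [O]. *)
Lemma ac_Wbar w : continuous w -> ac (Wbar w) (step1 w).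
Proof.
move=> cw x x0.
have cw1 : continuous (fun y => w (y + 1)).
  move=> y; apply: (@continuous_comp _ _ _ (fun y => y + 1) w); last exact: cw.
  by apply: cvgD; [exact: cvg_id|exact: cvg_cst].
have cs : continuous (step1 w).
  by move=> y; apply: cvgB; [exact: cw1|exact: cw].
split; first exact: continuous_rint.
pose O (z : R) : R := \int[mu]_(t in `[0, z]) w t.
have WO y : 0 <= y -> Wbar w y = O (y + 1) - O y.
  move=> y0; rewrite /Wbar /O.
  rewrite (@Rintegral_itvB _ w (BLeft 0) (BRight (y + 1)) y) ?bnd_simp ?lerDl//.
    rewrite -Rintegral_itv_obnd_cbnd//.
    by apply: integrableS (continuous_rint y (y + 1) cw) => //; exact: subset_itv_oc_cc.
  exact: continuous_rint.
have dO (z : R) : 0 < z -> is_derive z 1 O (w z).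
  move=> z0; have [||||d1 d2] := @continuous_FTC1_closed _ w 0 z (z + 1) => //.
  - by rewrite ltrDl.
  - exact: continuous_rint.
  - exact: cw.
  - by apply: DeriveDef => //; rewrite -derive1E.
have dO1 y : 0 <= y -> is_derive y 1 (O \o shift 1) (w (y + 1)).
  move=> y0; rewrite -[w (y + 1)]mulr1.
  apply: (@is_derive1_comp _ O (shift 1) y (w (y + 1)) 1); last exact: is_derive_shift.
  by apply: dO; rewrite /= ltr_wpDl.
have cO (y : R) : 0 <= y -> {for y, continuous (O \o shift 1)}.
  move=> y0; apply/differentiable_continuous/derivable1_diffP.
  by have [] := dO1 y y0.
have O1 : \int[mu]_(y in `[0, x]) w (y + 1) = O (x + 1) - O 1.
  move: x0; rewrite le_eqVlt => /predU1P[<-|x0].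
    by rewrite set_itv1 Rintegral_set1 add0r subrr.
  rewrite /Rintegral (@continuous_FTC2 _ (fun y => w (y + 1)) (O \o shift 1) _ _ x0).
  - by rewrite -EFinB/= add0r.
  - exact: continuous_subspaceT.
  - split => [y||]; rewrite ?in_itv/=.
    + by move=> /andP[y0 _]; have [] := dO1 y (ltW y0).
    + exact/cvg_at_right_filter/(cO 0 (lexx 0)).
    + exact/cvg_at_left_filter/(cO x (ltW x0)).
  - move=> y; rewrite in_itv/= => /andP[y0 _].
    by rewrite derive1E; have [] := dO1 y (ltW y0).
rewrite /step1 RintegralB//; [|exact: continuous_rint|exact: continuous_rint].
rewrite O1 !WO//= add0r /O set_itv1 Rintegral_set1; lra.
Qed.

Lemma Wbar_bound w (C M : R) : 0 <= C -> continuous w ->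
  (forall x, 0 <= x <= M + 1 -> `|w x| <= C) ->
  forall x, 0 <= x <= M -> `|Wbar w x| <= C.
Proof.
move=> C0 cw wC x /andP[x0 xM].
have iw := continuous_rint x (x + 1) cw.
apply: le_trans (le_normr_Rintegral _ iw) _ => //.
apply: (@le_trans _ _ (\int[mu]_(y in `[x, x + 1]) C)).
  apply: le_Rintegral => //; first exact: integrable_norm.
    by apply: continuous_rint; exact: cst_continuous.
  move=> y /=; rewrite in_itv/= => /andP[xy yx]; apply: wC.
  by rewrite (le_trans x0 xy) (le_trans yx)// lerD2r.
rewrite Rintegral_cst//= lebesgue_measure_itv/= lte_fin ltrDl ltr01 -EFinB/=.
by rewrite addrAC subrr add0r mulr1.
Qed.

Lemma WbarB w v x : continuous w -> continuous v ->
  Wbar (fun y => w y - v y) x = Wbar w x - Wbar v x.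
Proof. by move=> cw cv; rewrite /Wbar RintegralB//; exact: continuous_rint. Qed.

Lemma step1_dist w v (e M : R) : (forall x, 0 <= x <= M + 1 -> `|w x - v x| <= e) ->
  forall x, 0 <= x <= M -> `|step1 w x - step1 v x| <= 2 * e.
Proof.
move=> wv x /andP[x0 xM].
have h1 : `|w x - v x| <= e by apply: wv; rewrite x0/=; lra.
have h2 : `|w (x + 1) - v (x + 1)| <= e by apply: wv; rewrite addr_ge0//= lerD2r.
have -> : step1 w x - step1 v x = (w (x + 1) - v (x + 1)) - (w x - v x).
  by rewrite /step1; lra.
by apply: le_trans (ler_normB _ _) _; lra.
Qed.

Lemma osc1_dist w v (e M : R) : 0 <= e -> continuous w -> continuous v ->
  (forall x, 0 <= x <= M + 1 -> `|w x - v x| <= e) ->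
  forall x, 0 <= x <= M -> `|osc1 w x - osc1 v x| <= 2 * e.
Proof.
move=> e0 cw cv wv x xM; have /andP[x0 x1] := xM.
have h1 : `|w x - v x| <= e by apply: wv; rewrite x0/=; lra.
have h2 : `|Wbar (fun y => w y - v y) x| <= e.
  by apply: Wbar_bound wv _ xM => // y; apply: cvgB; [exact: cw|exact: cv].
rewrite WbarB// in h2.
have -> : osc1 w x - osc1 v x = (w x - v x) - (Wbar w x - Wbar v x).
  by rewrite /osc1; lra.
by apply: le_trans (ler_normB _ _) _; lra.
Qed.

Lemma eq_measurable_on_pos (h : R -> R) :
  (forall n, measurable_fun (`[0, n%:R]%classic : set R) h) -> measurable_fun (`[0, +oo[%classic : set R) h.
Proof.
move=> mh; have -> : `[0%R, +oo[%classic = \bigcup_n `[0%R, n%:R]%classic :> set R.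
  apply/seteqP; split => [x /=|x [n _] /=]; rewrite !in_itv/= ?andbT.
    move=> x0; exists (Num.truncn x).+1 => //=.
    by rewrite in_itv/= x0 ltW// truncnS_gt.
  by move=> /andP[].
by apply/measurable_fun_bigcup.
Qed.

Lemma ac_measurable (F p : R -> R) : ac F p ->
  measurable_fun (`[0, +oo[%classic : set R) F /\ measurable_fun (`[0, +oo[%classic : set R) p.
Proof.
move=> a; split; apply: eq_measurable_on_pos => n.
  by apply: subspace_continuous_measurable_fun => //; exact: ac_continuous a.
exact: rint_measurable (ac_integrable n%:R a).
Qed.

Lemma path_integrands_measurable w : continuous w ->
  measurable_fun (`[0, +oo[%classic : set R) (step1 w) /\ measurable_fun (`[0, +oo[%classic : set R) (osc1 w).
Proof.
move=> cw; have [mW mD] := ac_measurable (ac_Wbar cw); split=> //.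
by apply: measurable_funB => //; apply: measurable_funTS; exact: continuous_measurable_fun.
Qed.

End Paths.

Notation halfline R := (`]0, +oo[%classic : set R).

(** * Powers, and integrability of the noise weight near 0 *)

Section Powers.
Context {R : realType}.
Notation mu := (@lebesgue_measure R).
Implicit Types (x a M : R) (k : nat).

Lemma powR_le_addr1 x a : 0 < x -> 0 <= a <= 1 -> x `^ a <= 1 + x.
Proof.
move=> x0 /andP[a0 a1]; have [x1|x1] := leP x 1.
  have : x `^ a <= 1 `^ a by rewrite ge0_ler_powR// ?nnegrE// ltW.
  by rewrite powR1 => /le_trans; apply; rewrite lerDl ltW.
have : x `^ a <= x `^ 1 by rewrite ler_powR// ltW.
by rewrite powRr1 ?(ltW x0)// => /le_trans; apply; rewrite lerDr.
Qed.

Lemma ak_ge0 k : 0 <= ak k :> R.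
Proof. by rewrite /ak divr_ge0. Qed.

Lemma ak_lt_half k : ak k < 2^-1 :> R.
Proof.
have k0 : 0 <= k%:R :> R by [].
by rewrite /ak natrD natrM ltr_pdivrMr; lra.
Qed.

Lemma gk_gt0 k x : 0 < x -> 0 < gk k x.
Proof. by move=> x0; rewrite /gk powR_gt0. Qed.

Lemma pot_ge0 k x : 0 <= pot k x. Proof. exact: powR_ge0. Qed.

(** On []1/(n+1), M]] the primitive x^(1-a)/(1-a) bounds the integral independently of n, and
    monotone convergence reaches 0. The noise weight is the case a = [ak k], which is below 1/2. *)
Lemma rint_powR_near0 a M : 0 <= a < 1 ->
  mu.-integrable `]0, M] (EFin \o (fun x => x `^ (- a))).
Proof.
move=> /andP[a0 a1].
have mp (D : set R) : measurable D -> measurable_fun D (fun x : R => x `^ (- a)).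
  by move=> mD; apply: measurable_funTS; exact: measurable_powR.
apply/rint_ltyP => //; [exact: mp|by move=> x _; exact: powR_ge0|].
pose F n : set R := `]n.+1%:R^-1, M]%classic.
have UF : `]0, M]%classic = \bigcup_n F n.
  apply/seteqP; split => [x /=|x [n _] ]; rewrite /F/= !in_itv/=.
    move=> /andP[x0 xM]; exists (Num.truncn x^-1) => //=.
    rewrite /F/= in_itv/= xM andbT invf_plt ?posrE//; exact: truncnS_gt.
  by move=> /andP[nx ->]; rewrite (lt_trans _ nx)// invr_gt0.
have ndF : {homo F : n m / (n <= m)%N >-> (n <= m)%O}.
  move=> n m nm; rewrite subsetEset => x; rewrite /F/= !in_itv/= => /andP[nx ->].
  by rewrite andbT (le_lt_trans _ nx)// lef_pV2 ?posrE// ler_nat.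
have cv : (\int[mu]_(x in F i) (x `^ (- a))%:E @[i --> \oo] -->
          \int[mu]_(x in \bigcup_i F i) (x `^ (- a))%:E)%E.
  apply: ge0_nondecreasing_set_cvg_integral => //.
  - by move=> i; exact: measurable_itv.
  - by move=> i; apply/measurable_EFinP; apply: mp; rewrite /F; exact: measurable_itv.
  - by move=> i x _; rewrite lee_fin powR_ge0.
rewrite UF -(cvg_lim _ cv)//.
apply: (@le_lt_trans _ _ ((Num.max M 1 `^ (1 - a)) / (1 - a))%:E); last exact: ltry.
apply: lime_le; first by apply/cvg_ex; eexists; exact: cv.
apply: nearW => n.
have l0 : 0 < n.+1%:R^-1 :> R by rewrite invr_gt0.
have [M0|M0] := leP M 0.
  rewrite /F set_itv_ge ?bnd_simp -?leNgt ?(le_trans M0 (ltW l0))//.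
  by rewrite integral_set0 lee_fin divr_ge0 ?powR_ge0// subr_ge0 ltW.
have [ip e] := ac_powR_max (1 - a) l0 (ltW M0).
have e1 : 1 - a - 1 = - a by lra.
rewrite e1 in ip e.
have setE : `[0, M] `&` `]n.+1%:R^-1, +oo[ = F n :> set R.
  apply/seteqP; split => y /=; rewrite /F/= !in_itv/= ?andbT.
    by move=> [/andP[_ ->] ->].
  by move=> /andP[ly ->]; rewrite ly (ltW (lt_trans l0 ly)).
have pE : (fun y : R => if n.+1%:R^-1 < y then (1 - a) * y `^ (- a) else 0) =
   (fun y => (1 - a) * y `^ (- a)) \_ `]n.+1%:R^-1, +oo[.
  apply/funext => y; rewrite patchE; case: ifPn => ly; case: ifPn => //.
    by rewrite notin_setE/= in_itv/= ly.
  by rewrite inE/= in_itv/= (negbTE ly).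
rewrite pE -Rintegral_mkcondr setE in e.
have iF : mu.-integrable (F n) (EFin \o (fun y => (1 - a) * y `^ (- a))).
  by rewrite pE -restrict_EFin in ip; move/integrable_restrict : ip; rewrite setE; apply.
have iF' : mu.-integrable (F n) (EFin \o (fun y : R => y `^ (- a))).
  apply: (@eq_rint _ _ _ mu _ _ (fun y => (1 - a)^-1 * ((1 - a) * y `^ (- a)))).
    exact: measurable_itv.
    by move=> y _; rewrite mulKf//; lra.
  by apply: rintZl => //; exact: measurable_itv.
rewrite -EFin_Rintegral ?lee_fin; [|exact: measurable_itv|exact: iF'].
rewrite RintegralZl in e; [|exact: measurable_itv|exact: iF'].
rewrite ler_pdivlMr; last by lra.
have /max_idPr m0 : 0 <= n.+1%:R^-1 :> R by exact: ltW.
rewrite mulrC -[leLHS](addKr (Num.max 0 n.+1%:R^-1 `^ (1 - a))) -e.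
apply: (@le_trans _ _ (Num.max M n.+1%:R^-1 `^ (1 - a))).
  by rewrite addrC lerBlDr lerDl powR_ge0.
have l1 : n.+1%:R^-1 <= 1 :> R by rewrite invf_le1// ler1n.
apply: ge0_ler_powR; rewrite ?nnegrE ?subr_ge0 ?(ltW a1)//.
- by rewrite le_max (ltW M0).
- by rewrite le_max (ltW M0).
- by rewrite ge_max !le_max lexx l1 orbT.
Qed.

End Powers.

(** * Integrals over the half line as limits over segments *)

Section HalfLine.
Context {R : realType}.
Notation mu := (@lebesgue_measure R).
Notation H := (halfline R).
Implicit Types (x M e : R) (h : R -> R).

Lemma halflineE : H = \bigcup_n (`]0, n%:R]%classic : set R).
Proof.
apply/seteqP; split => [x /=|x [n _] /=]; rewrite !in_itv/= ?andbT.
  move=> x0; exists (Num.truncn x).+1 => //=.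
  by rewrite in_itv/= x0 ltW// truncnS_gt.
by move=> /andP[].
Qed.

Lemma halfline_sub_ge0 : H `<=` (`[0, +oo[%classic : set R).
Proof. by move=> x /=; rewrite !in_itv/= !andbT; exact: ltW. Qed.

Lemma le_halfline_segments h (C : R) : measurable_fun H h ->
  (forall x, H x -> 0 <= h x) ->
  (forall n, \int[mu]_(x in `]0%R, n%:R%R]) (h x)%:E <= C%:E)%E ->
  (\int[mu]_(x in H) (h x)%:E <= C%:E)%E.
Proof.
move=> mh h0 hC.
have sub n : (`]0, n%:R]%classic : set R) `<=` H.
  by move=> x /=; rewrite !in_itv/= => /andP[-> _].
have cv : (\int[mu]_(x in `]0%R, n%:R%R]) (h x)%:E @[n --> \oo] -->
          \int[mu]_(x in \bigcup_n (`]0%R, n%:R%R]%classic : set R)) (h x)%:E)%E.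
  apply: ge0_nondecreasing_set_cvg_integral => //.
  - move=> n m nm; rewrite subsetEset => x /=; rewrite !in_itv/= => /andP[-> xn] /=.
    by rewrite (le_trans xn)// ler_nat.
  - move=> n; apply/measurable_EFinP; apply: measurable_funS mh => //; exact: sub.
  - by move=> i x xi; rewrite lee_fin h0//; exact: sub xi.
rewrite halflineE -(cvg_lim _ cv)//.
apply: lime_le; first by apply/cvg_ex; eexists; exact: cv.
exact: nearW.
Qed.

(** If every tail exceeded e, every initial segment would carry at most S - e, and so would the
    whole half line, whose integral is [S]. *)
Lemma tail_small h e : mu.-integrable H (EFin \o h) ->
  (forall x, H x -> 0 <= h x) -> 0 < e ->
  exists n : nat, \int[mu]_(x in `]n%:R, +oo[) h x <= e.
Proof.
move=> ih h0 e0; apply: contrapT => /forallNP hn.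
set S := \int[mu]_(x in H) h x.
have : (\int[mu]_(x in H) (h x)%:E <= (S - e)%:E)%E.
  apply: le_halfline_segments => // [|n]; first exact: (rint_measurable ih).
  have i1 : mu.-integrable `]0, n%:R] (EFin \o h).
    by apply: integrableS ih => // x /=; rewrite !in_itv/= => /andP[->].
  rewrite -EFin_Rintegral// lee_fin.
  have /negP := hn n; rewrite -ltNge => hn'.
  have -> : S = \int[mu]_(x in `]0, n%:R]) h x + \int[mu]_(x in `]n%:R, +oo[) h x.
    rewrite /S -(@Rintegral_itvB _ h (BRight 0) (BInfty _ false) n%:R) ?bnd_simp//.
    by rewrite addrC subrK.
  by lra.
by rewrite -EFin_Rintegral// lee_fin; rewrite -/S; lra.
Qed.

Lemma Rintegral_le_halfline h (A : set R) : measurable A -> A `<=` H ->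
  mu.-integrable H (EFin \o h) -> (forall x, H x -> 0 <= h x) ->
  \int[mu]_(x in A) h x <= \int[mu]_(x in H) h x.
Proof.
move=> mA AH ih h0.
have iA : mu.-integrable A (EFin \o h) by apply: integrableS ih.
rewrite -lee_fin !EFin_Rintegral//.
apply: ge0_subset_integral => //; exact: (measurable_int _ ih).
Qed.

Lemma cst_rint_oc (x y c : R) : mu.-integrable `]x, y] (EFin \o (fun _ => c)).
Proof.
have := @continuous_rint _ (fun _ => c) x y (@cst_continuous _ _ c).
by apply: integrableS => //; exact: subset_itv_oc_cc.
Qed.

End HalfLine.

(** * Functions of finite energy *)

Section FiniteEnergy.
Context {R : realType}.
Notation mu := (@lebesgue_measure R).
Notation H := (halfline R).
Implicit Types (x M e : R) (f df w : R -> R) (k : nat).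

(** The class [Lstar] with its integrals separately available and without normalization, because
    truncating and gluing do not preserve the norm. The domain is the open half line, as in
    [stoch_int]. *)
Definition finen k f df :=
  [/\ ac f df, f 0 = 0,
      mu.-integrable H (EFin \o (fun x => df x ^+ 2)),
      mu.-integrable H (EFin \o (fun x => pot k x * f x ^+ 2)) &
      mu.-integrable H (EFin \o (fun x => f x ^+ 2))].

(* The two integrands of [stoch_int]. *)
Definition chan k w (c : bool) f df x : R :=
  if c then f x ^+ 2 * gk k x * step1 w x
  else (2 * f x * df x * gk k x + f x ^+ 2 * dgk k x) * osc1 w x.

Section Fixed.
Context (k : nat) (f df : R -> R).
Hypothesis fe : finen k f df.

Lemma finen_measurable : measurable_fun H f /\ measurable_fun H df.
Proof.
have [a _ _ _ _] := fe; have [m1 m2] := ac_measurable a.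
by split; [apply: measurable_funS m1|apply: measurable_funS m2] => //;
  exact: halfline_sub_ge0.
Qed.

(** This is Cauchy-Schwarz applied to f(x) as the integral of df, obtained from |df| <= t/2 +
    df^2/(2t). The linear decay at 0 is what pays for the singular weights [gk] and [dgk]. *)
Lemma finen_sqr_near0 : exists2 K : R, 0 < K & forall x, 0 <= x -> f x ^+ 2 <= K * x.
Proof.
have [a f0 i1 _ _] := fe.
pose K := \int[mu]_(x in H) (df x ^+ 2) + 1.
have K0 : 0 < K.
  by rewrite /K ltr_pwDr// Rintegral_ge0// => x _; exact: sqr_ge0.
exists K => // x; rewrite le_eqVlt => /predU1P[<-|x0].
  by rewrite f0 expr0n mulr0.
(* This t balances the two terms, each of which integrates to at most t x / 2. The 1 added in [K]
   makes t positive. *)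
pose t := Num.sqrt (K / x).
have t0 : 0 < t by rewrite sqrtr_gt0 divr_gt0.
have t2 : t ^+ 2 = K / x by rewrite sqr_sqrtr// divr_ge0 ?ltW.
have idf : mu.-integrable `]0, x] (EFin \o df) by exact: ac_integrable_oc a.
have sub : (`]0, x]%classic : set R) `<=` H.
  by move=> y /=; rewrite !in_itv/= => /andP[->].
have i2 : mu.-integrable `]0, x] (EFin \o (fun x => df x ^+ 2)).
  by apply: integrableS i1.
have ft : `|f x| <= t * x.
  have -> : f x = f x - f 0 by rewrite f0 subr0.
  rewrite (ac_sub (lexx 0) (ltW x0) a).
  apply: le_trans (le_normr_Rintegral _ idf) _ => //.
  have ic : mu.-integrable `]0, x] (EFin \o (fun _ => t / 2)).
    exact: cst_rint_oc.
  have i3 : mu.-integrable `]0, x] (EFin \o (fun y => (2 * t)^-1 * df y ^+ 2)).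
    exact: rintZl.
  apply: (@le_trans _ _ (\int[mu]_(y in `]0, x]) (t / 2 + (2 * t)^-1 * df y ^+ 2))).
    apply: le_Rintegral => //; [exact: integrable_norm|exact: rintD|].
    move=> y _; rewrite -(real_normK (num_real (df y))).
    have : 0 <= (t - `|df y|) ^+ 2 / (2 * t) by rewrite divr_ge0 ?sqr_ge0// mulr_ge0// ltW.
    have -> : (t - `|df y|) ^+ 2 / (2 * t) = t / 2 + (2 * t)^-1 * `|df y| ^+ 2 - `|df y|.
      by field; rewrite gt_eqF.
    by rewrite subr_ge0.
  rewrite RintegralD// Rintegral_cst//= RintegralZl//.
  rewrite lebesgue_measure_itv/= lte_fin x0 oppr0 adde0/=.
  have le1 : \int[mu]_(y in `]0, x]) df y ^+ 2 <= K.
    apply: le_trans (Rintegral_le_halfline _ sub i1 _) _ => //.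
      by move=> y _; exact: sqr_ge0.
    by rewrite /K lerDl.
  have : (2 * t)^-1 * \int[mu]_(y in `]0, x]) df y ^+ 2 <= (2 * t)^-1 * K.
    by rewrite ler_wpM2l// invr_ge0 mulr_ge0// ltW.
  have -> : (2 * t)^-1 * K = t / 2 * x.
    have -> : K = t ^+ 2 * x by rewrite t2 divfK// gt_eqF.
    by field; rewrite gt_eqF.
  by lra.
rewrite -(real_normK (num_real (f x))).
apply: (@le_trans _ _ ((t * x) ^+ 2)).
  by rewrite lerXn2r// ?nnegrE ?mulr_ge0// ltW.
by rewrite exprMn t2 expr2 mulrA divfK// gt_eqF.
Qed.

(** The derivative 2 f df of f^2 is dominated by f^2 + df^2. *)
Lemma finen_sqr_diff x y : 0 <= x -> x <= y ->
  `|f y ^+ 2 - f x ^+ 2| <= \int[mu]_(t in `]x, +oo[) (f t ^+ 2 + df t ^+ 2).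
Proof.
move=> x0 xy; have [a f0 i1 _ i2] := fe.
have a2 := ac_sqr a.
rewrite (ac_sub x0 xy a2).
have ix : mu.-integrable `]x, y] (EFin \o (fun t => 2 * f t * df t)).
  exact: ac_integrable_oc a2.
have sub : (`]x, +oo[%classic : set R) `<=` H.
  by move=> z /=; rewrite !in_itv/= !andbT => xz; exact: le_lt_trans xz.
have sub2 : (`]x, y]%classic : set R) `<=` `]x, +oo[%classic.
  by move=> z /=; rewrite !in_itv/= => /andP[->].
have is_ : mu.-integrable `]x, +oo[ (EFin \o (fun t => f t ^+ 2 + df t ^+ 2)).
  have : mu.-integrable H (EFin \o (fun t => f t ^+ 2 + df t ^+ 2)) by exact: rintD.
  exact: integrableS.
have isy : mu.-integrable `]x, y] (EFin \o (fun t => f t ^+ 2 + df t ^+ 2)).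
  by apply: integrableS is_.
apply: le_trans (le_normr_Rintegral _ ix) _ => //.
apply: (@le_trans _ _ (\int[mu]_(t in `]x, y]) (f t ^+ 2 + df t ^+ 2))).
  apply: le_Rintegral => //; first exact: integrable_norm.
  move=> t _; rewrite ler_norml; have := sqr_ge0 (f t + df t); have := sqr_ge0 (f t - df t).
  by move=> h1 h2; apply/andP; split; nra.
rewrite -lee_fin !EFin_Rintegral//; apply: ge0_subset_integral => //.
  exact: (measurable_int _ is_).
by move=> t _; rewrite lee_fin addr_ge0 ?sqr_ge0.
Qed.

Lemma finen_bounded : exists2 C : R, 0 <= C & forall x, 0 <= x -> f x ^+ 2 <= C.
Proof.
have [a f0 i1 _ i2] := fe.
exists (\int[mu]_(t in H) (f t ^+ 2 + df t ^+ 2)).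
  by apply: Rintegral_ge0 => t _; rewrite addr_ge0 ?sqr_ge0.
move=> x x0; have := finen_sqr_diff (lexx 0) x0.
by rewrite f0 expr0n subr0 ger0_norm// sqr_ge0.
Qed.

(** Past a point where the tail of f^2 + df^2 is at most e^2/2, a value |f(x)| > e would force f^2
    >= e^2/2 on all of [[x, +oo[], against the integrability of f^2. *)
Lemma finen_vanish e : 0 < e -> exists2 M : R, 0 < M & forall x, M <= x -> `|f x| <= e.
Proof.
move=> e0; have [a f0 i1 _ i2] := fe.
have i12 : mu.-integrable H (EFin \o (fun t => f t ^+ 2 + df t ^+ 2)) by exact: rintD.
have e20 : 0 < e ^+ 2 / 2 by rewrite divr_gt0// exprn_gt0.
have [|n hn] := @tail_small _ _ _ i12 _ e20.
  by move=> x _; rewrite addr_ge0 ?sqr_ge0.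
exists n.+1%:R => // x nx; rewrite leNgt; apply/negP => fx.
have x0 : 0 <= x by apply: le_trans nx.
have nx' : n%:R <= x by apply: le_trans nx; rewrite ler_nat.
have fy y : x <= y -> e ^+ 2 / 2 <= f y ^+ 2.
  move=> xy; have n0 : 0 <= n%:R :> R by [].
  have fx2 : e ^+ 2 < f x ^+ 2.
    rewrite -(real_normK (num_real (f x))) ltrXn2r// ?nnegrE// ltW//.
  have := finen_sqr_diff x0 xy.
  have : \int[mu]_(t in `]x, +oo[) (f t ^+ 2 + df t ^+ 2) <= e ^+ 2 / 2.
    apply: le_trans hn; rewrite -lee_fin.
    have sub (z : R) : 0 <= z -> (`]z, +oo[%classic : set R) `<=` H.
      by move=> z0 t /=; rewrite !in_itv/= !andbT => xz; exact: le_lt_trans xz.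
    have inz (z : R) : 0 <= z -> mu.-integrable `]z, +oo[ (EFin \o (fun t => f t ^+ 2 + df t ^+ 2)).
      by move=> z0; apply: integrableS i12 => //; exact: sub.
    rewrite !EFin_Rintegral//; [|exact: inz|exact: inz].
    apply: ge0_subset_integral => //; first exact: (measurable_int _ (inz _ n0)).
      by move=> t _; rewrite lee_fin addr_ge0 ?sqr_ge0.
    by move=> t /=; rewrite !in_itv/= !andbT; exact: le_lt_trans.
  rewrite ler_norml => h1 /andP[h2 _]; lra.
pose S := \int[mu]_(t in H) f t ^+ 2.
have S0 : 0 <= S by apply: Rintegral_ge0 => t _; exact: sqr_ge0.
(* On an interval of this length the constant e^2/2 integrates to S + e^2/2, more than the whole
   norm [S]. *)
pose L := 2 * S / e ^+ 2 + 1.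
have L0 : 0 < L by rewrite ltr_wpDl// divr_ge0 ?sqr_ge0// mulr_ge0.
have sub : (`]x, x + L]%classic : set R) `<=` H.
  by move=> t /=; rewrite !in_itv/= => /andP[xt _]; rewrite (le_lt_trans x0 xt).
have : \int[mu]_(t in `]x, x + L]) (e ^+ 2 / 2) <= S.
  apply: le_trans (Rintegral_le_halfline _ sub i2 _) => //; last by move=> ? _; exact: sqr_ge0.
  apply: le_Rintegral => //; last 2 first.
  - by apply: integrableS i2.
  - by move=> t /=; rewrite in_itv/= => /andP[xt _]; apply: fy; exact: ltW.
  exact: cst_rint_oc.
rewrite Rintegral_cst//= lebesgue_measure_itv/= lte_fin ltrDl L0 -EFinB/=.
have -> : e ^+ 2 / 2 * (x + L - x) = S + e ^+ 2 / 2.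
  by rewrite /L; field; rewrite gt_eqF.
by lra.
Qed.

End Fixed.
End FiniteEnergy.

(** * The two integrands of the pathwise Wiener integral *)

Section Channels.
Context {R : realType}.
Notation mu := (@lebesgue_measure R).
Notation H := (halfline R).
Implicit Types (x M e : R) (f df w : R -> R) (k : nat).

Definition incr w (c : bool) x : R := if c then step1 w x else osc1 w x.

(** One majorant, free of the path, for the coefficients of both channels; the path then enters only
    through the size of its increments. *)
Definition envelope k f df x : R :=
  (`|f x| * `|df x| + f x ^+ 2) * gk k x + f x ^+ 2 * `|dgk k x|.

Lemma envelope_ge0 k f df x : 0 <= envelope k f df x.
Proof.
have g0 : 0 <= gk k x by exact: powR_ge0.
apply: addr_ge0; apply: mulr_ge0 => //; last exact: sqr_ge0.
by apply: addr_ge0; [exact: mulr_ge0|exact: sqr_ge0].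
Qed.

Definition coef k (c : bool) f df x : R :=
  if c then f x ^+ 2 * gk k x else 2 * f x * df x * gk k x + f x ^+ 2 * dgk k x.

Lemma chanE k w c f df x : chan k w c f df x = coef k c f df x * incr w c x.
Proof. by rewrite /chan /coef /incr; case: c. Qed.

Lemma coef_le_envelope k c f df x : `|coef k c f df x| <= 2 * envelope k f df x.
Proof.
have g0 : 0 <= gk k x by exact: powR_ge0.
have h2 : 0 <= f x ^+ 2 * gk k x by rewrite mulr_ge0 ?sqr_ge0.
have h3 : 0 <= f x ^+ 2 * `|dgk k x| by rewrite mulr_ge0 ?sqr_ge0.
case: c; rewrite /coef /envelope.
  rewrite normrM (ger0_norm (sqr_ge0 _)) (ger0_norm g0).
  have h1 : 0 <= `|f x| * `|df x| * gk k x by rewrite !mulr_ge0.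
  by move: h1 h2 h3; lra.
apply: le_trans (ler_normD _ _) _.
have -> : `|2 * f x * df x * gk k x| = 2 * `|f x| * `|df x| * gk k x.
  by rewrite !normrM (ger0_norm g0) ger0_norm.
have -> : `|f x ^+ 2 * dgk k x| = f x ^+ 2 * `|dgk k x|.
  by rewrite normrM (ger0_norm (sqr_ge0 _)).
by move: h2 h3; lra.
Qed.

Lemma chan_le_envelope k w c f df x :
  `|chan k w c f df x| <= 2 * envelope k f df x * `|incr w c x|.
Proof. by rewrite chanE normrM ler_wpM2r// coef_le_envelope. Qed.

Lemma gk_measurable k (D : set R) : measurable D -> measurable_fun D (gk k).
Proof. by move=> mD; apply: measurable_funTS; exact: measurable_powR. Qed.

Lemma dgk_measurable k (D : set R) : measurable D -> measurable_fun D (dgk k).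
Proof.
move=> mD; apply: measurable_funM => //.
by apply: measurable_funTS; exact: measurable_powR.
Qed.

Lemma pot_measurable k (D : set R) : measurable D -> measurable_fun D (pot k).
Proof. by move=> mD; apply: measurable_funTS; exact: measurable_powR. Qed.

Lemma incr_measurable w c : continuous w -> measurable_fun H (incr w c).
Proof.
move=> cw; have [m1 m2] := path_integrands_measurable cw.
by rewrite /incr; case: c; apply: measurable_funS (@halfline_sub_ge0 R) _.
Qed.

Lemma incr_bounded_segment w M : continuous w ->
  exists2 C : R, 0 <= C & forall c x, 0 <= x <= M -> `|incr w c x| <= C.
Proof.
move=> cw; have [C C0 hC] := continuous_bounded_segment (M + 1) cw.
exists (2 * C) => [|c x xM]; first exact: mulr_ge0.
have c0 : continuous (fun _ : R => 0 : R) by exact: cst_continuous.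
have hw y : 0 <= y <= M + 1 -> `|w y - 0| <= C by rewrite subr0; exact: hC.
rewrite /incr; case: c.
  by have := step1_dist hw xM; rewrite /step1 subrr subr0.
have := osc1_dist C0 cw c0 hw xM.
by rewrite /osc1 /Wbar /Rintegral integral0 /= !subr0.
Qed.

Section Fixed.
Context (k : nat) (f df : R -> R).
Hypothesis fe : finen k f df.

Lemma envelope_measurable : measurable_fun H (envelope k f df).
Proof.
have [mf mdf] := finen_measurable fe.
have mg := @gk_measurable k H (measurable_itv _).
have mdg := @dgk_measurable k H (measurable_itv _).
apply: measurable_funD; apply: measurable_funM => //; last 2 first.
- exact: measurable_funX.
- exact: measurableT_comp.
apply: measurable_funD; last exact: measurable_funX.
by apply: measurable_funM; exact: measurableT_comp.
Qed.

Lemma chan_measurable w c : continuous w -> measurable_fun H (chan k w c f df).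
Proof.
move=> cw; have mi := incr_measurable c cw; move: mi.
have [mf mdf] := finen_measurable fe.
have mg := @gk_measurable k H (measurable_itv _).
have mdg := @dgk_measurable k H (measurable_itv _).
have mf2 : measurable_fun H (fun x => f x ^+ 2) by exact: measurable_funX.
rewrite /chan /incr; case: c => mi.
  by apply: measurable_funM => //; exact: measurable_funM.
apply: measurable_funM => //; apply: measurable_funD; last exact: measurable_funM.
by apply: measurable_funM => //; apply: measurable_funM => //; exact: measurable_funM.
Qed.

(** Nothing can diverge at 0. With alpha = [ak k], the bound f^2 <= K x gives |f| gk <= sqrt(K x^(1
    - 2 alpha)), bounded since alpha < 1/2, and f^2 |dgk| <= K x^(-alpha), which is integrable.
    Divergence is a matter of infinity alone. *)
Lemma envelope_rint M : mu.-integrable `]0, M] (EFin \o envelope k f df).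
Proof.
have [a f0 i1 _ _] := fe.
have [K K0 hK] := finen_sqr_near0 fe.
have [B B0 hB] := finen_bounded fe.
pose C := Num.sqrt (K * (1 + `|M|)).
have C0 : 0 <= C by exact: sqrtr_ge0.
have sub : (`]0, M]%classic : set R) `<=` H.
  by move=> x /=; rewrite !in_itv/= => /andP[->].
have idf : mu.-integrable `]0, M] (EFin \o df) by exact: ac_integrable_oc a.
have ig : mu.-integrable `]0, M] (EFin \o gk k).
  apply: rint_powR_near0; rewrite ak_ge0/=.
  by apply: lt_trans (ak_lt_half k) _; lra.
apply: (@rint_le _ _ _ mu _ _ _
  (fun x => C * `|df x| + (C * Num.sqrt B + K * gk k x))) => //.
- exact: measurable_funS envelope_measurable.
- move=> x; rewrite /= in_itv/= => /andP[x0 xM].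
  rewrite ger0_norm ?envelope_ge0// /envelope.
  have g0 : 0 <= gk k x by exact: powR_ge0.
  have fx := hK _ (ltW x0).
  have hf : `|f x| <= Num.sqrt B.
    by rewrite -sqrtr_sqr ler_wsqrtr// hB// ltW.
  have hfg : `|f x| * gk k x <= C.
    rewrite -(ger0_norm g0) -normrM -sqrtr_sqr ler_wsqrtr// exprMn.
    apply: (@le_trans _ _ (K * x * gk k x ^+ 2)); first by rewrite ler_wpM2r// sqr_ge0.
    rewrite -mulrA ler_wpM2l ?(ltW K0)//.
    have -> : x * gk k x ^+ 2 = x `^ (1 - 2 * ak k).
      have -> : 1 - 2 * ak k = 1 + (- ak k + - ak k) :> R by lra.
      rewrite !powRD ?(gt_eqF x0) ?implybT//.
      by rewrite powRr1 ?ltW// /gk expr2.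
    have e01 : 0 <= 1 - 2 * @ak R k <= 1.
      by have := @ak_ge0 R k; have := @ak_lt_half R k; lra.
    apply: (le_trans (@powR_le_addr1 _ _ _ x0 e01)).
    by rewrite lerD2l; have := ler_norm M; lra.
  have h1 : `|f x| * `|df x| * gk k x <= C * `|df x|.
    by rewrite mulrAC ler_wpM2r.
  have h2 : f x ^+ 2 * gk k x <= C * Num.sqrt B.
    rewrite -(real_normK (num_real (f x))) expr2 -mulrA mulrC.
    by apply: ler_pM => //; exact: mulr_ge0.
  have h3 : f x ^+ 2 * `|dgk k x| <= K * gk k x.
    have -> : `|dgk k x| = ak k * (gk k x / x).
      rewrite /dgk mulNr normrN ger0_norm ?mulr_ge0 ?ak_ge0 ?powR_ge0//.
      by rewrite powRD ?(gt_eqF x0) ?implybT// powR_inv1 ?ltW.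
    apply: (@le_trans _ _ (K * x * (ak k * (gk k x / x)))).
      by rewrite ler_wpM2r// mulr_ge0 ?ak_ge0// divr_ge0// ltW.
    have -> : K * x * (ak k * (gk k x / x)) = ak k * (K * gk k x).
      by field; rewrite gt_eqF.
    rewrite ler_piMl ?mulr_ge0 ?(ltW K0)//.
    by have := @ak_lt_half R k; lra.
  by move: h1 h2 h3; lra.
- apply: rintD => //; first by apply: rintZl => //; exact: integrable_norm.
  by apply: rintD => //; [exact: cst_rint_oc|exact: rintZl].
Qed.

Lemma chan_rint_segment w c M : continuous w ->
  mu.-integrable `]0, M] (EFin \o chan k w c f df).
Proof.
move=> cw.
have sub : (`]0, M]%classic : set R) `<=` H.
  by move=> x /=; rewrite !in_itv/= => /andP[->].
have [C C0 hC] := incr_bounded_segment M cw.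
apply: (@rint_le _ _ _ mu _ _ _ (fun x => (2 * C) * envelope k f df x)) => //.
- exact: measurable_funS (chan_measurable c cw).
- move=> x; rewrite /= in_itv/= => /andP[x0 xM].
  apply: le_trans (chan_le_envelope _ _ _ _ _ _) _.
  have hi : `|incr w c x| <= C by apply: hC; rewrite xM ltW.
  have e0 := envelope_ge0 k f df x.
  rewrite -[leRHS]mulrA mulrCA; nra.
- by apply: rintZl => //; exact: envelope_rint.
Qed.

End Fixed.

Lemma rint_vanish (h : R -> R) M : measurable_fun H h ->
  mu.-integrable `]0, M] (EFin \o h) -> (forall x, 0 < x -> M < x -> h x = 0) ->
  mu.-integrable H (EFin \o h).
Proof.
move=> mh ih h0.
have e : H `&` `]0, M]%classic = `]0, M]%classic :> set R.
  by apply/setIidPr => x /=; rewrite !in_itv/= => /andP[->].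
apply: (@eq_integrable _ _ _ mu _ _ ((EFin \o h) \_ `]0, M])) => //.
  move=> x; rewrite inE/= in_itv/= andbT => x0.
  rewrite patchE; case: ifPn => //; rewrite notin_setE/= in_itv/= x0/= => /negP.
  by rewrite -ltNge => /h0 ->.
by apply/integrable_restrict => //; rewrite e.
Qed.

(** [df] has to vanish pointwise off the support as well: it is only a version of the derivative,
    and the channels are evaluated pointwise. *)
Definition bumpf k l r f df :=
  [/\ 0 < l, finen k f df &
      forall x, 0 <= x -> (x < l) || (r < x) -> f x = 0 /\ df x = 0].

Lemma chan_eq0 k w c f df x : f x = 0 -> df x = 0 -> chan k w c f df x = 0.
Proof. by move=> f0 d0; rewrite /chan f0 d0; case: c; rewrite expr0n/= !(mulr0, mul0r, addr0). Qed.

Lemma bumpf_chan_rint k l r f df w c : continuous w -> bumpf k l r f df ->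
  mu.-integrable H (EFin \o chan k w c f df).
Proof.
move=> cw [l0 fe h0]; apply: (@rint_vanish _ r).
- exact: chan_measurable.
- exact: chan_rint_segment.
- move=> x x0 rx; have [f0 d0] := h0 x (ltW x0) (introT orP (or_intror rx)).
  exact: chan_eq0.
Qed.

Lemma bumpf_envelope_rint k l r f df : bumpf k l r f df ->
  mu.-integrable H (EFin \o envelope k f df).
Proof.
move=> [l0 fe h0]; apply: (@rint_vanish _ r).
- exact: envelope_measurable.
- exact: envelope_rint.
- move=> x x0 rx; have [f0 d0] := h0 x (ltW x0) (introT orP (or_intror rx)).
  by rewrite /envelope f0 d0 expr0n/= normr0 !(mul0r, addr0).
Qed.

(** The exponents satisfy 1/(2k+1) = 1 - 2 alpha. For |Y| <= sqrt x this gives (gk Y)^2 <= pot, the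
    inequality by which the potential absorbs ordinary noise. *)
Lemma pot_sqr_gk k x : 0 < x -> pot k x = x * gk k x ^+ 2.
Proof.
move=> x0; rewrite /gk expr2 -powRD ?(gt_eqF x0) ?implybT//.
rewrite -[in X in X * _](powRr1 (ltW x0)) -powRD ?(gt_eqF x0) ?implybT//.
rewrite /pot; congr (_ `^ _); rewrite /ak.
have k0 : 0 <= k%:R :> R by [].
rewrite natrD natrM; field; lra.
Qed.

Lemma chan_le_bound k f df w c x : 0 < x ->
  `|chan k w c f df x| <=
  2 * `|f x| * `|df x| * gk k x * `|incr w c x| * (~~ c)%:R
  + f x ^+ 2 * (if c then gk k x else `|dgk k x|) * `|incr w c x|.
Proof.
move=> x0; have g0 := gk_gt0 k x0.
case: c; rewrite /chan /incr normrM /= ?mulr0 ?add0r ?mulr1 ?mulr0n ?mulr0 ?add0r.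
  by rewrite normrM (ger0_norm (sqr_ge0 _)) (ger0_norm (ltW g0)).
rewrite -mulrDl ler_wpM2r//; apply: le_trans (ler_normD _ _) _.
rewrite lerD//; last by rewrite normrM (ger0_norm (sqr_ge0 _)).
by rewrite !normrM (ger0_norm (ltW g0)) ger0_norm.
Qed.

(* Either [Y ^+ 2 <= x], and the potential absorbs the increment [Y],
   or [1 < Y ^+ 2 / x], and powers of this ratio raise the moment. *)
Lemma moment_dichotomy (x g p dg Y F D B z : R) (c : bool) :
  1 < x -> 0 < g -> g <= 1 -> 1 <= p -> p = x * g ^+ 2 -> `|dg| <= g ->
  F ^+ 2 <= B ->
  z <= 2 * `|F| * `|D| * g * `|Y| * (~~ c)%:R
       + F ^+ 2 * (if c then g else `|dg|) * `|Y| ->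
  z <= D ^+ 2 + 2 * (p * F ^+ 2) + (4 * B) * (x ^- 2 * (1 + Y ^+ 6)).
Proof.
move=> x1 g0 g1 p1 pE dg1 FB.
have x0 : 0 < x by exact: lt_trans x1.
have B0 : 0 <= B by apply: le_trans FB; exact: sqr_ge0.
have F0 := sqr_ge0 F; have D0 := sqr_ge0 D.
have x2 : 0 < x ^+ 2 by exact: exprn_gt0.
pose m := x ^- 2 * (1 + Y ^+ 6).
have Y6 : Y ^+ 6 = `|Y| ^+ 6 by rewrite -normrX ger0_norm// (exprM Y 3 2) sqr_ge0.
have m0 : 0 <= m.
  by rewrite mulr_ge0 ?invr_ge0 ?(ltW x2)// addr_ge0// Y6 exprn_ge0.
have y0 := normr_ge0 Y.
have P1 : F ^+ 2 * g * `|Y| <= p * F ^+ 2 + B * m.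
  have [yx|xy] := leP (`|Y| ^+ 2) x.
    have yg : g * `|Y| <= p.
      have yg2 : (g * `|Y|) ^+ 2 <= p ^+ 2.
        rewrite exprMn; apply: (@le_trans _ _ (x * g ^+ 2)).
          by rewrite mulrC ler_wpM2r ?sqr_ge0.
        by rewrite -pE; nra.
      have p0 : 0 <= p by lra.
      have gy0 : 0 <= g * `|Y| by rewrite mulr_ge0// ltW.
      by move: yg2; rewrite ler_pXn2r.
    rewrite -mulrA; apply: (@le_trans _ _ (F ^+ 2 * p)); first by rewrite ler_wpM2l.
    by rewrite [leLHS]mulrC lerDl mulr_ge0.
  apply: (@le_trans _ _ (B * m)); last by rewrite lerDr mulr_ge0//; lra.
  apply: (@le_trans _ _ (B * `|Y|)).
    rewrite ler_wpM2r//; nra.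
  rewrite ler_wpM2l// /m mulrC ler_pdivlMr// Y6.
  have y1 : 1 <= `|Y| by nra.
  have : x ^+ 2 <= (`|Y| ^+ 2) ^+ 2 by rewrite lerXn2r ?nnegrE ?(ltW x0) ?sqr_ge0 ?(ltW xy).
  rewrite -exprM => h.
  apply: (@le_trans _ _ (`|Y| * `|Y| ^+ 4)); first by rewrite ler_wpM2l.
  rewrite -exprS; apply: (@le_trans _ _ (`|Y| ^+ 6)); last by rewrite lerDr.
  by rewrite ler_weXn2l.
case: c => /=.
  rewrite mulr0n mulr0 add0r => /le_trans; apply; apply: le_trans P1 _.
  have : 0 <= p * F ^+ 2 by rewrite mulr_ge0//; lra.
  have : 0 <= B * m by rewrite mulr_ge0.
  by rewrite -/m; lra.
(* This term fixes the sixth power: when x < Y^2, one has Y^2 <= Y^2 (Y^2/x)^2 = Y^6/x^2. *)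
have P2 : F ^+ 2 * (g ^+ 2 * `|Y| ^+ 2) <= p * F ^+ 2 + B * m.
  have [yx|xy] := leP (`|Y| ^+ 2) x.
    apply: (@le_trans _ _ (F ^+ 2 * p)); last by rewrite [leLHS]mulrC lerDl mulr_ge0.
    by rewrite ler_wpM2l// pE mulrC ler_wpM2r ?sqr_ge0.
  apply: (@le_trans _ _ (B * m)); last by rewrite lerDr mulr_ge0//; lra.
  have gy : g ^+ 2 * `|Y| ^+ 2 <= `|Y| ^+ 2.
    by rewrite ler_piMl ?sqr_ge0// expr_le1// ltW.
  apply: (@le_trans _ _ (B * `|Y| ^+ 2)).
    by apply: ler_pM => //; rewrite mulr_ge0 ?sqr_ge0.
  rewrite ler_wpM2l// /m mulrC ler_pdivlMr// Y6.
  have : x ^+ 2 <= (`|Y| ^+ 2) ^+ 2 by rewrite lerXn2r ?nnegrE ?(ltW x0) ?sqr_ge0 ?(ltW xy).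
  rewrite -exprM => h.
  apply: (@le_trans _ _ (`|Y| ^+ 2 * `|Y| ^+ 4)); first by rewrite ler_wpM2l ?sqr_ge0.
  by rewrite -exprD lerDr.
(* Young's inequality splits off [D ^+ 2] and leaves the square treated in [P2]. *)
have P3 : 2 * `|F| * `|D| * g * `|Y| <= D ^+ 2 + F ^+ 2 * (g ^+ 2 * `|Y| ^+ 2).
  rewrite -(real_normK (num_real F)) -(real_normK (num_real D)).
  have := sqr_ge0 (`|D| - `|F| * g * `|Y|).
  rewrite (_ : (`|D| - `|F| * g * `|Y|) ^+ 2 =
    `|D| ^+ 2 + `|F| ^+ 2 * (g ^+ 2 * `|Y| ^+ 2) - 2 * `|F| * `|D| * g * `|Y|); last by ring.
  by rewrite subr_ge0.
have P4 : F ^+ 2 * `|dg| * `|Y| <= F ^+ 2 * g * `|Y|.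
  by rewrite ler_wpM2r// ler_wpM2l.
rewrite mulr1 -/m => h.
have : 0 <= B * m by rewrite mulr_ge0.
by move: P1 P2 P3 P4 h; lra.
Qed.

(** Up to 1 the convergence is automatic. Beyond 1 one has gk <= 1 <= pot and |dgk| <= gk, so the
    pointwise dichotomy provides the integrable majorant [b]. *)
Lemma chan_rint_moment k f df w c : continuous w -> finen k f df ->
  mu.-integrable `]1, +oo[ (EFin \o (fun x => x ^- 2 * (1 + incr w c x ^+ 6))) ->
  mu.-integrable H (EFin \o chan k w c f df).
Proof.
move=> cw fe im; have [a f0 i1 i2 i3] := fe.
have [B B0 hB] := finen_bounded fe.
have ch := chan_measurable fe c cw.
have sub : (`]1, +oo[%classic : set R) `<=` H.
  by move=> x /=; rewrite !in_itv/= !andbT => x1; exact: lt_trans x1.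
have e : H = `]0, 1]%classic `|` `]1, +oo[%classic :> set R.
  apply/seteqP; split => x /=; rewrite !in_itv/= !andbT.
    by move=> x0; have [x1|x1] := leP x 1; [left; rewrite x0|right].
  by case=> [/andP[]//|x1]; exact: lt_trans x1.
pose b x := df x ^+ 2 + 2 * (pot k x * f x ^+ 2) + (4 * B) * (x ^- 2 * (1 + incr w c x ^+ 6)).
have ib : mu.-integrable `]1, +oo[ (EFin \o b).
  apply: rintD => //; last exact: rintZl.
  apply: rintD => //; last apply: rintZl => //.
    by apply: integrableS i1.
  by apply: integrableS i2.
have i4 : mu.-integrable `]1, +oo[ (EFin \o chan k w c f df).
  apply: (@rint_le _ _ _ mu _ _ _ b) => //; first exact: measurable_funS ch.
  move=> x; rewrite /= in_itv/= andbT => x1.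
  have x0 : 0 < x by exact: lt_trans x1.
  have := @chan_le_bound k f df w c x x0.
  have g0 : 0 < gk k x by exact: gk_gt0.
  have g1 : gk k x <= 1.
    by rewrite -(powRr0 x) /gk ler_powR ?(ltW x1)// oppr_le0 ak_ge0.
  have p1 : 1 <= pot k x by rewrite -(powRr0 x) /pot ler_powR ?(ltW x1).
  have pE := pot_sqr_gk k x0.
  have dg : `|dgk k x| <= gk k x.
    rewrite /dgk mulNr normrN ger0_norm ?mulr_ge0 ?ak_ge0 ?powR_ge0//.
    rewrite powRD ?(gt_eqF x0) ?implybT// powR_inv1 ?(ltW x0)// -/(gk k x).
    apply: (@le_trans _ _ (1 * (gk k x * 1))); last by rewrite mul1r mulr1.
    apply: ler_pM; rewrite ?ak_ge0 ?mulr_ge0 ?(ltW g0) ?invr_ge0 ?(ltW x0)//.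
      by have := @ak_lt_half R k; lra.
    by rewrite ler_wpM2l ?(ltW g0)// invf_le1// ltW.
  apply: (moment_dichotomy (B := B) x1 g0 g1 p1 pE) => //.
  by apply: hB; exact: ltW.
apply/integrableP; split; first exact/measurable_EFinP.
rewrite e ge0_integral_setU//=.
- have /integrableP[_ j1] := chan_rint_segment fe c 1 cw.
  have /integrableP[_ j2] := i4.
  by rewrite lte_add_pinfty.
- by rewrite -e; apply/measurable_EFinP; exact: measurableT_comp.
- by rewrite disj_set2E; apply/eqP/seteqP; split => x //=; rewrite !in_itv/= => -[/andP[_ x1]]; rewrite andbT ltNge x1.
Qed.

End Channels.

(** * Truncation *)

Section Truncation.
Context {R : realType}.
Notation mu := (@lebesgue_measure R).
Notation H := (halfline R).
Implicit Types (x u d : R) (f df F p : R -> R) (k : nat).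

(** The chain rule asks for a Lipschitz derivative, which the square of a positive part has and the
    positive part itself has not; truncations are built from it. *)
Definition psqr u : R := Num.max u 0 ^+ 2.

Lemma ac_psqr F p : ac F p ->
  ac (fun x => psqr (F x)) (fun x => 2 * Num.max (F x) 0 * p x).
Proof.
apply: (@ac_chain _ psqr (fun u => 2 * Num.max u 0) 2) => x y; rewrite /psqr.
  have sx := sqr_ge0 x; have sy := sqr_ge0 y; have sd := sqr_ge0 (y - x).
  have [x0|x0] := leP x 0; have [y0|y0] := leP y 0; rewrite ler_norml ?expr0n/=.
  - by apply/andP; split; lra.
  - have h : 0 <= - x * y by apply: mulr_ge0; lra.
    by apply/andP; split; nra.
  - have h : 0 <= x * - y by apply: mulr_ge0; lra.
    by apply/andP; split; nra.
  - by apply/andP; split; nra.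
by rewrite -mulrBr normrM ger0_norm// ler_wpM2l//;
  have [x0|x0] := leP x 0; have [y0|y0] := leP y 0;
  rewrite ler_norml; apply/andP; have := ler_norm (y - x);
  have := ler_norm (- (y - x)); rewrite normrN => h1 h2; split; lra.
Qed.

(* A C^1 truncation: 0 on [-d, d], of slope 1 outside [-2d, 2d]. *)
Definition trunc d u : R :=
  (psqr (u - d) - psqr (u - 2 * d) - psqr (- u - d) + psqr (- u - 2 * d)) / (2 * d).

Definition dtrunc d u : R :=
  (Num.max (u - d) 0 - Num.max (u - 2 * d) 0 + Num.max (- u - d) 0
   - Num.max (- u - 2 * d) 0) / d.

Lemma ac_trunc d F p : 0 < d -> ac F p ->
  ac (fun x => trunc d (F x)) (fun x => dtrunc d (F x) * p x).
Proof.
move=> d0 a.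
have aff (s c : R) : ac (fun x => s * F x + c) (fun x => s * p x).
  apply: eq_ac (ac_lin s 1 a (ac_cst c)) => x _; first by rewrite mul1r.
  by rewrite /= mulr0 addr0.
pose A s c := ac_psqr (aff s c).
have := ac_lin (2 * d)^-1 (2 * d)^-1 (ac_lin 1 (-1) (A 1 (- d)) (A 1 (- (2 * d))))
   (ac_lin (-1) 1 (A (-1) (- d)) (A (-1) (- (2 * d)))).
apply: eq_ac => x _.
  by rewrite /trunc !mul1r !mulN1r; field; rewrite gt_eqF.
by rewrite /dtrunc !mul1r !mulN1r; field; rewrite gt_eqF.
Qed.

Lemma truncN d u : trunc d (- u) = - trunc d u.
Proof. by rewrite /trunc opprK; ring. Qed.

Lemma dtruncN d u : dtrunc d (- u) = dtrunc d u.
Proof. by rewrite /dtrunc opprK; ring. Qed.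

Lemma trunc_dtrunc_pos d u : 0 < d -> 0 <= u ->
  [/\ 0 <= trunc d u <= u, 0 <= dtrunc d u <= 1,
      (u <= d -> trunc d u = 0 /\ dtrunc d u = 0) &
      (2 * d <= u -> u - 2 * d <= trunc d u /\ dtrunc d u = 1)].
Proof.
move=> d0 u0; rewrite /trunc /dtrunc /psqr.
have -> : Num.max (- u - d) 0 = 0 by apply/max_idPr; lra.
have -> : Num.max (- u - 2 * d) 0 = 0 by apply/max_idPr; lra.
rewrite expr0n/= !subr0 !addr0.
have d2 : 0 < 2 * d by lra.
have [ud|ud] := leP u d.
  have -> : Num.max (u - d) 0 = 0 by apply/max_idPr; lra.
  have -> : Num.max (u - 2 * d) 0 = 0 by apply/max_idPr; lra.
  rewrite expr0n/= !subr0 !mul0r; split => //; rewrite ?lexx ?u0 ?ler01// => h.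
  by exfalso; lra.
have -> : Num.max (u - d) 0 = u - d by apply/max_idPl; lra.
have [u2|u2] := leP u (2 * d).
  have -> : Num.max (u - 2 * d) 0 = 0 by apply/max_idPr; lra.
  rewrite expr0n/= !subr0; split.
  - apply/andP; split; first by apply: divr_ge0; [exact: sqr_ge0|exact: ltW].
    by rewrite ler_pdivrMr//; nra.
  - apply/andP; split; first by apply: divr_ge0; [lra|exact: ltW].
    by rewrite ler_pdivrMr//; lra.
  - by move=> h; exfalso; lra.
  - move=> h; have -> : u = 2 * d by lra.
    rewrite ler_pdivlMr//; split; first by nra.
    by field; rewrite gt_eqF.
have -> : Num.max (u - 2 * d) 0 = u - 2 * d by apply/max_idPl; lra.
have -> : ((u - d) ^+ 2 - (u - 2 * d) ^+ 2) / (2 * d) = u - 3 * d / 2.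
  by field; rewrite gt_eqF.
have -> : (u - d - (u - 2 * d)) / d = 1 by field; rewrite gt_eqF.
split.
- by apply/andP; split; lra.
- by rewrite ler01 lexx.
- by move=> h; exfalso; lra.
- by move=> _; split => //; lra.
Qed.

(** Truncation becomes multiplication by a factor r in [0, 1], so that later bounds and limits
    concern only the pair of factors r and [dtrunc]. The lower bound on r drives it to 1 as d tends
    to 0. *)
Lemma trunc_ratio d : 0 < d -> exists r : R -> R, forall u,
  [/\ trunc d u = r u * u, 0 <= r u <= 1, 0 <= dtrunc d u <= 1,
      (`|u| <= d -> r u = 0 /\ dtrunc d u = 0) &
      (2 * d <= `|u| -> 1 - 2 * d / `|u| <= r u /\ dtrunc d u = 1)].
Proof.
move=> d0; exists (fun u => trunc d `|u| / `|u|) => u.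
have [h1 h2 h3 h4] := trunc_dtrunc_pos d0 (normr_ge0 u).
have d' : dtrunc d u = dtrunc d `|u|.
  by have [_|_] := ger0P u => //; rewrite dtruncN.
have [t0 s0] : trunc d 0 = 0 /\ dtrunc d 0 = 0.
  by have [_ _ h _] := trunc_dtrunc_pos d0 (lexx 0); apply: h; exact: ltW.
have t' : trunc d u = trunc d `|u| * Num.sg u.
  by have [->|u0|u0] := sgrP u; rewrite ?mulr0 ?t0 ?mulr1 ?mulrN1 ?truncN ?opprK.
rewrite d'; have [u0|u0] := eqVneq u 0.
  rewrite u0 normr0 invr0 !mulr0 t0 s0 lexx ler01; split => // h.
  by exfalso; lra.
have n0 : 0 < `|u| by rewrite normr_gt0.
split => //.
- by rewrite t' -mulrA; congr (_ * _); rewrite [X in _ = _ * X](numEsg u) mulrCA mulVf ?mulr1// gt_eqF.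
- by case/andP: h1 => a b; rewrite divr_ge0//= ler_pdivrMr// mul1r.
- by move=> /h3[-> ->]; rewrite mul0r.
- move=> /h4[a ->]; split => //; rewrite ler_pdivlMr// mulrBl mul1r divfK// gt_eqF//.
Qed.

(** The logarithmic derivative of the weight max(x, 1)^(-alpha/2). It satisfies 2 kap gk = dgk for x
    > 1. *)
Definition kap k x : R := if 1 < x then - ak k / 2 / x else 0.

Lemma kap_le1 k x : `|kap k x| <= 1.
Proof.
rewrite /kap; case: ifPn => x1; last by rewrite normr0.
have x0 : 0 < x by exact: lt_trans x1.
rewrite normrM normfV (gtr0_norm x0) ler_pdivrMr// mul1r mulNr normrN.
have a0 := @ak_ge0 R k; have a1 := @ak_lt_half R k.
by rewrite ger0_norm; lra.
Qed.

Lemma sqr_perturb_le (r s c D F : R) : 0 <= r <= 1 -> 0 <= s <= 1 -> `|c| <= 1 ->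
  (s * D + c * (s - r) * F) ^+ 2 <= 2 * (D ^+ 2 + F ^+ 2).
Proof.
move=> /andP[r0 r1] /andP[s0 s1] c1.
have sq a : 0 <= a <= 1 -> a ^+ 2 <= 1 by move=> /andP[a0 a1]; rewrite expr_le1.
have h1 : (s * D) ^+ 2 <= D ^+ 2.
  by rewrite exprMn ler_piMl ?sqr_ge0// sq// s0.
have h2 : (c * (s - r) * F) ^+ 2 <= F ^+ 2.
  rewrite exprMn ler_piMl ?sqr_ge0// -(real_normK (num_real _)) sq// normr_ge0/=.
  rewrite normrM -[leRHS]mulr1; apply: ler_pM => //.
  by rewrite ler_norml; apply/andP; split; lra.
have := sqr_ge0 (s * D - c * (s - r) * F); nra.
Qed.

(** The truncation acts on u = w f with w = max(x, 1)^(-alpha/2) and is then divided by w, since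
    beyond 1 the coefficient of the second channel is the derivative of u^2. Cutting by value, not
    by position, multiplies this derivative by the single factor r s. The support becomes compact
    because f is small near 0 and near infinity. *)
Lemma truncation_sequence k f df : finen k f df ->
  exists r s : nat -> R -> R,
  [/\ forall m x, 0 <= r m x <= 1 /\ 0 <= s m x <= 1,
      forall m x, f x = 0 -> s m x = 0,
      forall x, 0 < x -> f x != 0 ->
        r m x @[m --> \oo] --> (1 : R) /\ s m x @[m --> \oo] --> (1 : R) &
      forall m, exists a b, bumpf k a b (fun x => r m x * f x)
        (fun x => s m x * df x + kap k x * (s m x - r m x) * f x)].
Proof.
move=> fe; have [a f0 i1 i2 i3] := fe.
pose d m : R := m.+1%:R^-1.
have d0 m : 0 < d m by rewrite invr_gt0.
(* Its square is [gk] beyond 1; below 1, where [gk] may be unbounded, it stays equal to 1. *)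
pose ww x : R := Num.max x 1 `^ (- (ak k / 2)).
pose wi x : R := Num.max x 1 `^ (ak k / 2).
have M0 x : 0 < Num.max x 1 :> R by rewrite lt_max ltr01 orbT.
have ww0 x : 0 < ww x by exact: powR_gt0.
have wwi x : wi x * ww x = 1.
  by rewrite /wi /ww -powRD ?subrr ?powRr0// (gt_eqF (M0 x)) implybT.
have ww1 x : ww x <= 1.
  rewrite -(powRr0 (Num.max x 1)) ler_powR ?le_max ?lexx ?orbT//.
  by rewrite oppr_le0 divr_ge0 ?ak_ge0.
have aw := @ac_powR_max R 1 (- (ak k / 2)) ltr01.
have awi := @ac_powR_max R 1 (ak k / 2) ltr01.
have dwE x : (if 1 < x then - (ak k / 2) * x `^ (- (ak k / 2) - 1) else 0) = kap k x * ww x.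
  rewrite /kap; case: ifPn => x1; last by rewrite mul0r.
  have x0 : 0 < x by exact: lt_trans x1.
  rewrite /ww (max_idPl (ltW x1)) powRD ?(gt_eqF x0) ?implybT// powR_inv1 ?ltW//.
  by field; rewrite gt_eqF.
have dwiE x : (if 1 < x then ak k / 2 * x `^ (ak k / 2 - 1) else 0) = - kap k x * wi x.
  rewrite /kap; case: ifPn => x1; last by rewrite oppr0 mul0r.
  have x0 : 0 < x by exact: lt_trans x1.
  rewrite /wi (max_idPl (ltW x1)) powRD ?(gt_eqF x0) ?implybT// powR_inv1 ?ltW//.
  by field; rewrite gt_eqF.
have /choice[rr hrr] m := trunc_ratio (d0 m).
pose u x := ww x * f x.
have fu x : f x != 0 -> u x != 0 by move=> fx; rewrite mulf_neq0// gt_eqF.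
exists (fun m x => rr m (u x)), (fun m x => dtrunc (d m) (u x)); split.
- by move=> m x; have [] := hrr m (u x).
- move=> m x fx; have [_ _ _ h _] := hrr m (u x); apply: (h _).2.
  by rewrite /u fx mulr0 normr0 ltW.
- move=> x x0 /fu ux; have u0 : 0 < `|u x| by rewrite normr_gt0.
  have dcv : d m @[m --> \oo] --> (0 : R) by exact: cvg_harmonic.
  have near2 : \forall m \near \oo, 2 * d m <= `|u x|.
    have e0 : 0 < `|u x| / 2 by exact: divr_gt0.
    near=> m; have : `|0 - d m| <= `|u x| / 2.
      by near: m; apply: cvgr_dist_le; [exact: dcv|exact: e0].
    by rewrite sub0r normrN gtr0_norm// ler_pdivlMr// mulrC.
  split.
    apply: (@squeeze_cvgr _ _ _ _ (fun m => 1 - 2 * d m / `|u x|) (fun=> 1)).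
    + near=> m; have [_ /andP[_ ->] _ _ h] := hrr m (u x); rewrite andbT.
      by apply: (h _).1; near: m.
    + have c : 1 - 2 * d m / `|u x| @[m --> \oo] --> 1 - 2 * 0 / `|u x|.
        by apply: cvgB; [exact: cvg_cst|apply: cvgM; [apply: cvgM => //|]; exact: cvg_cst].
      by rewrite mulr0 mul0r subr0 in c.
    + exact: cvg_cst.
  apply: cvg_near_cst; near=> m.
  by have [_ _ _ _ h] := hrr m (u x); apply: (h _).2; near: m.
move=> m.
have [K K0 hK] := finen_sqr_near0 fe.
have [M M1 hM] := finen_vanish fe (d0 m).
(* Left of the first point f^2 <= K x < (d m)^2, and right of [M] |f| <= d m; as w <= 1, the
   truncation vanishes in both places. *)
exists (d m ^+ 2 / K), M.
have key x : 0 <= x -> `|f x| <= d m -> rr m (u x) = 0 /\ dtrunc (d m) (u x) = 0.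
  move=> x0 fx; have [_ _ _ h _] := hrr m (u x); apply: h.
  rewrite /u normrM (gtr0_norm (ww0 x)) (le_trans _ fx)//.
  by rewrite ler_piMl.
have fm : ac (fun x => rr m (u x) * f x)
    (fun x => dtrunc (d m) (u x) * df x + kap k x * (dtrunc (d m) (u x) - rr m (u x)) * f x).
  have := ac_mul awi (ac_trunc (d0 m) (ac_mul aw a)).
  apply: eq_ac => x _.
    rewrite -/(ww x) -/(u x) -/(wi x); have [-> _ _ _ _] := hrr m (u x).
    by rewrite mulrCA /u (mulrA (wi x)) wwi mul1r.
  rewrite dwE dwiE -/(ww x) -/(u x) -/(wi x); have [-> _ _ _ _] := hrr m (u x).
  transitivity (wi x * ww x * (dtrunc (d m) (u x) * df x +
    kap k x * (dtrunc (d m) (u x) - rr m (u x)) * f x)); last by rewrite wwi mul1r.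
  by rewrite /u; ring.
have [mfm mdfm] := ac_measurable fm.
have sq_le x : (rr m (u x) * f x) ^+ 2 <= f x ^+ 2.
  have [_ /andP[h1 h2] _ _ _] := hrr m (u x).
  by rewrite exprMn ler_piMl ?sqr_ge0// expr_le1.
have dsq_le x : (dtrunc (d m) (u x) * df x +
    kap k x * (dtrunc (d m) (u x) - rr m (u x)) * f x) ^+ 2 <= 2 * (df x ^+ 2 + f x ^+ 2).
  have [_ h1 h2 _ _] := hrr m (u x); have := kap_le1 k x.
  exact: sqr_perturb_le.
split.
- by rewrite divr_gt0// exprn_gt0.
- split => //.
  + by rewrite f0 mulr0.
  + apply: (@rint_le _ _ _ mu _ _ _ (fun x => 2 * (df x ^+ 2 + f x ^+ 2))) => //.
    * by apply: measurable_funX; apply: measurable_funS mdfm => //; exact: halfline_sub_ge0.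
    * by move=> x _; rewrite ger0_norm ?sqr_ge0.
    * by apply: rintZl => //; exact: rintD.
  + apply: (@rint_le _ _ _ mu _ _ _ (fun x => pot k x * f x ^+ 2)) => //.
    * apply: measurable_funM; first exact: pot_measurable.
      by apply: measurable_funX; apply: measurable_funS mfm => //; exact: halfline_sub_ge0.
    * move=> x _; rewrite ger0_norm; last by apply: mulr_ge0; [exact: pot_ge0|exact: sqr_ge0].
      by rewrite ler_wpM2l ?pot_ge0.
  + apply: (@rint_le _ _ _ mu _ _ _ (fun x => f x ^+ 2)) => //.
    * by apply: measurable_funX; apply: measurable_funS mfm => //; exact: halfline_sub_ge0.
    * by move=> x _; rewrite ger0_norm ?sqr_ge0.
- move=> x x0 /orP hx; have [] := key x x0; last first.
    by move=> -> ->; rewrite !mul0r subrr mulr0 mul0r addr0.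
  case: hx => hx; last by apply: hM; exact: ltW.
  have h : f x ^+ 2 <= d m ^+ 2.
    apply: le_trans (hK _ x0) _.
    by rewrite mulrC -ler_pdivlMr// ltW.
  by rewrite -(real_normK (num_real (f x))) ler_pXn2r ?nnegrE// ltW in h.
Unshelve. all: by end_near. Qed.

End Truncation.

Lemma cvgn_cst (R : realType) (c : R) : (fun _ : nat => c) m @[m --> \oo] --> c.
Proof. exact: cvg_cst. Qed.

Lemma limr_le_bound (R : realType) (u : nat -> R) (l C : R) :
  u m @[m --> \oo] --> l -> (forall m, `|u m| <= C) -> `|l| <= C.
Proof.
move=> cu uC; have cn : `|u m| @[m --> \oo] --> `|l| by exact: cvg_norm.
rewrite -(cvg_lim _ cn)//; apply: limr_le; last exact: nearW.
by apply/cvg_ex; eexists; exact: cn.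
Qed.

Lemma Rintegral_dominated_cvg d (T : measurableType d) (R : realType)
    (nu : {measure set T -> \bar R}) (D : set T) (h_ : nat -> T -> R) (h g : T -> R) :
  measurable D -> (forall m, measurable_fun D (h_ m)) ->
  (forall x, D x -> h_ m x @[m --> \oo] --> h x) ->
  nu.-integrable D (EFin \o g) ->
  (forall m x, D x -> `|h_ m x| <= g x) ->
  \int[nu]_(x in D) h_ m x @[m --> \oo] --> \int[nu]_(x in D) h x.
Proof.
move=> mD mh cv ig hg.
have mh' : measurable_fun D h by exact: measurable_fun_cvg cv.
have ih : nu.-integrable D (EFin \o h).
  apply: (rint_le mD mh' _ ig) => x Dx.
  apply: (@limr_le_bound _ (fun m => h_ m x)) => [|m]; [exact: cv|exact: hg].
have ihm m : nu.-integrable D (EFin \o h_ m) by apply: (rint_le mD _ _ ig) => // x; exact: hg.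
apply: fine_cvg; rewrite EFin_Rintegral//.
have := @dominated_cvg _ _ _ nu _ mD (fun m x => (h_ m x)%:E) (EFin \o h) (EFin \o g).
apply => //.
- by move=> m; apply/measurable_EFinP.
- by move=> x Dx; apply: cvg_EFin; [exact: nearW|exact: cv].
Qed.

(** * Quadratic form and limits along truncations *)

Section Classes.
Context {R : realType}.
Notation mu := (@lebesgue_measure R).
Notation H := (halfline R).
Implicit Types (x t cc : R) (f df w : R -> R) (k : nat) (a : bool -> bool).

Definition energy2 k f df : R :=
  \int[mu]_(x in H) (df x ^+ 2 + pot k x * f x ^+ 2).
Definition normsq f : R := \int[mu]_(x in H) f x ^+ 2.
Definition chanI k w c f df : R := \int[mu]_(x in H) chan k w c f df x.
Definition chanN k w c f df : R := \int[mu]_(x in H) `|chan k w c f df x|.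

(** The inequality functional > t made homogeneous of degree two in f, so that test functions need
    not be normalized. A channel with [a c] false counts as 0. *)
Definition qform k w a cc t f df : R :=
  cc * ((if a true then chanI k w true f df else 0)
        - (if a false then chanI k w false f df else 0))
  - energy2 k f df - t * normsq f.

(** By 2 kap gk = dgk the terms without df combine beyond 1, and the second channel is just
    multiplied by r s. A cross term survives only on []0, 1]], where the envelope controls it.
    Without this cancellation the two summands of the channel would have to converge separately. *)
Lemma chan_truncE k w c f df (r s : R) x : 0 < x ->
  chan k w c (fun x => r * f x) (fun x => s * df x + kap k x * (s - r) * f x) x =
  (if c then r ^+ 2 else r * s) * chan k w c f df x +
  (if c || (1 < x) then 0 else r * (r - s) * (f x ^+ 2 * dgk k x * incr w c x)).
Proof.
move=> x0; rewrite /chan /incr; case: c => /=; first by rewrite addr0; ring.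
rewrite /kap; case: ifPn => x1; last by rewrite mul0r; ring.
rewrite /dgk /gk powRD ?(gt_eqF x0) ?implybT// powR_inv1 ?ltW//.
by field; rewrite gt_eqF.
Qed.

Lemma chan_trunc_le k w c f df (r s : R) x : 0 < x -> 0 <= r <= 1 -> 0 <= s <= 1 ->
  `|chan k w c (fun x => r * f x) (fun x => s * df x + kap k x * (s - r) * f x) x| <=
  `|chan k w c f df x| + (if x <= 1 then envelope k f df x * `|incr w c x| else 0).
Proof.
move=> x0 /andP[r0 r1] /andP[s0 s1]; rewrite chan_truncE//.
apply: le_trans (ler_normD _ _) _; apply: lerD.
  rewrite normrM ler_piMl//; case: c; rewrite ger0_norm ?exprn_ge0 ?mulr_ge0//.
    by rewrite expr_le1.
  by rewrite mulr_ile1.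
have e0 := envelope_ge0 k f df x.
rewrite (leNgt x 1); have [x1|x1] := ltP 1 x; first by rewrite orbT normr0.
rewrite orbF; case: c => /=.
  by rewrite normr0 mulr_ge0// ?e0.
rewrite mulrA normrM ler_wpM2r// normrM -[leRHS]mul1r; apply: ler_pM => //.
  rewrite normrM (ger0_norm r0) mulr_ile1// ler_norml; apply/andP; split; lra.
rewrite normrM (ger0_norm (sqr_ge0 _)) /envelope lerDr.
apply: mulr_ge0; last exact: powR_ge0.
by apply: addr_ge0; [exact: mulr_ge0|exact: sqr_ge0].
Qed.

Lemma chan_trunc_cvg k w c f df (r s : nat -> R) x : 0 < x ->
  (f x != 0 -> r m @[m --> \oo] --> (1 : R) /\ s m @[m --> \oo] --> (1 : R)) ->
  chan k w c (fun x => r m * f x) (fun x => s m * df x + kap k x * (s m - r m) * f x) x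
    @[m --> \oo] --> chan k w c f df x.
Proof.
move=> x0 rs; have [fx|fx] := eqVneq (f x) 0.
  rewrite [X in _ --> X](_ : _ = 0); last first.
    by rewrite /chan fx; case: c; rewrite expr0n/= !(mulr0, mul0r, addr0).
  apply: cvg_near_cst; apply: nearW => m.
  by rewrite /chan fx; case: c; rewrite /= !mulr0 expr0n/= !(mulr0, mul0r, addr0).
have [cr cs] := rs fx.
under eq_cvg do rewrite chan_truncE//.
have c1 : (if c then r m ^+ 2 else r m * s m) @[m --> \oo] --> (1 : R).
  have h1 := cvgM cr cr; have h2 := cvgM cr cs; rewrite mulr1 in h1 h2.
  by case: (c); [exact: h1|exact: h2].
set K := f x ^+ 2 * dgk k x * incr w c x.
have c2 : (if c || (1 < x) then 0 else r m * (r m - s m) * K) @[m --> \oo] --> (0 : R).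
  case: (c || (1 < x)); first exact: cvg_cst.
  have c3 := @cvgn_cst R (K).
  have h := cvgM (cvgM cr (cvgB cr cs)) c3.
  by rewrite subrr mulr0 mul0r in h; exact: h.
have c3 := @cvgn_cst R (chan k w c f df x).
have h := cvgD (cvgM c1 c3) c2.
by rewrite mul1r addr0 in h; exact: h.
Qed.

(** Dominated convergence serves a channel that converges, Fatou's lemma one that does not. Energy
    and norm stay bounded along the sequence in either case. *)
Lemma truncation_limits k w f df : continuous w -> finen k f df ->
  exists F DF : nat -> R -> R,
  [/\ forall m, exists l r, bumpf k l r (F m) (DF m),
      forall m x, f x = 0 -> df x = 0 -> F m x = 0 /\ DF m x = 0,
      exists C, forall m, energy2 k (F m) (DF m) + normsq (F m) <= C,
      normsq (F m) @[m --> \oo] --> normsq f /\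
        exists2 e, e <= energy2 k f df & energy2 k (F m) (DF m) @[m --> \oo] --> e &
      forall c,
        (mu.-integrable H (EFin \o chan k w c f df) ->
          chanI k w c (F m) (DF m) @[m --> \oo] --> chanI k w c f df /\
          exists C, forall m, chanN k w c (F m) (DF m) <= C) /\
        (~ mu.-integrable H (EFin \o chan k w c f df) ->
          forall K, exists m, K < chanN k w c (F m) (DF m))].
Proof.
move=> cw fe; have [r [s [rs01 s0 rs1 bm]]] := truncation_sequence fe.
have [a f0 i1 i2 i3] := fe; have [mf mdf] := finen_measurable fe.
pose F m x := r m x * f x.
pose DF m x := s m x * df x + kap k x * (s m x - r m x) * f x.
have feF m : finen k (F m) (DF m) by have [l [q []]] := bm m.
have Fsq m x : F m x ^+ 2 <= f x ^+ 2.
  have [/andP[r0 r1] _] := rs01 m x.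
  by rewrite exprMn ler_piMl ?sqr_ge0// expr_le1.
have DFsq m x : DF m x ^+ 2 <= 2 * (df x ^+ 2 + f x ^+ 2).
  by have [h1 h2] := rs01 m x; apply: sqr_perturb_le => //; exact: kap_le1.
have F0 m x : f x = 0 -> F m x = 0 by rewrite /F => ->; rewrite mulr0.
have DF0 m x : f x = 0 -> DF m x = 0.
  by move=> h; rewrite /DF (s0 _ _ h) h mul0r mulr0 addr0.
have Fcv x : 0 < x -> F m x @[m --> \oo] --> f x.
  move=> x0; have [h|h] := eqVneq (f x) 0.
    by rewrite h; apply: cvg_near_cst; apply: nearW => m; exact: F0.
  have c3 := @cvgn_cst R (f x).
  by have h' := cvgM (rs1 x x0 h).1 c3; rewrite mul1r in h'; exact: h'.
(* The factor s vanishes where f does, so the truncated derivatives tend to 0 there, whatever [df]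
   is. Hence only an upper bound on the limit energy is claimed, the useful direction for
   [qform]. *)
pose df' x := if f x == 0 then 0 else df x.
have DFcv x : 0 < x -> DF m x @[m --> \oo] --> df' x.
  move=> x0; rewrite /df'; have [h|h] := eqVneq (f x) 0.
    by apply: cvg_near_cst; apply: nearW => m; exact: DF0.
  have [h1 h2] := rs1 x x0 h.
  have c3 := @cvgn_cst R (df x).
  have c4 := @cvgn_cst R (f x).
  have c5 := @cvgn_cst R (kap k x).
  have h' := cvgD (cvgM h2 c3) (cvgM (cvgM c5 (cvgB h2 h1)) c4).
  by rewrite mul1r subrr mulr0 mul0r addr0 in h'; exact: h'.
have sqcv (u : nat -> R) (l : R) : u m @[m --> \oo] --> l -> u m ^+ 2 @[m --> \oo] --> l ^+ 2.
  by move=> h; exact: cvgM.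
have mF m := (finen_measurable (feF m)).1.
have mDF m := (finen_measurable (feF m)).2.
have mp := @pot_measurable R k H (measurable_itv _).
have nF m : normsq (F m) <= normsq f.
  by apply: le_Rintegral => //; have [] := feF m.
have eF m : energy2 k (F m) (DF m) <=
    \int[mu]_(x in H) (2 * (df x ^+ 2 + f x ^+ 2) + pot k x * f x ^+ 2).
  have [_ _ j1 j2 j3] := feF m.
  apply: le_Rintegral => //; [exact: rintD| |].
    by apply: rintD => //; apply: rintZl => //; exact: rintD.
  by move=> x _; rewrite lerD// ler_wpM2l ?pot_ge0.
exists F, DF; split.
- exact: bm.
- by move=> m x fx _; split; [exact: F0|exact: DF0].
- exists (\int[mu]_(x in H) (2 * (df x ^+ 2 + f x ^+ 2) + pot k x * f x ^+ 2) + normsq f).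
  by move=> m; exact: lerD.
- split.
    apply: (Rintegral_dominated_cvg _ _ _ i3) => //.
    + by move=> m; exact: (measurable_funX 2 (mF m)).
    + by move=> x; rewrite /= in_itv/= andbT => x0; exact/sqcv/Fcv.
    + by move=> m x _; rewrite ger0_norm ?sqr_ge0.
  have ig : mu.-integrable H (EFin \o (fun x => 2 * (df x ^+ 2 + f x ^+ 2) + pot k x * f x ^+ 2)).
    by apply: rintD => //; apply: rintZl => //; exact: rintD.
  have mh m : measurable_fun H (fun x => DF m x ^+ 2 + pot k x * F m x ^+ 2).
    by apply: measurable_funD; [|apply: measurable_funM => //]; exact: (measurable_funX 2).
  have cvh x : H x -> DF m x ^+ 2 + pot k x * F m x ^+ 2 @[m --> \oo] -->
       df' x ^+ 2 + pot k x * f x ^+ 2.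
    rewrite /= in_itv/= andbT => x0; apply: cvgD; first exact/sqcv/DFcv.
    by apply: cvgM; [exact: cvg_cst|exact/sqcv/Fcv].
  have bh m x : H x -> `|DF m x ^+ 2 + pot k x * F m x ^+ 2| <=
      2 * (df x ^+ 2 + f x ^+ 2) + pot k x * f x ^+ 2.
    move=> _; rewrite ger0_norm; first by rewrite lerD// ler_wpM2l ?pot_ge0.
    by apply: addr_ge0; [exact: sqr_ge0|apply: mulr_ge0; [exact: pot_ge0|exact: sqr_ge0]].
  exists (\int[mu]_(x in H) (df' x ^+ 2 + pot k x * f x ^+ 2)).
    have iE : mu.-integrable H (EFin \o (fun x => df x ^+ 2 + pot k x * f x ^+ 2)) by exact: rintD.
    have le' x : df' x ^+ 2 <= df x ^+ 2.
      by rewrite /df'; case: ifP => // _; rewrite expr0n sqr_ge0.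
    apply: le_Rintegral => //; last by move=> x _; rewrite lerD2r.
    apply: (rint_le _ _ _ ig) => //; first exact: (measurable_fun_cvg mh cvh).
    by move=> x Hx; apply: limr_le_bound (cvh x Hx) _ => m; exact: bh.
  by apply: (Rintegral_dominated_cvg _ _ _ ig).
move=> c.
have mc m : measurable_fun H (chan k w c (F m) (DF m)) by exact: chan_measurable.
pose G x := if x <= 1 then envelope k f df x * `|incr w c x| else 0.
have iG : mu.-integrable H (EFin \o G).
  have sub : (`]0, 1]%classic : set R) `<=` H.
    by move=> x /=; rewrite !in_itv/= => /andP[->].
  have mG : measurable_fun H G.
    apply: measurable_fun_if => //.
      by apply: measurable_fun_ler => //; exact: measurable_id.
    apply: (@measurable_funS _ _ _ _ H) => //.
    apply: measurable_funM; first exact: envelope_measurable.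
    by apply: measurableT_comp => //; exact: incr_measurable.
  apply: (@rint_vanish _ _ 1) => //; last by move=> x _ x1; rewrite /G leNgt x1.
  have [C C0 hC] := incr_bounded_segment 1 cw.
  apply: (@rint_le _ _ _ mu _ _ _ (fun x => C * envelope k f df x)) => //.
  - exact: measurable_funS mG.
  - move=> x; rewrite /= in_itv/= => /andP[x0 x1]; rewrite /G x1.
    have e0 := envelope_ge0 k f df x.
    rewrite ger0_norm ?mulr_ge0// mulrC ler_wpM2r//; apply: hC.
    by rewrite x1 ltW.
  - by apply: rintZl => //; exact: envelope_rint.
have bnd m x : H x -> `|chan k w c (F m) (DF m) x| <= `|chan k w c f df x| + G x.
  rewrite /= in_itv/= andbT => x0; have [h1 h2] := rs01 m x.
  exact: chan_trunc_le.
have ccv x : H x -> chan k w c (F m) (DF m) x @[m --> \oo] --> chan k w c f df x.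
  rewrite /= in_itv/= andbT => x0.
  exact: (@chan_trunc_cvg k w c f df (r ^~ x) (s ^~ x) x x0 (rs1 x x0)).
split=> [ic|nic].
  have ig : mu.-integrable H (EFin \o (fun x => `|chan k w c f df x| + G x)).
    by apply: rintD => //; exact: integrable_norm.
  split; first by apply: (Rintegral_dominated_cvg _ _ _ ig).
  exists (\int[mu]_(x in H) (`|chan k w c f df x| + G x)) => m.
  apply: le_Rintegral => //; last exact: bnd.
  by apply: integrable_norm; apply: (rint_le _ _ _ ig) => // [|x Hx]; [exact: mc|exact: bnd].
(* If [chanN] stayed below K along the sequence, Fatou's lemma would make the channel of f
   integrable. *)
move=> K; apply: contrapT => /forallNP hK; apply: nic.
apply/integrableP; split; first by apply/measurable_EFinP; exact: chan_measurable.
have [l [q bq]] := bm 0%N.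
have ib m : mu.-integrable H (EFin \o (fun x => `|chan k w c (F m) (DF m) x|)).
  by have [l' [q' b']] := bm m; apply: integrable_norm; exact: bumpf_chan_rint b'.
apply: (@le_lt_trans _ _ K%:E); last exact: ltry.
have -> : (\int[mu]_(x in H) `|(EFin \o chan k w c f df) x|)%E =
   (\int[mu]_(x in H) limn_einf (fun m => `|chan k w c (F m) (DF m) x|%:E))%E.
  apply: eq_integral => x; rewrite inE => Hx.
  have cx : `|chan k w c (F m) (DF m) x|%:E @[m --> \oo] --> `|chan k w c f df x|%:E.
    by apply: cvg_EFin; [exact: nearW|apply: cvg_norm; exact: ccv].
  rewrite is_cvg_limn_einfE; last by apply/cvg_ex; eexists; exact: cx.
  by rewrite /= -(cvg_lim _ cx).
apply: le_trans (fatou _ _ _ _) _ => //.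
- by move=> m; apply/measurable_EFinP; apply: measurableT_comp => //; exact: mc.
rewrite limn_einf_lim; apply: lime_le; first exact: is_cvg_einfs.
apply: nearW => m; apply: le_trans (ereal_inf_lbound _) _; first by exists m => /=.
have /negP := hK m; rewrite -leNgt /chanN => h.
by rewrite -EFin_Rintegral// lee_fin.
Qed.

End Classes.

(** * From a test function to bumps and spikes *)

Section Localization.
Context {R : realType}.
Notation mu := (@lebesgue_measure R).
Notation H := (halfline R).
Implicit Types (x t cc : R) (f df w : R -> R) (k n : nat) (a : bool -> bool).

Lemma ac_max (l : R) : 0 < l -> ac (fun x => Num.max x l) (fun x => if l < x then 1 else 0).
Proof.
move=> l0; apply: eq_ac (ac_powR_max 1 l0) => x x0.
  by rewrite powRr1// le_max x0.
by case: ifP => // _; rewrite subrr powRr0 mulr1.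
Qed.

(** Erasing f on [0, n] neither creates nor cures a divergence at infinity, and it lets spikes be
    found arbitrarily far out. *)
Lemma cutoff k n f df : finen k f df -> exists v dv,
  [/\ finen k v dv, forall x, 0 <= x -> x <= n%:R -> v x = 0 /\ dv x = 0 &
      forall x, n.+2%:R < x -> v x = f x /\ dv x = df x].
Proof.
move=> fe; have [a f0 i1 i2 i3] := fe.
have n0 : 0 <= n%:R :> R by [].
rewrite (_ : n.+2%:R = n%:R + 1 + 1); last by rewrite -!natr1.
(* The ramp climbs on [n+1, n+2] rather than on [n, n+1], so that its corners are positive even for
   n = 0, as [ac_max] demands. *)
move: (n%:R : R) n0 => N n0; set N1 := N + 1; set N2 := N1 + 1.
have n1 : 0 < N1 by rewrite /N1; lra.
have n2 : 0 < N2 by rewrite /N2; lra.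
pose e x : R := Num.max x N1 - Num.max x N2 + 1.
pose de x : R := (if N1 < x then 1 else 0) - (if N2 < x then 1 else 0).
have ae : ac e de.
  apply: eq_ac (ac_add (ac_lin 1 (-1) (ac_max n1) (ac_max n2)) (ac_cst 1)) => x _.
    by rewrite /e mul1r mulN1r.
  by rewrite /de /= addr0 mul1r mulN1r.
have e01 x : 0 <= e x <= 1.
  by rewrite /e /N2; have [h1|h1] := leP x N1; have [h2|h2] := leP x (N1 + 1);
    apply/andP; split; lra.
have de1 x : `|de x| <= 1.
  by rewrite /de /N2; have [h1|h1] := ltP N1 x; have [h2|h2] := ltP (N1 + 1) x;
    rewrite ler_norml; apply/andP; split; lra.
have av := ac_mul ae a.
have [mv mdv] := ac_measurable av.
have vsq x : (e x * f x) ^+ 2 <= f x ^+ 2.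
  by have /andP[h1 h2] := e01 x; rewrite exprMn ler_piMl ?sqr_ge0// expr_le1.
have dvsq x : (de x * f x + e x * df x) ^+ 2 <= 2 * (df x ^+ 2 + f x ^+ 2).
  have := @sqr_perturb_le _ 0 (e x) 0 (df x) 0; rewrite lexx ler01 normr0 => _.
  have h1 : (de x * f x) ^+ 2 <= f x ^+ 2.
    by rewrite exprMn ler_piMl ?sqr_ge0// -(real_normK (num_real _)) expr_le1.
  have h2 : (e x * df x) ^+ 2 <= df x ^+ 2.
    by have /andP[h2 h3] := e01 x; rewrite exprMn ler_piMl ?sqr_ge0// expr_le1.
  have := sqr_ge0 (de x * f x - e x * df x); nra.
exists (fun x => e x * f x), (fun x => de x * f x + e x * df x); split.
- split => //.
  + by rewrite f0 mulr0.
  + apply: (@rint_le _ _ _ mu _ _ _ (fun x => 2 * (df x ^+ 2 + f x ^+ 2))) => //.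
    * by apply: measurable_funX; apply: measurable_funS mdv => //; exact: halfline_sub_ge0.
    * by move=> x _; rewrite ger0_norm ?sqr_ge0.
    * by apply: rintZl => //; exact: rintD.
  + apply: (@rint_le _ _ _ mu _ _ _ (fun x => pot k x * f x ^+ 2)) => //.
    * apply: measurable_funM; first exact: pot_measurable.
      by apply: measurable_funX; apply: measurable_funS mv => //; exact: halfline_sub_ge0.
    * move=> x _; rewrite ger0_norm; last by apply: mulr_ge0; [exact: pot_ge0|exact: sqr_ge0].
      by rewrite ler_wpM2l ?pot_ge0.
  + apply: (@rint_le _ _ _ mu _ _ _ (fun x => f x ^+ 2)) => //.
    * by apply: measurable_funX; apply: measurable_funS mv => //; exact: halfline_sub_ge0.
    * by move=> x _; rewrite ger0_norm ?sqr_ge0.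
- move=> x x0 xn.
  have h1 : x <= N1 by rewrite /N1; lra.
  have h2 : x <= N2 by rewrite /N2; lra.
  have -> : e x = 0 by rewrite /e (max_idPr h1) (max_idPr h2) /N2; lra.
  by rewrite /de !ltNge h1 h2 /= subrr !mul0r addr0.
- move=> x xn.
  have h1 : N1 < x by apply: lt_trans xn; rewrite /N2 ltrDl.
  have -> : e x = 1 by rewrite /e (max_idPl (ltW h1)) (max_idPl (ltW xn)) subrr add0r.
  by rewrite /de h1 xn subrr mul1r mul0r add0r mul1r.
Qed.

Lemma chan_eq k w c (f df v dv : R -> R) x : f x = v x -> df x = dv x ->
  chan k w c f df x = chan k w c v dv x.
Proof. by move=> h1 h2; rewrite /chan h1 h2. Qed.

(** The two channels differ only on a bounded segment, where both are integrable. *)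
Lemma chan_rint_tail k w c f df v dv (N : R) : continuous w ->
  finen k f df -> finen k v dv -> (forall x, N < x -> v x = f x /\ dv x = df x) ->
  mu.-integrable H (EFin \o chan k w c f df) ->
  mu.-integrable H (EFin \o chan k w c v dv).
Proof.
move=> cw fe ve fv ic.
apply: (@eq_rint _ _ _ mu _ _ (fun x => chan k w c f df x + (chan k w c v dv x - chan k w c f df x))).
- exact: measurable_itv.
- by move=> x _; rewrite addrC subrK.
apply: rintD => //; apply: (@rint_vanish _ _ N).
- by apply: measurable_funB; exact: chan_measurable.
- by apply: rintB => //; exact: chan_rint_segment.
- by move=> x _ Nx; have [h1 h2] := fv x Nx; rewrite (chan_eq _ _ _ h1 h2) subrr.
Qed.

Lemma chanZ k w c f df (e : R) x :
  chan k w c (fun x => e * f x) (fun x => e * df x) x = e ^+ 2 * chan k w c f df x.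
Proof. by rewrite /chan; case: c; ring. Qed.

Lemma finenZ k f df (e : R) : finen k f df -> finen k (fun x => e * f x) (fun x => e * df x).
Proof.
move=> [a f0 i1 i2 i3]; split.
- apply: eq_ac (ac_lin e 0 a a) => x _; by rewrite mul0r addr0.
- by rewrite f0 mulr0.
- apply: (@eq_rint _ _ _ mu _ _ (fun x => e ^+ 2 * df x ^+ 2)) => //.
    by move=> x _; rewrite exprMn.
  exact: rintZl.
- apply: (@eq_rint _ _ _ mu _ _ (fun x => e ^+ 2 * (pot k x * f x ^+ 2))) => //.
    by move=> x _; rewrite exprMn mulrCA.
  exact: rintZl.
- apply: (@eq_rint _ _ _ mu _ _ (fun x => e ^+ 2 * f x ^+ 2)) => //.
    by move=> x _; rewrite exprMn.
  exact: rintZl.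
Qed.

Lemma energy2Z k f df (e : R) : finen k f df ->
  energy2 k (fun x => e * f x) (fun x => e * df x) = e ^+ 2 * energy2 k f df.
Proof.
move=> [_ _ i1 i2 _]; rewrite /energy2 -RintegralZl//; last exact: rintD.
by apply: eq_Rintegral => x _; rewrite !exprMn; ring.
Qed.

Lemma normsqZ k f df (e : R) : finen k f df ->
  normsq (fun x => e * f x) = e ^+ 2 * normsq f.
Proof.
move=> [_ _ _ _ i3]; rewrite /normsq -RintegralZl//.
by apply: eq_Rintegral => x _; rewrite exprMn.
Qed.

Lemma chanIZ k w c f df (e : R) : mu.-integrable H (EFin \o chan k w c f df) ->
  chanI k w c (fun x => e * f x) (fun x => e * df x) = e ^+ 2 * chanI k w c f df.
Proof.
move=> i; rewrite /chanI -RintegralZl//.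
by apply: eq_Rintegral => x _; rewrite chanZ.
Qed.

Lemma chanNZ k w c f df (e : R) : mu.-integrable H (EFin \o chan k w c f df) ->
  chanN k w c (fun x => e * f x) (fun x => e * df x) = e ^+ 2 * chanN k w c f df.
Proof.
move=> i; rewrite /chanN -RintegralZl//; last exact: integrable_norm.
by apply: eq_Rintegral => x _; rewrite chanZ normrM ger0_norm ?sqr_ge0.
Qed.

Lemma energy2_ge0 k f df : 0 <= energy2 k f df.
Proof.
apply: Rintegral_ge0 => x _; apply: addr_ge0; first exact: sqr_ge0.
by apply: mulr_ge0; [exact: pot_ge0|exact: sqr_ge0].
Qed.

Lemma normsq_ge0 f : 0 <= normsq f.
Proof. by apply: Rintegral_ge0 => x _; exact: sqr_ge0. Qed.

Lemma chanN_ge0 k w c f df : 0 <= chanN k w c f df.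
Proof. by apply: Rintegral_ge0 => x _. Qed.

(* Small in energy and in the channels marked by [a], but not in channel [c]. *)
Definition spike k w a c n f df :=
  exists l r, [/\ n%:R <= l, bumpf k l r f df, 1 < chanN k w c f df,
    energy2 k f df + normsq f < n.+1%:R^-1 &
    forall c', a c' -> chanN k w c' f df < n.+1%:R^-1].

(** Along the truncations [qform] tends to a limit at least its value at f, as the energy can only
    drop; so some truncation is still positive. *)
Lemma class_bump k w a cc t f df : continuous w -> finen k f df ->
  (forall c, a c -> mu.-integrable H (EFin \o chan k w c f df)) ->
  0 < qform k w a cc t f df ->
  exists l r f1 df1, bumpf k l r f1 df1 /\ 0 < qform k w a cc t f1 df1.
Proof.
move=> cw fe ia q0.
have [F [DF [bF _ _ [cn [e le_e ce]] cI]]] := truncation_limits cw fe.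
have cI' c : (if a c then chanI k w c (F m) (DF m) else 0) @[m --> \oo] -->
             (if a c then chanI k w c f df else 0).
  by case: ifP => [ac|_]; [have [/(_ (ia c ac))[]] := cI c|exact: cvg_cst].
pose q' := cc * ((if a true then chanI k w true f df else 0)
        - (if a false then chanI k w false f df else 0)) - e - t * normsq f.
have cq : qform k w a cc t (F m) (DF m) @[m --> \oo] --> q'.
  have h := cvgB (cvgB (cvgM (cvgn_cst (c := cc)) (cvgB (cI' true) (cI' false))) ce)
    (cvgM (cvgn_cst (c := t)) cn).
  exact: h.
have q'0 : 0 < q' by move: q0; rewrite /q' /qform; lra.
have [N _ hN] : \forall m \near \oo, 0 < qform k w a cc t (F m) (DF m).
  by apply: cvgr_gt cq _ _.
have [l [r b]] := bF N.
by exists l, r, (F N), (DF N); split => //; exact: hN (leqnn N).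
Qed.

(** Cut off below n, then truncate: channel c is unbounded along the sequence while the energy and
    the channels of [a] stay below a constant. All these quantities are quadratic, so one small
    factor makes the bounded ones tiny and keeps the other above 1. *)
Lemma class_spike k w a c f df : continuous w -> finen k f df ->
  (forall c, a c -> mu.-integrable H (EFin \o chan k w c f df)) ->
  ~ mu.-integrable H (EFin \o chan k w c f df) ->
  forall n, exists f1 df1, spike k w a c n f1 df1.
Proof.
move=> cw fe ia nc n.
have [v [dv [ve v0 vf]]] := cutoff n fe.
have fv x : n.+2%:R < x -> f x = v x /\ df x = dv x by move=> /vf[-> ->].
have {}ia c' : a c' -> mu.-integrable H (EFin \o chan k w c' v dv).
  by move=> /ia i; exact: (chan_rint_tail cw fe ve vf i).
have {}nc : ~ mu.-integrable H (EFin \o chan k w c v dv).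
  by move=> i; apply: nc; exact: (chan_rint_tail cw ve fe fv i).
have [F [DF [bF F0 [C hC] _ cI]]] := truncation_limits cw ve.
have hB c' : exists B, forall m, a c' -> chanN k w c' (F m) (DF m) <= B.
  have [ac|] := boolP (a c'); last by exists 0.
  by have [/(_ (ia c' ac))[_ [B hB]] _] := cI c'; exists B => m _.
have [Bt hBt] := hB true; have [Bf hBf] := hB false.
pose K := `|C| + `|Bt| + `|Bf| + 1.
have K0 : 0 < K by rewrite /K ltr_wpDl// !addr_ge0.
(* Multiplied by e2, a quantity below [K] becomes smaller than 1/(n+1), the 2 making this strict,
   and a channel above 1/e2 becomes larger than 1. *)
pose e2 := (2 * K * n.+1%:R)^-1.
have [e20 eK] : 0 < e2 /\ e2 * K < n.+1%:R^-1.
  rewrite /e2 invr_gt0 !mulr_gt0//; split => //.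
  rewrite !invfM (_ : _ * K = 2^-1 * n.+1%:R^-1); last by field; rewrite gt_eqF// gt_eqF.
  by rewrite gtr_pMl ?invr_gt0// invf_lt1// ltr1n.
have [m hm] := (cI c).2 nc (e2^-1).
have [l [r b]] := bF m.
have [l0 fe1 b0] := b.
pose s := Num.sqrt e2.
have s2 : s ^+ 2 = e2 by rewrite sqr_sqrtr// ltW.
have ib c' := bumpf_chan_rint c' cw b.
exists (fun x => s * F m x), (fun x => s * DF m x), (Num.max l n%:R), r; split.
- by rewrite le_max lexx orbT.
- split; first by rewrite lt_max l0.
    exact: finenZ.
  move=> x x0; rewrite lt_max -orbA => /or3P[xl|xn|rx].
  + by have [-> ->] := b0 x x0 (introT orP (or_introl xl)); rewrite mulr0.
  + have [h1 h2] := v0 x x0 (ltW xn).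
    by have [-> ->] := F0 m x h1 h2; rewrite mulr0.
  + by have [-> ->] := b0 x x0 (introT orP (or_intror rx)); rewrite mulr0.
- by rewrite chanNZ// s2 mulrC -ltr_pdivrMr// mul1r.
- rewrite energy2Z// (normsqZ _ fe1) -mulrDr s2; apply: le_lt_trans eK.
  rewrite ler_pM2l//; apply: le_trans (hC m) _.
  by rewrite /K; have := ler_norm C; have := normr_ge0 Bt; have := normr_ge0 Bf; lra.
- move=> c' ac; rewrite chanNZ// s2; apply: le_lt_trans eK.
  rewrite ler_pM2l//; case: c' ac => ac.
    apply: le_trans (hBt m ac) _.
    by rewrite /K; have := ler_norm Bt; have := normr_ge0 C; have := normr_ge0 Bf; lra.
  apply: le_trans (hBf m ac) _.
  by rewrite /K; have := ler_norm Bf; have := normr_ge0 C; have := normr_ge0 Bt; lra.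
Qed.

End Localization.

Section FiniteSums.
Context d (T : measurableType d) {R : realType} (nu : {measure set T -> \bar R}).
Context (D : set T).
Hypothesis mD : measurable D.

Lemma rint_sum (h : nat -> T -> R) n :
  (forall j, nu.-integrable D (EFin \o h j)) ->
  nu.-integrable D (EFin \o (fun x => \sum_(j < n) h j x)).
Proof.
move=> ih; elim: n => [|n IH].
  apply: (eq_rint mD (f := fun _ => 0)); last exact: integrable0.
  by move=> x _; rewrite big_ord0.
apply: (eq_rint mD (f := fun x => \sum_(j < n) h j x + h n x)); last exact: rintD.
by move=> x _; rewrite big_ord_recr.
Qed.

Lemma Rintegral_sum (h : nat -> T -> R) n :
  (forall j, nu.-integrable D (EFin \o h j)) ->
  \int[nu]_(x in D) (\sum_(j < n) h j x) = \sum_(j < n) \int[nu]_(x in D) h j x.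
Proof.
move=> ih; elim: n => [|n IH].
  rewrite big_ord0; under eq_Rintegral do rewrite big_ord0.
  by rewrite /Rintegral integral0.
rewrite big_ord_recr/= -IH -RintegralD//; last exact: rint_sum.
by apply: eq_Rintegral => x _; rewrite big_ord_recr.
Qed.

End FiniteSums.

(** * Gluing bumps *)

Section Gluing.
Context {R : realType}.
Notation mu := (@lebesgue_measure R).
Notation H := (halfline R).
Implicit Types (x t cc : R) (w : R -> R) (n : nat) (a : bool -> bool).

Lemma ac_sum (F p : nat -> R -> R) n : (forall j, ac (F j) (p j)) ->
  ac (fun x => \sum_(j < n) F j x) (fun x => \sum_(j < n) p j x).
Proof.
move=> aF; elim: n => [|n IH].
  by apply: eq_ac (ac_cst 0) => x _; rewrite big_ord0.
by apply: eq_ac (ac_add IH (aF n)) => x _; rewrite big_ord_recr.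
Qed.

Section Pieces.
Context (k : nat) (f_ df_ : nat -> R -> R) (L r : nat -> R).
Hypothesis hb : forall j, bumpf k (L j) (r j) (f_ j) (df_ j).
Hypothesis sep : forall j, r j < L j.+1.
Hypothesis Lr : forall j, L j <= r j.
Hypothesis Lj : forall j, j%:R <= L j.

(** Piece j lives beyond j, so for x >= 0 this finite sum is the value of the whole series. *)
Definition glued x := \sum_(j < (Num.truncn x).+1) f_ j x.
Definition dglued x := \sum_(j < (Num.truncn x).+1) df_ j x.

Lemma pieces_separated i j : (i < j)%N -> r i < L j.
Proof.
elim: j => // j IH; rewrite ltnS leq_eqVlt => /predU1P[->//|/IH h].
exact: lt_trans (lt_le_trans h (Lr j)) (sep j).
Qed.

Lemma piece_eq0 j x : 0 <= x -> (x < L j) || (r j < x) -> f_ j x = 0 /\ df_ j x = 0.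
Proof. by move=> x0; have [_ _] := hb j; apply. Qed.

Lemma one_piece x : 0 <= x -> exists j, forall i, i != j -> f_ i x = 0 /\ df_ i x = 0.
Proof.
move=> x0; have [[j hj]|h] := pselect (exists j, L j <= x <= r j); last first.
  exists 0%N => i _; apply: piece_eq0 => //; apply: contrapT => /negP.
  by rewrite negb_or -!leNgt => hi; apply: h; exists i.
exists j => i; rewrite neq_ltn; case/andP: hj => h1 h2 /orP[ij|ji]; apply: piece_eq0 => //.
  by rewrite (lt_le_trans (pieces_separated ij) h1) orbT.
by rewrite (le_lt_trans h2 (pieces_separated ji)).
Qed.

Lemma late_piece j x : 0 <= x -> x < j%:R -> f_ j x = 0 /\ df_ j x = 0.
Proof. by move=> x0 xj; apply: piece_eq0 => //; rewrite (lt_le_trans xj). Qed.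

(** At each point at most one piece is nonzero, so any density that vanishes at (0, 0) passes
    through the sum. Leaving [h] free serves value, derivative, energy, norm and channels at
    once. *)
Lemma glue_sum (h : R -> R -> R -> R) x n : (forall y, h y 0 0 = 0) -> 0 <= x ->
  x < n%:R -> h x (glued x) (dglued x) = \sum_(j < n) h x (f_ j x) (df_ j x).
Proof.
move=> h0 x0 xn; have [j hj] := one_piece x0.
have sumE (u : nat -> R) m : (forall i, i != j -> u i = 0) -> (x < m%:R -> (m <= j)%N -> u j = 0) ->
    x < m%:R -> \sum_(i < m) u i = u j.
  move=> u0 ul xm; have [jm|mj] := ltnP j m.
    rewrite (bigD1 (Ordinal jm))//= big1 ?addr0// => i ij.
    by apply: u0; apply: contra ij => /eqP ij; apply/eqP/val_inj.
  rewrite ul// big1// => i _; apply: u0.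
  by rewrite neq_ltn (leq_trans (ltn_ord i) mj).
have lt m : x < m%:R -> (m <= j)%N -> f_ j x = 0 /\ df_ j x = 0.
  by move=> xm mj; apply: late_piece => //; apply: lt_le_trans xm _; rewrite ler_nat.
have xt : x < (Num.truncn x).+1%:R by exact: truncnS_gt.
rewrite (sumE (fun i => h x (f_ i x) (df_ i x)))//; last 2 first.
- by move=> i /hj[-> ->].
- by move=> xm mj; have [-> ->] := lt n xm mj.
rewrite /glued /dglued (sumE (fun i => f_ i x))//; last 2 first.
- by move=> i /hj[].
- by move=> xm mj; have [] := lt _ xm mj.
rewrite (sumE (fun i => df_ i x))//.
- by move=> i /hj[].
- by move=> xm mj; have [] := lt _ xm mj.
Qed.

Lemma glue_ac : ac glued dglued.
Proof.
move=> x x0; pose n := (Num.truncn x).+1.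
have xn : x < n%:R by exact: truncnS_gt.
have gE y : 0 <= y -> y <= x -> glued y = \sum_(j < n) f_ j y.
  by move=> y0 yx; apply: (@glue_sum (fun _ u _ => u)) => //; exact: le_lt_trans xn.
have dgE y : 0 <= y -> y <= x -> dglued y = \sum_(j < n) df_ j y.
  by move=> y0 yx; apply: (@glue_sum (fun _ _ u => u)) => //; exact: le_lt_trans xn.
have aj j : ac (f_ j) (df_ j) by have [_ [? _ _ _ _] _] := hb j.
have [i e] := ac_sum n aj x0.
have eq_on y : `[0, x]%classic y -> \sum_(j < n) df_ j y = dglued y.
  by rewrite /= in_itv/= => /andP[y0 yx]; rewrite dgE.
split; first by apply: (@eq_rint _ _ _ mu _ _ (fun y => \sum_(j < n) df_ j y)).
rewrite !gE// e; congr (_ + _); apply: eq_Rintegral => y; rewrite inE; exact: eq_on.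
Qed.

Section Bound.
Context (h : R -> R -> R -> R) (delta : R).
Hypothesis h0 : forall y, h y 0 0 = 0.
Hypothesis hge0 : forall y u v : R, 0 < y -> 0 <= h y u v.
Hypothesis mh : measurable_fun H (fun x => h x (glued x) (dglued x)).
Hypothesis ih : forall j, mu.-integrable H (EFin \o (fun x => h x (f_ j x) (df_ j x))).
Hypothesis hdelta : forall j,
  \int[mu]_(x in H) h x (f_ j.+1 x) (df_ j.+1 x) <= delta / 2 ^+ j.+1.

(** The allowances delta / 2^(j+1) of the later pieces add up to at most delta, and piece 0 is
    counted in full. On each segment the sum is finite; monotone convergence passes to the half
    line. *)
Lemma glue_bound : mu.-integrable H (EFin \o (fun x => h x (glued x) (dglued x))) /\
  \int[mu]_(x in H) h x (glued x) (dglued x) <=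
  \int[mu]_(x in H) h x (f_ 0%N x) (df_ 0%N x) + delta.
Proof.
set I0 := \int[mu]_(x in H) h x (f_ 0%N x) (df_ 0%N x).
have Hx0 x : H x -> 0 < x by rewrite /= in_itv/= andbT.
have sb n : \sum_(j < n.+1) \int[mu]_(x in H) h x (f_ j x) (df_ j x) <= I0 + delta * (1 - 2 ^- n).
  elim: n => [|n IH]; first by rewrite big_ord_recr big_ord0/= expr0 invr1 subrr mulr0 addr0 add0r.
  rewrite big_ord_recr/=; have := hdelta n; move: IH.
  have -> : 2 ^- n = 2 * 2 ^- n.+1 :> R by rewrite exprS; field; rewrite expf_neq0.
  by lra.
have d0 : 0 <= delta.
  have := hdelta 0; rewrite expr1 => h1.
  have : 0 <= \int[mu]_(x in H) h x (f_ 1%N x) (df_ 1%N x).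
    by apply: Rintegral_ge0 => x /Hx0; exact: hge0.
  by lra.
have le : (\int[mu]_(x in H) (h x (glued x) (dglued x))%:E <= (I0 + delta)%:E)%E.
  apply: le_halfline_segments => // [x /Hx0|n]; first exact: hge0.
  have sub : (`]0, n%:R]%classic : set R) `<=` H.
    by move=> x /=; rewrite !in_itv/= => /andP[->].
  have is_ : mu.-integrable H (EFin \o (fun x => \sum_(j < n.+1) h x (f_ j x) (df_ j x))).
    by apply: (@rint_sum _ _ _ mu _ _ (fun j x => h x (f_ j x) (df_ j x))).
  have -> : (\int[mu]_(x in `]0%R, n%:R%R]) (h x (glued x) (dglued x))%:E =
      \int[mu]_(x in `]0%R, n%:R%R]) (\sum_(j < n.+1) h x (f_ j x) (df_ j x))%R%:E)%E.
    apply: eq_integral => x; rewrite inE/= in_itv/= => /andP[x0 xn]; congr _%:E.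
    by apply: glue_sum => //; [exact: ltW|rewrite (le_lt_trans xn)// ltr_nat].
  apply: (@le_trans _ _ (\int[mu]_(x in H) (\sum_(j < n.+1) h x (f_ j x) (df_ j x))%R%:E)%E).
    apply: ge0_subset_integral => //; first exact: (measurable_int _ is_).
    by move=> x /Hx0 x0; rewrite lee_fin sumr_ge0// => j _; exact: hge0.
  rewrite -EFin_Rintegral// (@Rintegral_sum _ _ _ mu _ _ (fun j x => h x (f_ j x) (df_ j x)))// lee_fin; apply: le_trans (sb n) _.
  by rewrite lerD2l ler_piMr// lerBlDr lerDl invr_ge0 exprn_ge0.
have i : mu.-integrable H (EFin \o (fun x => h x (glued x) (dglued x))).
  apply/rint_ltyP => //; first by move=> x /Hx0; exact: hge0.
  by apply: le_lt_trans le _; exact: ltry.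
by split => //; rewrite -lee_fin EFin_Rintegral.
Qed.

End Bound.

(** A convergent total dominates every partial sum; this will turn infinitely many pieces of mass 1
    into a divergence. *)
Lemma glue_lower (h : R -> R -> R -> R) n :
  (forall y, h y 0 0 = 0) -> (forall y u v : R, 0 < y -> 0 <= h y u v) ->
  mu.-integrable H (EFin \o (fun x => h x (glued x) (dglued x))) ->
  (forall j, mu.-integrable H (EFin \o (fun x => h x (f_ j x) (df_ j x)))) ->
  \sum_(j < n) \int[mu]_(x in H) h x (f_ j x) (df_ j x) <=
  \int[mu]_(x in H) h x (glued x) (dglued x).
Proof.
move=> h0 hge0 ig ih.
rewrite -(@Rintegral_sum _ _ _ mu _ _ (fun j x => h x (f_ j x) (df_ j x)))//.
apply: le_Rintegral => //.
  by apply: (@rint_sum _ _ _ mu _ _ (fun j x => h x (f_ j x) (df_ j x))).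
move=> x; rewrite /= in_itv/= andbT => x0.
pose N := maxn n (Num.truncn x).+1.
have xN : x < N%:R.
  by apply: lt_le_trans (truncnS_gt x) _; rewrite ler_nat leq_maxr.
rewrite (glue_sum h0 (ltW x0) xN).
rewrite (big_ord_widen N (fun j => h x (f_ j x) (df_ j x)) (leq_maxl _ _)).
by rewrite [leRHS](bigID (fun j : 'I_N => (j < n)%N))/= lerDl sumr_ge0// => j _; exact: hge0.
Qed.

End Pieces.
End Gluing.

(** * Realizing a prescribed pattern of convergence *)

Section ClassGlue.
Context {R : realType}.
Notation mu := (@lebesgue_measure R).
Notation H := (halfline R).
Implicit Types (x t cc : R) (w : R -> R) (n : nat) (a : bool -> bool).

Lemma glue_piece k (f_ df_ : nat -> R -> R) (L r : nat -> R) :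
  (forall j, bumpf k (L j) (r j) (f_ j) (df_ j)) -> (forall j, r j < L j.+1) ->
  (forall j, L j <= r j) -> (forall j, j%:R <= L j) ->
  forall x, 0 <= x -> exists j, [/\ glued f_ x = f_ j x, dglued df_ x = df_ j x &
    forall i, i != j -> f_ i x = 0 /\ df_ i x = 0].
Proof.
move=> hb sep Lr Lj x x0; have [j hj] := one_piece hb sep Lr x0.
exists j; pose n := maxn j.+1 (Num.truncn x).+1.
have xn : x < n%:R by apply: lt_le_trans (truncnS_gt x) _; rewrite ler_nat leq_maxr.
have jn : (j < n)%N by rewrite leq_maxl.
have e (u : nat -> R) : (forall i, i != j -> u i = 0) -> \sum_(i < n) u i = u j.
  move=> u0; rewrite (bigD1 (Ordinal jn))//= big1 ?addr0// => i ij.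
  by apply: u0; apply: contra ij => /eqP ij; apply/eqP/val_inj.
split => //.
  rewrite (glue_sum hb sep Lr Lj (h := fun _ u _ => u) _ x0 xn)//.
  by rewrite (e (fun i => f_ i x))// => i /hj[].
rewrite (glue_sum hb sep Lr Lj (h := fun _ _ u => u) _ x0 xn)//.
by rewrite (e (fun i => df_ i x))// => i /hj[].
Qed.

(** The right end of the previous piece is part of the state of the recursion, and the next spike is
    requested beyond it. *)
Lemma spike_sequence k w a (l0 r0 delta : R) (g dg : R -> R) (ch : nat -> bool) :
  bumpf k l0 r0 g dg -> 0 < delta ->
  (forall j n, exists f df, spike k w a (ch j) n f df) ->
  exists (f_ df_ : nat -> R -> R) (L r : nat -> R),
  [/\ f_ 0%N = g, df_ 0%N = dg, (forall j, bumpf k (L j) (r j) (f_ j) (df_ j)) &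
   [/\ forall j, r j < L j.+1, forall j, L j <= r j, forall j, j%:R <= L j &
    forall j, [/\ 1 < chanN k w (ch j) (f_ j.+1) (df_ j.+1),
      energy2 k (f_ j.+1) (df_ j.+1) + normsq (f_ j.+1) <= delta / 2 ^+ j.+1 &
      forall c, a c -> chanN k w c (f_ j.+1) (df_ j.+1) <= delta / 2 ^+ j.+1]]].
Proof.
move=> bg d0 hs.
pose P (p : nat * R) (q : (R -> R) * (R -> R) * (R * R)) :=
  [/\ p.2 < q.2.1, p.1.+1%:R <= q.2.1, q.2.1 <= q.2.2, bumpf k q.2.1 q.2.2 q.1.1 q.1.2 &
    [/\ 1 < chanN k w (ch p.1) q.1.1 q.1.2,
      energy2 k q.1.1 q.1.2 + normsq q.1.1 <= delta / 2 ^+ p.1.+1 &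
      forall c, a c -> chanN k w c q.1.1 q.1.2 <= delta / 2 ^+ p.1.+1]].
have widen l r r' f df : r <= r' -> bumpf k l r f df -> bumpf k l r' f df.
  move=> rr [? ? h]; split => // x x0 /orP[xl|rx]; apply: h => //; first by rewrite xl.
  by rewrite (le_lt_trans rr rx) orbT.
have /choice[S hS] : forall p, exists q, P p q.
  move=> [j r].
  (* One index for three demands: at least j+1, beyond the previous right end, and 1/(n+1) within
     the allowance delta / 2^(j+1). *)
  pose n := maxn j.+1 (maxn (Num.truncn `|r|).+1 (Num.truncn (2 ^+ j.+1 / delta)).+1).
  have nj : j.+1%:R <= n%:R :> R by rewrite ler_nat leq_maxl.
  have nr : r < n%:R.
    apply: le_lt_trans (ler_norm r) _; apply: lt_le_trans (truncnS_gt _) _.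
    by rewrite ler_nat /n maxnCA leq_maxl.
  have nd : n.+1%:R^-1 <= delta / 2 ^+ j.+1.
    rewrite -[leRHS]invrK lef_pV2 ?posrE ?invr_gt0 ?divr_gt0 ?exprn_gt0//.
    rewrite invf_div; apply: ltW; apply: lt_le_trans (truncnS_gt _) _.
    by rewrite ler_nat (leq_trans _ (leqnSn _))// /n !leq_max leqnn !orbT.
  have [f [df [l [r' [nl b h1 h2 h3]]]]] := hs j n.
  (* A spike may come with r' < l; enlarging its right end is harmless and gives the ordering of end
     points that the gluing asks for. *)
  exists ((f, df), (l, Num.max l r')); split => /=.
  - exact: lt_le_trans nl.
  - exact: le_trans nl.
  - by rewrite le_max lexx.
  - by apply: widen b; rewrite le_max lexx orbT.
  - split => //; first by apply: le_trans (ltW h2) _.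
    by move=> c ac; apply: le_trans (ltW (h3 c ac)) _.
pose fix st j : (R -> R) * (R -> R) * (R * R) :=
  if j is j'.+1 then S (j', (st j').2.2) else ((g, dg), (l0, Num.max l0 r0)).
have stP j : P (j, (st j).2.2) (st j.+1) by exact: hS.
have l00 : 0 < l0 by case: bg.
exists (fun j => (st j).1.1), (fun j => (st j).1.2), (fun j => (st j).2.1), (fun j => (st j).2.2).
split => //; last split.
- case=> [|j]; last by have [] := stP j.
  by apply: widen bg; rewrite le_max lexx orbT.
- by move=> j; have [] := stP j.
- by case=> [|j]; [rewrite /= le_max lexx|have [] := stP j].
- by case=> [|j]; [exact: ltW|have [] := stP j].
- by move=> j; have [_ _ _ _ []] := stP j.
Qed.

(** The given bump makes [qform] positive, and the spikes glued to it use up at most half of that.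
    Each failing channel receives infinitely many spikes of mass above 1 and so diverges; the
    channels of [a] receive a summable amount. *)
Lemma class_glue k w a cc t (l0 r0 : R) g dg : continuous w ->
  bumpf k l0 r0 g dg -> 0 < qform k w a cc t g dg ->
  (forall c, ~~ a c -> forall n, exists f df, spike k w a c n f df) ->
  exists f df, [/\ finen k f df,
    forall c, mu.-integrable H (EFin \o chan k w c f df) <-> a c &
    0 < qform k w a cc t f df].
Proof.
move=> cw bg q0 hs.
have [[c0 nc0]|all_a] := pselect (exists c0, ~~ a c0); last first.
  exists g, dg; split => //; first by case: bg.
  move=> c; split=> _; last exact: bumpf_chan_rint bg.
  by apply: contrapT => /negP nc; apply: all_a; exists c.
(* Both failing channels if both fail, otherwise the only failing one twice. *)
pose c1 := if a true then c0 else true.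
pose c2 := if a false then c0 else false.
have nc1 : ~~ a c1 by rewrite /c1; case: ifPn.
have nc2 : ~~ a c2 by rewrite /c2; case: ifPn.
pose ch j := if odd j then c1 else c2.
(* The spikes lower [qform] by at most delta (2 |cc| + |t| + 1): one delta for each convergent
   channel, one for the norm and one for the energy. *)
pose K := 2 * `|cc| + `|t| + 1.
have K0 : 0 < K by rewrite /K ltr_wpDl// addr_ge0// mulr_ge0.
pose delta := qform k w a cc t g dg / (2 * K).
have d0 : 0 < delta by rewrite divr_gt0// mulr_gt0.
have hch j n : exists f df, spike k w a (ch j) n f df.
  by apply: hs; rewrite /ch; case: ifP.
have [f_ [df_ [L [r [f0 df0 hb [sep Lr Lj hsp]]]]]] := spike_sequence bg d0 hch.
have gac := glue_ac hb sep Lr Lj.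
have [mf mdf] := ac_measurable gac.
have {}mf : measurable_fun H (glued f_) by apply: measurable_funS mf => //; exact: halfline_sub_ge0.
have {}mdf : measurable_fun H (dglued df_) by apply: measurable_funS mdf => //; exact: halfline_sub_ge0.
have mp := @pot_measurable R k H (measurable_itv _).
have fe j : finen k (f_ j) (df_ j) by have [] := hb j.
set f := glued f_; set df := dglued df_.
have gb := glue_bound hb sep Lr Lj.
have [iE bE] : mu.-integrable H (EFin \o (fun x => df x ^+ 2 + pot k x * f x ^+ 2)) /\
    energy2 k f df <= energy2 k g dg + delta.
  rewrite -{1}f0 -{1}df0.
  apply: (gb (fun x u v => v ^+ 2 + pot k x * u ^+ 2)) => [y|y u v _| |j|j].
  - by rewrite !expr0n/= mulr0 addr0.
  - apply: addr_ge0; first exact: sqr_ge0.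
    by apply: mulr_ge0; [exact: pot_ge0|exact: sqr_ge0].
  - by apply: measurable_funD; [|apply: measurable_funM => //]; exact: (measurable_funX 2).
  - by have [_ _ i1 i2 _] := fe j; exact: rintD.
  - have [_ h _] := hsp j; apply: le_trans h.
    by rewrite lerDl normsq_ge0.
have [jN bN] : mu.-integrable H (EFin \o (fun x => f x ^+ 2)) /\
    normsq f <= normsq g + delta.
  rewrite -{1}f0.
  apply: (gb (fun x u v => u ^+ 2)) => [y|y u v _| |j|j].
  - by rewrite !expr0n.
  - exact: sqr_ge0.
  - exact: (measurable_funX 2).
  - by have [] := fe j.
  - have [_ h _] := hsp j; apply: le_trans h.
    by rewrite lerDr energy2_ge0.
have fg : finen k f df.
  split => //.
  - by rewrite /f /glued big1// => j _; have [_ ? _ _ _] := fe j.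
  - apply: (rint_le _ _ _ iE) => //; first exact: (measurable_funX 2).
    move=> x _; rewrite ger0_norm ?sqr_ge0// lerDl.
    by apply: mulr_ge0; [exact: pot_ge0|exact: sqr_ge0].
  - apply: (rint_le _ _ _ iE) => //.
      by apply: measurable_funM => //; exact: (measurable_funX 2).
    move=> x _; rewrite ger0_norm; first by rewrite lerDr sqr_ge0.
    by apply: mulr_ge0; [exact: pot_ge0|exact: sqr_ge0].
have lowN : normsq g <= normsq f.
  have := @glue_lower _ k f_ df_ L r hb sep Lr Lj (fun x u v => u ^+ 2) 1.
  rewrite big_ord1 f0; apply => //; first by move=> y; rewrite expr0n.
  - by move=> y u v _; exact: sqr_ge0.
  - by move=> j; have [] := fe j.
have ichj c j : mu.-integrable H (EFin \o chan k w c (f_ j) (df_ j)).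
  exact: bumpf_chan_rint (hb j).
pose hc c (x u v : R) := `|chan k w c (fun _ => u) (fun _ => v) x|.
have hc0 c y : hc c y 0 0 = 0 by rewrite /hc chan_eq0// normr0.
have igood c : a c -> mu.-integrable H (EFin \o chan k w c f df) /\
    `|chanI k w c f df - chanI k w c g dg| <= delta.
  move=> ac.
  have [iC bC] : mu.-integrable H (EFin \o (fun x => `|chan k w c f df x|)) /\
      chanN k w c f df <= chanN k w c g dg + delta.
    rewrite -{1}f0 -{1}df0.
    apply: (gb (hc c)) => [y|y u v _| |j|j].
    - exact: hc0.
    - exact: normr_ge0.
    - by apply: measurableT_comp => //; exact: chan_measurable.
    - by apply: integrable_norm; exact: ichj.
    - by have [_ _ h] := hsp j; exact: h.
  have ic : mu.-integrable H (EFin \o chan k w c f df).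
    apply: (rint_le _ _ _ iC) => //; exact: chan_measurable.
  have ic0 : mu.-integrable H (EFin \o chan k w c g dg) by rewrite -f0 -df0.
  split => //; rewrite /chanI -RintegralB//.
  have id : mu.-integrable H (EFin \o (fun x => chan k w c f df x - chan k w c g dg x)).
    exact: rintB.
  apply: le_trans (le_normr_Rintegral _ id) _ => //.
  have -> : \int[mu]_(x in H) `|chan k w c f df x - chan k w c g dg x| =
      \int[mu]_(x in H) (`|chan k w c f df x| - `|chan k w c g dg x|).
  apply: eq_Rintegral => x; rewrite inE/= in_itv/= andbT => x0.
  have [j [e1 e2 hj]] := glue_piece hb sep Lr Lj (ltW x0).
  have -> : chan k w c f df x = chan k w c (f_ j) (df_ j) x by exact: chan_eq.
  rewrite -f0 -df0; have [->|j0] := eqVneq j 0%N; first by rewrite !subrr normr0.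
  have [h1 h2] : f_ 0%N x = 0 /\ df_ 0%N x = 0 by apply: hj; rewrite eq_sym.
  by rewrite [chan _ _ _ (f_ 0%N) _ _]chan_eq0// normr0 !subr0.
  by rewrite RintegralB// ?lerBlDr 1?addrC//; exact: integrable_norm.
exists f, df; split => //.
- move=> c; split=> [ic|ac]; last by have [] := igood c ac.
  apply: contrapT => /negP nac.
  have lowC n : \sum_(j < n) chanN k w c (f_ j) (df_ j) <= chanN k w c f df.
    apply: (@glue_lower _ k f_ df_ L r hb sep Lr Lj (hc c)) => //.
    - by move=> y u v _; exact: normr_ge0.
    - exact: integrable_norm.
    - by move=> j; apply: integrable_norm; exact: ichj.
  (* Two consecutive spikes serve both [c1] and [c2], so a failing channel gains more than 1 every
     two pieces; the extra term is piece 0. *)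
  have many m : m%:R <= \sum_(j < (m.*2).+1) chanN k w c (f_ j) (df_ j).
    elim: m => [|m IH]; first by rewrite sumr_ge0// => j _; exact: chanN_ge0.
    rewrite doubleS !big_ord_recr/= -/(m.*2.+1) -natr1 in IH *.
    have n1 := chanN_ge0 k w c (f_ m.*2.+1) (df_ m.*2.+1).
    have n2 := chanN_ge0 k w c (f_ m.*2.+2) (df_ m.*2.+2).
    have [h1 _ _] := hsp m.*2; have [h2 _ _] := hsp m.*2.+1.
    rewrite /ch /= odd_double/= in h1 h2.
    have cE : c = c1 \/ c = c2.
      rewrite /c1 /c2; case: c nac {ic lowC IH n1 n2} => /negbTE ->; [by left|by right].
    by case: cE => e; rewrite -e in h1 h2; lra.
  have := le_trans (many (Num.truncn (chanN k w c f df)).+1) (lowC _).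
  by rewrite leNgt truncnS_gt.
- have dE : delta * (2 * K) = qform k w a cc t g dg.
    by rewrite /delta divfK// gt_eqF// mulr_gt0.
  have bI c : `|(if a c then chanI k w c f df else 0) - (if a c then chanI k w c g dg else 0)| <= delta.
    by case: ifP => [/igood[]//|_]; rewrite subrr normr0 ltW.
  pose It := (if a true then chanI k w true f df else 0) - (if a true then chanI k w true g dg else 0).
  pose If := (if a false then chanI k w false f df else 0) - (if a false then chanI k w false g dg else 0).
  have bcc : `|cc * (It - If)| <= `|cc| * (2 * delta).
    rewrite normrM ler_wpM2l//; apply: le_trans (ler_normB _ _) _.
    by have := bI true; have := bI false; rewrite -/It -/If; lra.
  have btt : `|t * (normsq f - normsq g)| <= `|t| * delta.
    by rewrite normrM ler_wpM2l// ger0_norm ?subr_ge0// lerBlDr addrC.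
  have -> : qform k w a cc t f df = qform k w a cc t g dg + cc * (It - If)
     - (energy2 k f df - energy2 k g dg) - t * (normsq f - normsq g).
    by rewrite /qform /It /If; ring.
  rewrite -dE; move: bcc btt; rewrite !ler_norml => /andP[b1 _] /andP[_ b2].
  have : 0 < delta * (1 + `|t| + 2 * `|cc|) by rewrite mulr_gt0// -addrA ltr_wpDr// addr_ge0// mulr_ge0.
  by rewrite /K; lra.
Qed.

End ClassGlue.

(** * Open sets of paths and their measurability *)

Section PathSpace.
Context {R : realType}.
Implicit Types (w v : R -> R) (x : R) (i j m n N M : nat) (U V : set (R -> R)).

(** Openness for locally uniform convergence on the half line, tested on continuous paths only. *)
Definition path_open U := forall w, continuous w -> U w ->
  exists N (e : R), 0 < e /\ forall v, continuous v ->
    (forall x, 0 <= x <= N%:R -> `|v x - w x| <= e) -> U v.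

Definition dyad i m : R := i%:R / 2 ^+ m.

Definition grid_events m : set (set (R -> R)) :=
  [set X | exists i (A : set R), measurable A /\
    X = [set w | A (w (dyad i m) - w 0)]].

(** The sigma-algebras of the levels increase with m. Their union need not be a sigma-algebra, but
    it is stable under intersection, as a Dynkin argument requires. *)
Definition path_events : set (set (R -> R)) := \bigcup_m <<s grid_events m>>.

(** Heine-Cantor on a segment, the second point being allowed to leave it. *)
Lemma uniform_modulus w N (e : R) : continuous w -> 0 < e ->
  exists M, forall x y, 0 <= x <= N%:R -> `|x - y| <= M.+1%:R^-1 -> `|w x - w y| <= e.
Proof.
move=> cw e0.
have /compact_near_coveringP cpt := @segment_compact R 0 N%:R.
have [] := @cpt nat \oo (fun M x => forall y, `|x - y| <= M.+1%:R^-1 -> `|w x - w y| <= e) _ _.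
  move=> x _; have e20 : 0 < e / 2 by exact: divr_gt0.
  have /cvgrPdist_le /(_ _ e20) /nbhs_ballP[d /= d0 hd] := cw x.
  have d20 : 0 < d / 2 by exact: divr_gt0.
  near=> x' M => y x'y.
  have hx' : `|x - x'| < d / 2 by near: x'; exact: nbhsx_ballx.
  have hM : M.+1%:R^-1 < d / 2 by near: M; exact: near_infty_natSinv_lt (PosNum d20).
  have dd : d / 2 < d by rewrite ltr_pdivrMr// ltr_pMr// ltr1n.
  have h1 : `|w x - w x'| <= e / 2 by apply: hd; exact: lt_trans hx' dd.
  have h2 : `|w x - w y| <= e / 2.
    apply: hd; rewrite /ball/=.
    have -> : d = d / 2 + d / 2 by field.
    have -> : x - y = (x - x') + (x' - y) by lra.
    apply: le_lt_trans (ler_normD _ _) _.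
    by apply: ltr_leD => //; exact: ltW (le_lt_trans x'y hM).
  have -> : w x' - w y = (w x - w y) - (w x - w x') by lra.
  by apply: le_trans (ler_normB _ _) _; lra.
move=> M _ hM; exists M => x y xN; apply: (hM M (leqnn M)).
by rewrite /= in_itv.
Unshelve. all: by end_near. Qed.

Lemma dyad_approx x (e : R) : 0 <= x -> 0 < e -> exists i j,
  dyad i j <= x /\ `|x - dyad i j| <= e.
Proof.
move=> x0 e0; pose j := Num.truncn e^-1.
have j0 : 0 < 2 ^+ j :> R by exact: exprn_gt0.
have je : (2 ^+ j)^-1 <= e.
  rewrite invf_ple ?posrE//; apply: ltW; apply: lt_le_trans (truncnS_gt _) _.
  by rewrite -natrX ler_nat ltn_expl.
exists (Num.truncn (x * 2 ^+ j)), j.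
have xj : 0 <= x * 2 ^+ j by rewrite mulr_ge0// ltW.
have h1 : (Num.truncn (x * 2 ^+ j))%:R <= x * 2 ^+ j by rewrite truncn_le.
have h2 := truncnS_gt (x * 2 ^+ j).
have h3 : dyad (Num.truncn (x * 2 ^+ j)) j <= x by rewrite /dyad ler_pdivrMr.
split => //; rewrite ger0_norm ?subr_ge0//.
apply: le_trans je; rewrite lerBlDr -[in leRHS](mul1r (2 ^+ j)^-1) /dyad -mulrDl ler_pdivlMr//.
by rewrite addrC natr1 ltW.
Qed.

(** A tube around a step function with rational values on cells of length 1/(M+1). Its parameters
    form a countable type, and it is tested at dyadic times only, which makes it an event;
    continuity recovers the other times. *)
Definition step_tube (p : nat * nat * nat * seq rat) : set (R -> R) :=
  let: (N, M, m, s) := p in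
  [set w | forall i j, dyad i j <= N%:R ->
    `|w (dyad i j) - w 0 - ratr (nth 0 s (Num.truncn (dyad i j * M.+1%:R)))| <= m.+1%:R^-1].

Lemma step_tube_event p : <<s path_events >> (step_tube p).
Proof.
move: p => [[[N M] m] s].
rewrite -[X in X _]/(@measurable _ (g_sigma_algebraType path_events)).
have -> : step_tube (N, M, m, s) = \bigcap_i \bigcap_j (if dyad i j <= N%:R then
    [set w | `|w (dyad i j) - w 0 - ratr (nth 0 s (Num.truncn (dyad i j * M.+1%:R)))| <= m.+1%:R^-1]
    else setT).
  apply/seteqP; split => [w hw i _ j _|w hw i j ij].
    by case: ifP => // ij; exact: hw.
  by have := hw i Logic.I j Logic.I; rewrite ij.
apply: bigcapT_measurable => i; apply: bigcapT_measurable => j.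
case: ifP => // ij; apply: sub_sigma_algebra; exists j => //.
apply: sub_sigma_algebra; exists i.
set r := ratr _.
exists `[r - m.+1%:R^-1, r + m.+1%:R^-1]%classic; split; first exact: measurable_itv.
by apply/seteqP; split => w /=; rewrite in_itv/= ler_distl.
Qed.

(** Separability of the path space: on continuous paths from 0, [U] is the union of the countably
    many tubes inside it. Two paths in a tube of radius at most e/2 are e-close at dyadic times of
    [0, N], hence on [0, N] by continuity. *)
Lemma path_open_event U : path_open U -> exists V, <<s path_events >> V /\
  forall w, continuous w -> w 0 = 0 -> (U w <-> V w).
Proof.
move=> oU.
pose good p := forall w, continuous w -> w 0 = 0 -> step_tube p w -> U w.
pose V := \bigcup_n (if unpickle n is Some p then if asbool (good p) then step_tube p else set0 else set0).
exists V; split.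
  rewrite -[X in X _]/(@measurable _ (g_sigma_algebraType path_events)).
  apply: bigcupT_measurable => n; case: unpickle => // p.
  by case: ifP => // _; exact: step_tube_event.
move=> w cw w0; split; last first.
  case=> n _; case: unpickle => // p; case: ifP => // /asboolP gp.
  exact: gp.
move=> Uw; have [N [e [e0 he]]] := oU w cw Uw.
pose m := Num.truncn (2 / e).
have m0 : 0 < m.+1%:R^-1 :> R by rewrite invr_gt0.
have me : m.+1%:R^-1 <= e / 2.
  rewrite -[leRHS]invrK lef_pV2 ?posrE ?invr_gt0 ?divr_gt0// invf_div ltW//.
  exact: truncnS_gt.
have m20 : 0 < m.+1%:R^-1 / 2 :> R by exact: divr_gt0.
have [M hM] := uniform_modulus N cw m20.
have /choice[q hq] : forall i, exists q : rat,
    `|w (i%:R / M.+1%:R) - ratr q| <= m.+1%:R^-1 / 2.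
  move=> i; have lt_i : w (i%:R / M.+1%:R) < w (i%:R / M.+1%:R) + m.+1%:R^-1 / 2.
    by rewrite ltrDl.
  have [q] := rat_in_itvoo lt_i.
  rewrite in_itv/= => /andP[q1 q2]; exists q.
  by rewrite distrC ger0_norm ?subr_ge0 ?(ltW q1)// lerBlDl ltW.
(* The step function samples w, up to half a radius, at the nodes l/(M+1) for l from 0 to N
   (M+1). *)
pose p := (N, M, m, mkseq q (N * M.+1).+1).
have M0 : 0 < M.+1%:R :> R by [].
have Bw : step_tube p w.
  move=> i j ij; set x := dyad i j in ij *.
  have x0 : 0 <= x by rewrite /x /dyad divr_ge0// exprn_ge0.
  set l := Num.truncn (x * M.+1%:R).
  have xM0 : 0 <= x * M.+1%:R by rewrite mulr_ge0.
  have l1 : l%:R <= x * M.+1%:R by rewrite truncn_le.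
  have l2 := truncnS_gt (x * M.+1%:R).
  have lN : (l < (N * M.+1).+1)%N.
    rewrite ltnS -(@ler_nat R); apply: le_trans l1 _.
    by rewrite natrM ler_wpM2r.
  rewrite nth_mkseq// w0 subr0.
  have h : `|w x - w (l%:R / M.+1%:R)| <= m.+1%:R^-1 / 2.
    apply: hM; first by rewrite x0.
    rewrite ger0_norm ?subr_ge0 ?ler_pdivrMr// lerBlDr.
    have -> : M.+1%:R^-1 + l%:R / M.+1%:R = l.+1%:R / M.+1%:R :> R by rewrite -natr1; ring.
    by rewrite ler_pdivlMr// ltW.
  have -> : w x - ratr (q l) = (w x - w (l%:R / M.+1%:R)) + (w (l%:R / M.+1%:R) - ratr (q l)) by lra.
  by apply: le_trans (ler_normD _ _) _; rewrite [leRHS]splitr; apply: lerD.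
exists (pickle p) => //; rewrite pickleK; case: ifPn => //.
move=> /asboolPn; apply => v cv v0 Bv; apply: he => // x /andP[x0 xN].
apply/ler_addgt0Pl => eta eta0.
have c2 : continuous (fun y => v y - w y) by move=> y; apply: cvgB; [exact: cv|exact: cw].
have [M' hM'] := uniform_modulus N c2 eta0.
have M'0 : 0 < M'.+1%:R^-1 :> R by rewrite invr_gt0.
have [i [j [d1 d2]]] := dyad_approx x0 M'0.
have h1 := hM' x (dyad i j) (introT andP (conj x0 xN)) d2.
have h2 := Bv i j (le_trans d1 xN).
have h3 := Bw i j (le_trans d1 xN).
rewrite v0 subr0 in h2; rewrite w0 subr0 in h3.
set r := ratr _ in h2 h3.
have -> : v x - w x = (v x - w x - (v (dyad i j) - w (dyad i j))) +
   ((v (dyad i j) - r) - (w (dyad i j) - r)) by lra.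
apply: le_trans (ler_normD _ _) _; apply: lerD => //.
apply: le_trans (ler_normB _ _) _; rewrite [e]splitr.
by apply: lerD; [exact: le_trans h2 me|exact: le_trans h3 me].
Qed.

End PathSpace.

(** * Open conditions on paths *)

Section Openness.
Context {R : realType}.
Notation mu := (@lebesgue_measure R).
Notation H := (halfline R).
Implicit Types (w v f df : R -> R) (x t cc : R) (k n N : nat) (U V : set (R -> R)) (a : bool -> bool).

(** Stability under arbitrary unions is what makes the uncountable family of test functions
    harmless. *)
Lemma path_open_exists (I : Type) (U : I -> set (R -> R)) :
  (forall i, path_open (U i)) -> path_open [set w | exists i, U i w].
Proof.
move=> oU w cw [i Ui]; have [N [e [e0 h]]] := oU i w cw Ui.
by exists N, e; split => // v cv vw; exists i; exact: h.
Qed.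

Lemma path_openI U V : path_open U -> path_open V -> path_open (U `&` V).
Proof.
move=> oU oV w cw [Uw Vw].
have [N [e [e0 hU]]] := oU w cw Uw; have [M [d [d0 hV]]] := oV w cw Vw.
exists (maxn N M), (Num.min e d); split; first by rewrite lt_min e0.
move=> v cv h; split; [apply: hU => // x /andP[x0 xN]|apply: hV => // x /andP[x0 xN]];
  (apply: le_trans (h x _) _; first by rewrite x0 (le_trans xN)// ler_nat ?leq_maxl ?leq_maxr);
  by rewrite ge_min lexx ?orbT.
Qed.

Lemma path_open_prop (P : Prop) : path_open [set w : R -> R | P].
Proof. by move=> w cw p; exists 0%N, 1; split. Qed.

Definition path_lipschitz (Phi : (R -> R) -> R) := exists N (C : R), 0 <= C /\
  forall w v (e : R), 0 < e -> continuous w -> continuous v ->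
    (forall x, 0 <= x <= N%:R -> `|v x - w x| <= e) -> `|Phi v - Phi w| <= C * e.

Lemma path_open_gt (Phi : (R -> R) -> R) (b : R) :
  path_lipschitz Phi -> path_open [set w | b < Phi w].
Proof.
move=> [N [C [C0 hC]]] w cw /= bw.
have C1 : 0 < C + 1 by rewrite ltr_wpDl.
pose e := (Phi w - b) / (C + 1).
have e0 : 0 < e by rewrite divr_gt0// subr_gt0.
exists N, e; split => // v cv vw.
have h := hC w v e e0 cw cv vw.
have : C * e < Phi w - b.
  rewrite /e mulrA ltr_pdivrMr// mulrC ltr_pM2l ?subr_gt0// ltrDl.
  exact: ltr01.
by move: h; rewrite ler_norml => /andP[h1 _]; lra.
Qed.

Lemma path_open_lt (Phi : (R -> R) -> R) (b : R) :
  path_lipschitz Phi -> path_open [set w | Phi w < b].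
Proof.
move=> [N [C [C0 hC]]].
have lip : path_lipschitz (fun w => - Phi w).
  exists N, C; split => // w v e e0 cw cv vw.
  by rewrite -opprD normrN; exact: hC.
have := @path_open_gt _ (- b) lip.
by under eq_set do rewrite ltrN2.
Qed.

(** A bump reads the path on [0, r+1] only. A change of the path by e moves an increment by at most
    2e, and a coefficient is at most 2 [envelope]; hence the constant 4. *)
Lemma path_lipschitz_chan k l r f df c : bumpf k l r f df ->
  path_lipschitz (fun w => chanI k w c f df) /\
  path_lipschitz (fun w => chanN k w c f df).
Proof.
move=> b; have ie := bumpf_envelope_rint b.
have [l0 fe h0] := b.
pose C := \int[mu]_(x in H) (4 * envelope k f df x).
have C0 : 0 <= C.
  by apply: Rintegral_ge0 => x _; rewrite mulr_ge0// envelope_ge0.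
(* One unit for rounding up |r|, one for the window [x, x+1]. *)
pose N := (Num.truncn `|r|).+2.
have rN : r <= N%:R - 1.
  rewrite /N -natr1 addrK; apply: le_trans (ler_norm r) _; rewrite ltW//; exact: truncnS_gt.
have key w v (e : R) : 0 < e -> continuous w -> continuous v ->
    (forall x, 0 <= x <= N%:R -> `|v x - w x| <= e) ->
    forall x, H x -> `|chan k v c f df x - chan k w c f df x| <= e * (4 * envelope k f df x).
  move=> e0 cw cv vw x; rewrite /= in_itv/= andbT => x0.
  have e4 : 0 <= e * (4 * envelope k f df x).
    by rewrite !mulr_ge0 ?envelope_ge0// ltW.
  have [rx|xr] := ltP r x.
    have [f0 d0] := h0 x (ltW x0) (introT orP (or_intror rx)).
    by rewrite !chan_eq0// subrr normr0.
  have vw' y : 0 <= y <= N%:R - 1 + 1 -> `|v y - w y| <= e by rewrite subrK; exact: vw.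
  have xN : 0 <= x <= N%:R - 1 by rewrite ltW//= (le_trans xr rN).
  have hi : `|incr v c x - incr w c x| <= 2 * e.
    rewrite /incr; case: c => /=; first exact: step1_dist vw' _ xN.
    exact: osc1_dist (ltW e0) cv cw vw' _ xN.
  rewrite !chanE -mulrBr normrM.
  apply: (@le_trans _ _ (2 * envelope k f df x * (2 * e))).
    by apply: ler_pM => //; exact: coef_le_envelope.
  by rewrite le_eqVlt; apply/orP; left; apply/eqP; ring.
have bound w v (e : R) (g : R -> R) : mu.-integrable H (EFin \o g) ->
    (forall x, H x -> `|g x| <= e * (4 * envelope k f df x)) ->
    `|\int[mu]_(x in H) g x| <= C * e.
  move=> ig hg; apply: le_trans (le_normr_Rintegral _ ig) _ => //.
  have i4 : mu.-integrable H (EFin \o (fun x => 4 * envelope k f df x)) by exact: rintZl.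
  rewrite mulrC /C -RintegralZl//; apply: le_Rintegral => //.
    exact: integrable_norm.
  exact: rintZl.
split; exists N, C; split => // w v e e0 cw cv vw.
  have iw := bumpf_chan_rint c cw b; have iv := bumpf_chan_rint c cv b.
  rewrite /chanI -RintegralB//; apply: bound => //; first exact: rintB.
  exact: key.
have iw := bumpf_chan_rint c cw b; have iv := bumpf_chan_rint c cv b.
have niw := integrable_norm iw; have niv := integrable_norm iv.
rewrite /chanN -RintegralB//; apply: bound => //; first exact: rintB.
move=> x Hx; apply: le_trans (key w v e e0 cw cv vw x Hx).
exact: ler_dist_dist.
Qed.

Lemma path_open_bump k a cc t :
  path_open [set w | exists l r f df, bumpf k l r f df /\ 0 < qform k w a cc t f df].
Proof.
apply: path_open_exists => l; apply: path_open_exists => r.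
apply: path_open_exists => f; apply: path_open_exists => df.
have [b|nb] := pselect (bumpf k l r f df); last by move=> w _ [].
apply: path_openI; first exact: path_open_prop.
apply: path_open_gt.
have lip c : path_lipschitz (fun w => if a c then chanI k w c f df else 0).
  case: (a c); first exact: (path_lipschitz_chan c b).1.
  exists 0%N, 0; split => // w v e e0 _ _ _; by rewrite subrr normr0 mul0r.
have [N [C [C0 hC]]] := lip true; have [M [D [D0 hD]]] := lip false.
exists (maxn N M), (`|cc| * (C + D)); split; first by rewrite mulr_ge0// addr_ge0.
move=> w v e e0 cw cv vw.
have h1 := hC w v e e0 cw cv; have h2 := hD w v e e0 cw cv.
have {}h1 : `|(if a true then chanI k v true f df else 0) -
     (if a true then chanI k w true f df else 0)| <= C * e.
  by apply: h1 => x /andP[x0 xN]; apply: vw; rewrite x0 (le_trans xN)// ler_nat leq_maxl.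
have {}h2 : `|(if a false then chanI k v false f df else 0) -
     (if a false then chanI k w false f df else 0)| <= D * e.
  by apply: h2 => x /andP[x0 xN]; apply: vw; rewrite x0 (le_trans xN)// ler_nat leq_maxr.
rewrite /qform; set A1 := (if a true then _ else _) in h1 *; set A2 := (if a true then _ else _) in h1 *.
set B1 := (if a false then _ else _) in h2 *; set B2 := (if a false then _ else _) in h2 *.
rewrite (_ : _ - _ = cc * ((A1 - A2) - (B1 - B2))); last by ring.
rewrite normrM -mulrA ler_wpM2l//; apply: le_trans (ler_normB _ _) _.
by rewrite mulrDl lerD.
Qed.

(** For a fixed bump, the conditions that involve the path are strict inequalities on functionals
    Lipschitz in the path. *)
Lemma path_open_spike k a c n :
  path_open [set w | exists f df, spike k w a c n f df].
Proof.
apply: path_open_exists => f; apply: path_open_exists => df.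
apply: path_open_exists => l; apply: path_open_exists => r.
have [b|nb] := pselect (bumpf k l r f df); last by move=> w _ [].
have eqU : [set w | [/\ n%:R <= l, bumpf k l r f df, 1 < chanN k w c f df,
    energy2 k f df + normsq f < n.+1%:R^-1 &
    forall c', a c' -> chanN k w c' f df < n.+1%:R^-1]] =
  [set w | [/\ n%:R <= l, bumpf k l r f df & energy2 k f df + normsq f < n.+1%:R^-1]] `&`
  [set w | 1 < chanN k w c f df] `&`
  ([set w | (if a true then chanN k w true f df else 0) < n.+1%:R^-1] `&`
   [set w | (if a false then chanN k w false f df else 0) < n.+1%:R^-1]).
  apply/seteqP; split => w /=.
    move=> [h1 h2 h3 h4 h5]; split; first by split.
    by split; case: ifPn => // ac; exact: h5.
  move=> [[[h1 h2 h4] h3] [h5 h6]]; split => // -[] ac; [move: h5|move: h6]; by rewrite ac.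
suff : path_open [set w | [/\ n%:R <= l, bumpf k l r f df, 1 < chanN k w c f df,
    energy2 k f df + normsq f < n.+1%:R^-1 &
    forall c', a c' -> chanN k w c' f df < n.+1%:R^-1]] by [].
rewrite eqU; apply: path_openI; first apply: path_openI.
- exact: path_open_prop.
- exact: path_open_gt (path_lipschitz_chan c b).2.
have lip c' : path_lipschitz (fun w => if a c' then chanN k w c' f df else 0).
  case: (a c'); first exact: (path_lipschitz_chan c' b).2.
  exists 0%N, 0; split => // w v e e0 _ _ _; by rewrite subrr normr0 mul0r.
by apply: path_openI; apply: path_open_lt; exact: lip.
Qed.

End Openness.

(** * Measurability of the classes *)

Section ClassEvents.
Context {R : realType} d (T : measurableType d) (W : R -> T -> R).
Notation mu := (@lebesgue_measure R).
Notation H := (halfline R).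
Hypothesis mW : forall x, measurable_fun setT (W x).
Hypothesis cW : forall w, continuous (W ^~ w).
Hypothesis W0 : forall w, W 0 w = 0.

Lemma measurable_path_event (V : set (R -> R)) : <<s path_events >> V ->
  measurable [set w | V (W ^~ w)].
Proof.
move=> sV.
have grid m (X : set (R -> R)) : <<s grid_events m >> X -> measurable [set w | X (W ^~ w)].
  move=> sX.
  have mphi : @measurable_fun _ _ T (g_sigma_algebraType (grid_events m)) setT
      (fun w => W ^~ w).
    apply: (@measurability _ _ T (g_sigma_algebraType (grid_events m)) _ _ (grid_events m)) => //.
    move=> _ [_ [i [A [mA ->]]] <-]; rewrite setTI /preimage/=.
    have mi : measurable_fun setT (fun w => W (dyad i m) w - W 0 w) by exact: measurable_funB.
    by have := mi measurableT A mA; rewrite setTI.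
  by have := mphi measurableT X sX; rewrite setTI.
have mphi : @measurable_fun _ _ T (g_sigma_algebraType (@path_events R)) setT
    (fun w => W ^~ w).
  apply: (@measurability _ _ T (g_sigma_algebraType (@path_events R)) _ _ (@path_events R)) => //.
  by move=> _ [X [m _ sX] <-]; rewrite setTI; exact: grid sX.
by have := mphi measurableT V sV; rewrite setTI.
Qed.

Lemma measurable_path_open (U : set (R -> R)) : path_open U ->
  measurable [set w | U (W ^~ w)].
Proof.
move=> /path_open_event[V [sV UV]].
rewrite (_ : [set w | _] = [set w | V (W ^~ w)]); first exact: measurable_path_event.
by apply/seteqP; split => w /=; apply UV.
Qed.

(* [a] tells which of the two integrals converge; a divergent one counts as 0,
   as in [stoch_int]. *)
Definition in_class k (a : bool -> bool) (cc t : R) (w : R -> R) :=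
  exists f df, [/\ finen k f df,
    forall c, mu.-integrable H (EFin \o chan k w c f df) <-> a c &
    0 < qform k w a cc t f df].

(** Measurability hinges on this equivalence: convergence of an integral is not an open condition on
    the path, whereas each condition on the right is open, and there are countably many of them. *)
Lemma in_classP k a cc t w : continuous w -> in_class k a cc t w <->
  (exists l r f df, bumpf k l r f df /\ 0 < qform k w a cc t f df) /\
  forall c, ~~ a c -> forall n, exists f df, spike k w a c n f df.
Proof.
move=> cw; split.
  move=> [f [df [fe ia q0]]].
  have ia' c : a c -> mu.-integrable H (EFin \o chan k w c f df) by move=> /ia.
  split; first exact: (class_bump cw fe ia' q0).
  by move=> c nac; apply: (class_spike cw fe ia') => /ia; exact/negP.
by move=> [[l [r [f [df [b q0]]]]] hs]; exact: (class_glue cw b q0 hs).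
Qed.

Lemma measurable_in_class k a cc t : measurable [set w | in_class k a cc t (W ^~ w)].
Proof.
have -> : [set w | in_class k a cc t (W ^~ w)] =
  [set w | exists l r f df, bumpf k l r f df /\ 0 < qform k (W ^~ w) a cc t f df] `&`
  ((if a true then setT else \bigcap_n [set w | exists f df, spike k (W ^~ w) a true n f df]) `&`
   (if a false then setT else \bigcap_n [set w | exists f df, spike k (W ^~ w) a false n f df])).
  apply/seteqP; split => w /=.
    move=> /(in_classP _ _ _ _ (@cW w))[h1 h2]; split => //.
    by split; case: ifPn => // na n _; exact: h2.
  move=> [h1 [h2 h3]]; apply/(in_classP _ _ _ _ (@cW w)); split => // -[] na n.
    by move: h2; rewrite (negbTE na); apply.
  by move: h3; rewrite (negbTE na); apply.
apply: measurableI.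
  exact: (measurable_path_open (@path_open_bump R k a cc t)).
have mc c : measurable (if a c then setT else \bigcap_n [set w | exists f df, spike k (W ^~ w) a c n f df]).
  case: ifP => // _; apply: bigcapT_measurable => n.
  exact: (measurable_path_open (@path_open_spike R k a c n)).
by apply: measurableI.
Qed.

End ClassEvents.

(** * Equality in law *)

Section Law.
Context {R : realType}.
Implicit Types (x t : R) (i j m n : nat) (X V : set (R -> R)).

(** Measurability of both events is bundled in, because closure under complements and disjoint
    unions needs it. *)
Definition same_law {d1} {T1 : measurableType d1} (P1 : probability T1 R) (W1 : R -> T1 -> R)
  {d2} {T2 : measurableType d2} (P2 : probability T2 R) (W2 : R -> T2 -> R) (X : set (R -> R)) :=
  [/\ measurable [set w | X (W1 ^~ w)], measurable [set w | X (W2 ^~ w)] &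
      P1 [set w | X (W1 ^~ w)] = P2 [set w | X (W2 ^~ w)]].

Lemma same_law_dynkin {d1} {T1 : measurableType d1} (P1 : probability T1 R) (W1 : R -> T1 -> R)
  {d2} {T2 : measurableType d2} (P2 : probability T2 R) (W2 : R -> T2 -> R) :
  dynkin [set X | same_law P1 W1 P2 W2 X].
Proof.
split.
- split; [exact: measurableT|exact: measurableT|].
  by rewrite -[LHS]/(P1 setT) -[RHS]/(P2 setT) !probability_setT.
- move=> X [m1 m2 e]; split.
  + exact: (measurableC m1).
  + exact: (measurableC m2).
  + rewrite -[LHS]/(P1 (~` [set w | X (W1 ^~ w)])) -[RHS]/(P2 (~` [set w | X (W2 ^~ w)])).
    by rewrite !probability_setC// e.
- move=> F tF hF.
  have bigE (d' : measure_display) (T' : measurableType d') (W : R -> T' -> R) :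
      [set w | (\bigcup_n F n) (W ^~ w)] = \bigcup_n [set w | F n (W ^~ w)].
    by apply/seteqP; split => w [n _ Fn]; exists n.
  have tE (d' : measure_display) (T' : measurableType d') (W : R -> T' -> R) :
      trivIset setT (fun n => [set w | F n (W ^~ w)]).
    apply/trivIsetP => i j _ _ ij; apply/seteqP; split => w //= [Fi Fj].
    have : (F i `&` F j) (W ^~ w) by [].
    by move/trivIsetP : tF => /(_ i j Logic.I Logic.I ij) ->.
  split; rewrite /= ?bigE.
  + by apply: bigcupT_measurable => n; have [] := hF n.
  + by apply: bigcupT_measurable => n; have [] := hF n.
  rewrite !measure_bigcup//; last 4 first.
  + by move=> n _; have [] := hF n.
  + exact: tE.
  + by move=> n _; have [] := hF n.
  + exact: tE.
  by apply: eq_eseriesr => n _; have [] := hF n.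
Qed.

Lemma same_law_generated {d1} {T1 : measurableType d1} (P1 : probability T1 R) (W1 : R -> T1 -> R)
  {d2} {T2 : measurableType d2} (P2 : probability T2 R) (W2 : R -> T2 -> R) G :
  setI_closed G -> (forall X, G X -> same_law P1 W1 P2 W2 X) ->
  forall X, <<s G >> X -> same_law P1 W1 P2 W2 X.
Proof.
move=> GI hG; rewrite -(setI_closed_g_dynkin_g_sigma_algebra GI).
suff h : <<d G >> `<=` [set X | same_law P1 W1 P2 W2 X] by exact: h.
by apply: smallest_sub; [exact: same_law_dynkin|exact: hG].
Qed.

(** Rectangles in consecutive increments, the very sets whose probability the independence clause of
    [brownian_motion] computes. *)
Definition grid_rectangles m : set (set (R -> R)) :=
  [set X | exists n (A : nat -> set R), (forall i, measurable (A i)) /\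
    X = \bigcap_(i in [set i | (i < n)%N]) [set w | A i (w (dyad i.+1 m) - w (dyad i m))]].

Lemma grid_rectangles_setI m : setI_closed (grid_rectangles m).
Proof.
move=> _ _ [n [A [mA ->]]] [n' [A' [mA' ->]]].
exists (maxn n n'), (fun i => (if (i < n)%N then A i else setT) `&` (if (i < n')%N then A' i else setT)).
split; first by move=> i; apply: measurableI; case: ifP.
apply/seteqP; split => w.
  by move=> [h h'] i _ /=; split; case: ifP => // ii; [exact: h|exact: h'].
move=> h; split => i /= ii.
  by have [] := h i (leq_trans ii (leq_maxl _ _)); rewrite ii.
by have [] := h i (leq_trans ii (leq_maxr _ _)); rewrite ii.
Qed.

(** The value at a grid point, minus the value at 0, is a sum of consecutive increments. *)
Lemma grid_events_rectangles m X : <<s grid_events m >> X -> <<s grid_rectangles m >> X.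
Proof.
suff h : <<s grid_events m >> `<=` <<s grid_rectangles m >> by exact: h.
apply: smallest_sub; first exact: smallest_sigma_algebra.
move=> _ [i [A [mA ->]]].
rewrite -[X in X _]/(@measurable _ (g_sigma_algebraType (grid_rectangles m))).
have minc j : @measurable_fun _ _ (g_sigma_algebraType (grid_rectangles m)) R setT
    (fun w => w (dyad j.+1 m) - w (dyad j m)).
  move=> _ B mB; rewrite setTI; apply: sub_sigma_algebra.
  exists j.+1, (fun l => if l == j then B else setT); split; first by move=> l; case: ifP.
  apply/seteqP; split => w; first by move=> Bw l _ /=; case: eqP => // ->.
  by move=> /(_ j (ltnSn j)) /=; rewrite eqxx.
have mval : @measurable_fun _ _ (g_sigma_algebraType (grid_rectangles m)) R setT
    (fun w => w (dyad i m) - w 0).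
  elim: i => [|i IH].
    rewrite (_ : (fun _ => _) = cst 0); first exact: measurable_cst.
    by apply/funext => w; rewrite /dyad mul0r subrr.
  rewrite (_ : (fun _ => _) = (fun w : R -> R => (w (dyad i.+1 m) - w (dyad i m)) + (w (dyad i m) - w 0))).
    exact: measurable_funD.
  by apply/funext => w; rewrite addrA subrK.
by have := mval measurableT A mA; rewrite setTI.
Qed.

Lemma grid_eventsS m X : <<s grid_events m >> X -> <<s grid_events m.+1 >> X.
Proof.
suff h : <<s @grid_events R m >> `<=` <<s grid_events m.+1 >> by exact: h.
apply: smallest_sub; first exact: smallest_sigma_algebra.
move=> _ [i [A [mA ->]]]; apply: sub_sigma_algebra; exists i.*2, A; split => //.
have -> // : dyad i.*2 m.+1 = dyad i m :> R.
rewrite /dyad -mul2n natrM exprS invfM mulrACA divff ?mul1r// pnatr_eq0//.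
Qed.

Lemma grid_events_le m n X : (m <= n)%N -> <<s grid_events m >> X -> <<s grid_events n >> X.
Proof.
elim: n => [|n IH]; first by rewrite leqn0 => /eqP ->.
by rewrite leq_eqVlt => /predU1P[->//|mn] /(IH mn); exact: grid_eventsS.
Qed.

Lemma path_events_setI : setI_closed (@path_events R).
Proof.
move=> X Y [m _ sX] [n _ sY]; exists (maxn m n) => //.
have := @measurableI _ (g_sigma_algebraType (@grid_events R (maxn m n))) X Y.
by apply; [exact: (@grid_events_le _ _ _ (leq_maxl m n) sX)|exact: (@grid_events_le _ _ _ (leq_maxr m n) sY)].
Qed.

(** Two nested Dynkin arguments: from rectangles to the sigma-algebra of one level, then from the
    union of the levels to what it generates. On rectangles both laws are the same product of
    Gaussian probabilities. *)
Lemma brownian_same_law {d1} {T1 : measurableType d1} (P1 : probability T1 R) (W1 : R -> T1 -> R)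
  {d2} {T2 : measurableType d2} (P2 : probability T2 R) (W2 : R -> T2 -> R) V :
  brownian_motion P1 W1 -> brownian_motion P2 W2 -> <<s path_events >> V ->
  same_law P1 W1 P2 W2 V.
Proof.
move=> b1 b2; apply: same_law_generated; first exact: path_events_setI.
move=> X [m _ /grid_events_rectangles]; move: X.
apply: same_law_generated; first exact: grid_rectangles_setI.
move=> _ [n [A [mA ->]]].
have t0 : 0 <= dyad 0 m :> R by rewrite /dyad mul0r.
have ti i : dyad i m < dyad i.+1 m :> R.
  by rewrite /dyad ltr_pM2r ?invr_gt0 ?exprn_gt0// ltr_nat.
have ti0 i : 0 <= dyad i m :> R by rewrite /dyad divr_ge0// exprn_ge0.
have rect (d' : measure_display) (T' : measurableType d') (W : R -> T' -> R) :
   [set w | (\bigcap_(i in [set i | (i < n)%N])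
      [set w0 : R -> R | A i (w0 (dyad i.+1 m) - w0 (dyad i m))]) (W ^~ w)] =
   \bigcap_(i in [set i | (i < n)%N]) [set w | W (dyad i.+1 m) w - W (dyad i m) w \in A i].
  by apply/seteqP; split => w h i ii; have := h i ii => /=; rewrite inE.
have meas (d' : measure_display) (T' : measurableType d') (P : probability T' R) (W : R -> T' -> R) :
    brownian_motion P W ->
    measurable (\bigcap_(i in [set i | (i < n)%N]) [set w | W (dyad i.+1 m) w - W (dyad i m) w \in A i]).
  move=> [mW _ _ _ _]; apply: bigcap_measurableType => i _.
  have mi : measurable_fun setT (fun w => W (dyad i.+1 m) w - W (dyad i m) w).
    exact: measurable_funB.
  have := mi measurableT (A i) (mA i); rewrite setTI.
  by congr (measurable _); apply/seteqP; split => w /=; rewrite inE.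
split; rewrite ?rect; [exact: meas _ _ _ _ b1|exact: meas _ _ _ _ b2|].
have [_ _ _ g1 i1] := b1; have [_ _ _ g2 i2] := b2.
rewrite (i1 n (fun i => dyad i m) A t0 ti mA) (i2 n (fun i => dyad i m) A t0 ti mA).
by apply: eq_bigr => i _; rewrite g1// g2.
Qed.

End Law.

(** * Moments *)

Section GaussianMoment.
Context {R : realType}.
Notation mu := (@lebesgue_measure R).
Implicit Types (s x y : R).

(* The weight turns a Gaussian density into a multiple of another one. *)
Lemma normal_pdf_weight s y : 0 < s <= 1 ->
  expR (3 * y ^+ 2 / 8) * normal_pdf 0 s y <=
  2 * normal_pdf 0 (s / Num.sqrt (1 - 3 / 4 * s ^+ 2)) y.
Proof.
move=> /andP[s0 s1].
have s2 : 0 < s ^+ 2 by exact: exprn_gt0.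
have s21 : s ^+ 2 <= 1 by rewrite expr_le1// ltW.
(* The new variance is s^2 divided by this quantity; as it is at least 1/4, the two normalizations
   differ by a factor of at most 2. *)
have q4 : 4^-1 <= 1 - 3 / 4 * s ^+ 2 by lra.
have q0 : 0 < 1 - 3 / 4 * s ^+ 2 by apply: lt_le_trans q4; rewrite invr_gt0.
set q := 1 - 3 / 4 * s ^+ 2 in q4 q0 *.
have sq0 : 0 < Num.sqrt q by rewrite sqrtr_gt0.
have sq2 : Num.sqrt q ^+ 2 = q by rewrite sqr_sqrtr// ltW.
have sq12 : 2^-1 <= Num.sqrt q.
  have e : (2^-1 : R) ^+ 2 = 4^-1 by field.
  by rewrite -(@ler_pXn2r _ 2) ?nnegrE ?invr_ge0 ?(ltW sq0)// sq2 e.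
set s' := s / Num.sqrt q.
have s'0 : 0 < s' by exact: divr_gt0.
have s'2 : s' ^+ 2 = s ^+ 2 / q by rewrite /s' expr_div_n sq2.
rewrite !normal_pdfE ?gt_eqF// /normal_fun !subr0.
have -> : normal_peak s = (Num.sqrt q)^-1 * normal_peak s'.
  rewrite /normal_peak s'2 -!mulrnAr.
  have -> : s ^+ 2 / q * (pi *+ 2) = (s ^+ 2 * (pi *+ 2)) / q by rewrite mulrAC.
  rewrite (@sqrtrM _ (s ^+ 2 * (pi *+ 2))); last first.
    by rewrite mulr_ge0 ?sqr_ge0// mulrn_wge0// pi_ge0.
  by rewrite sqrtrV ?ltW// invfM invrK mulrCA mulVf ?mulr1// gt_eqF.
have -> : expR (3 * y ^+ 2 / 8) * ((Num.sqrt q)^-1 * normal_peak s' * expR (- y ^+ 2 / (s ^+ 2 *+ 2)))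
   = (Num.sqrt q)^-1 * (normal_peak s' * expR (- y ^+ 2 / (s' ^+ 2 *+ 2))).
  have -> : - y ^+ 2 / (s' ^+ 2 *+ 2) = 3 * y ^+ 2 / 8 + - y ^+ 2 / (s ^+ 2 *+ 2).
    rewrite s'2 -(mulr_natr (s ^+ 2 / q) 2) -(mulr_natr (s ^+ 2) 2).
    have q1 : 1 - 3 / 4 * s ^+ 2 != 0 by rewrite -/q gt_eqF.
    rewrite /q; field; rewrite gt_eqF//=.
    by have := q1; apply: contraNneq => h; apply/eqP; lra.
  by rewrite expRD; ring.
rewrite ler_wpM2r ?mulr_ge0 ?normal_peak_ge0 ?expR_ge0//.
by rewrite -[leRHS]invrK lef_pV2 ?posrE ?invr_gt0.
Qed.

(** The cube of (|y| + 1)^2 <= 2 (y^2 + 1) <= 16 (1 + y^2/8) <= 16 exp(y^2/8). *)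
Lemma sixth_power_le_expR y : (`|y| + 1) ^+ 6 <= 16 ^+ 3 * expR (3 * y ^+ 2 / 8).
Proof.
have h : (`|y| + 1) ^+ 2 <= 16 * expR (y ^+ 2 / 8).
  have h1 := expR_ge1Dx (y ^+ 2 / 8).
  have h2 : y ^+ 2 = `|y| ^+ 2 by rewrite real_normK// num_real.
  have := sqr_ge0 (`|y| - 1); move: h1; rewrite h2; nra.
have -> : (`|y| + 1) ^+ 6 = ((`|y| + 1) ^+ 2) ^+ 3 by rewrite -exprM.
have -> : 16 ^+ 3 * expR (3 * y ^+ 2 / 8) = (16 * expR (y ^+ 2 / 8)) ^+ 3.
  by rewrite exprMn -expRM_natl; congr (_ * expR _); ring.
by rewrite lerXn2r// ?nnegrE ?mulr_ge0 ?expR_ge0 ?sqr_ge0.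
Qed.

(** The law is given as probabilities of sets, so the comparison goes over the shells n <= |y| <
    n+1. There X^6 <= (n+1)^6 <= (|y| + 1)^6, and the exponential bound turns the Gaussian density
    into at most a multiple of another one, of total mass 1. *)
Lemma normal_sixth_moment d (T : measurableType d) (P : probability T R) (X : T -> R) s :
  0 < s <= 1 -> measurable_fun setT X ->
  (forall A : set R, measurable A -> P [set w | X w \in A] = normal_prob 0 s A) ->
  (\int[P]_w (X w ^+ 6)%:E <= (2 * 16 ^+ 3)%:E)%E.
Proof.
move=> s01 mX lX.
pose A n : set R := [set y | n%:R <= `|y| < n.+1%:R].
have mA n : measurable (A n).
  have mn : measurable_fun setT (fun y : R => `|y|) by apply: measurableT_comp.
  have h := mn measurableT `[n%:R, n.+1%:R[%classic (measurable_itv _).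
  rewrite setTI in h; rewrite (_ : A n = (fun y : R => `|y|) @^-1` `[n%:R, n.+1%:R[%classic); first exact: h.
  by apply/seteqP; split => y; rewrite /A/= in_itv.
have tA : trivIset setT A.
  apply/trivIsetP => i j _ _ ij; apply/seteqP; split => y //= [/andP[h1 h2] /andP[h3 h4]].
  have := le_lt_trans h1 h4; have := le_lt_trans h3 h2; rewrite !ltr_nat !ltnS => ji ij'.
  by move/eqP : ij; apply; apply/eqP; rewrite eqn_leq ij' ji.
have UA : \bigcup_n A n = setT.
  apply/seteqP; split => // y _; exists (Num.truncn `|y|) => //.
  by rewrite /A/= truncnS_gt andbT truncn_le.
pose B n := [set w | X w \in A n].
have BE n : B n = X @^-1` A n by apply/seteqP; split => w; rewrite /B/= inE.
have mB n : measurable (B n).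
  by rewrite BE; have := mX measurableT (A n) (mA n); rewrite setTI.
have tB : trivIset setT B.
  apply/trivIsetP => i j _ _ ij; rewrite !BE -preimage_setI.
  by move/trivIsetP : tA => /(_ i j Logic.I Logic.I ij) ->; rewrite preimage_set0.
have UB : \bigcup_n B n = setT.
  by under eq_bigcupr do rewrite BE; rewrite -preimage_bigcup UA preimage_setT.
have mX6 : measurable_fun setT (fun w => (X w ^+ 6)%:E).
  by apply/measurable_EFinP; exact: measurable_funX.
have X60 w : (0 <= (X w ^+ 6)%:E)%E by rewrite lee_fin (exprM _ 3 2) sqr_ge0.
rewrite -{1}UB ge0_integral_bigcup ?UB//.
pose s' := s / Num.sqrt (1 - 3 / 4 * s ^+ 2).
have [c c0 hc] : exists2 c : R, 0 <= c & c = 16 ^+ 3 by exists (16 ^+ 3) => //; exact: exprn_ge0.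
pose phi y := c * (expR (3 * y ^+ 2 / 8) * normal_pdf 0 s y).
have phi0 y : 0 <= phi y by rewrite mulr_ge0// mulr_ge0 ?expR_ge0 ?normal_pdf_ge0.
have mphi : measurable_fun setT phi.
  apply: measurable_funM => //; apply: measurable_funM; last exact: measurable_normal_pdf.
  apply: measurableT_comp => //; apply: measurable_funM => //.
  by apply: measurable_funM => //; exact: measurable_funX.
apply: (@le_trans _ _ (\int[mu]_y (phi y)%:E)%E).
  rewrite -[X in (_ <= \int[_]_(_ in X) _)%E]UA ge0_integral_bigcup//; last 2 first.
    by rewrite UA; apply/measurable_EFinP.
    by move=> y _; rewrite lee_fin.
  apply: lee_nneseries => [n _ _|n _]; first by apply: integral_ge0 => w _; exact: X60.
  apply: (@le_trans _ _ (\int[P]_(w in B n) cst (n.+1%:R ^+ 6)%:E w)%E).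
    apply: ge0_le_integral => //.
    - exact: measurable_funS mX6.
    - move=> w; rewrite /B/= inE /A/= => /andP[_ h]; rewrite lee_fin.
      have -> : X w ^+ 6 = `|X w| ^+ 6.
        by rewrite -normrX ger0_norm// (exprM _ 3 2) sqr_ge0.
      by rewrite lerXn2r ?nnegrE// ltW.
  have -> : (\int[P]_(w in B n) cst (n.+1%:R ^+ 6)%:E w = (n.+1%:R ^+ 6)%:E * normal_prob 0 s (A n))%E.
    by rewrite integral_cst//; congr (_ * _)%E; exact: lX.
  have mpdf : measurable_fun (A n) (EFin \o normal_pdf 0 s).
    by apply/measurable_EFinP; apply: measurable_funTS; exact: measurable_normal_pdf.
  have pdf0 y : A n y -> (0 <= (EFin \o normal_pdf 0 s) y)%E.
    by move=> _; rewrite lee_fin normal_pdf_ge0.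
  have n60 : (0 <= (n.+1%:R ^+ 6)%:E :> \bar R)%E by rewrite lee_fin exprn_ge0.
  rewrite /normal_prob -(@ge0_integralZl _ _ _ mu _ (mA n) _ mpdf _ pdf0 n60).
  apply: ge0_le_integral => //.
  - exact: mA.
  - by move=> y Ay; rewrite mule_ge0 ?pdf0.
  - exact: measurable_funeM.
  - by apply/measurable_EFinP; exact: measurable_funTS.
  move=> y /= /andP[h _]; rewrite -EFinM lee_fin /phi mulrA.
  rewrite ler_wpM2r ?normal_pdf_ge0//; rewrite hc; apply: le_trans (sixth_power_le_expR y).
  by rewrite -natr1 lerXn2r ?nnegrE ?addr_ge0// lerD2r.
apply: (@le_trans _ _ (\int[mu]_y (2 * c * normal_pdf 0 s' y)%:E)%E).
  apply: ge0_le_integral => //.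
  - by move=> y _; rewrite lee_fin.
  - by apply/measurable_EFinP.
  - by apply/measurable_EFinP; apply: measurable_funM => //; exact: measurable_normal_pdf.
  by move=> y _; rewrite lee_fin /phi (mulrC 2 c) -(mulrA c 2) ler_wpM2l//; exact: normal_pdf_weight.
under eq_integral do rewrite EFinM.
rewrite ge0_integralZl//.
- by rewrite integral_normal_pdf mule1 hc.
- by apply/measurable_EFinP; exact: measurable_normal_pdf.
- by move=> y _; rewrite lee_fin normal_pdf_ge0.
- by rewrite lee_fin mulr_ge0.
Qed.

Lemma increment_sixth_moment d (T : measurableType d) (P : probability T R) (W : R -> T -> R) s t :
  brownian_motion P W -> 0 <= s -> s <= t -> t <= s + 1 ->
  (\int[P]_w ((W t w - W s w) ^+ 6)%:E <= (2 * 16 ^+ 3)%:E)%E.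
Proof.
move=> [mW _ _ hN _] s0; rewrite le_eqVlt => /predU1P[<- _|st ts].
  under eq_integral do rewrite subrr expr0n.
  by rewrite integral0 lee_fin mulr_ge0// exprn_ge0.
apply: normal_sixth_moment; last by move=> A; exact: hN.
  by rewrite sqrtr_gt0 subr_gt0 st/= -[leRHS]sqrtr1 ler_sqrt// lerBlDl.
exact: measurable_funB.
Qed.

End GaussianMoment.

(** * Joint measurability and Tonelli's theorem *)

Section JointMeasurability.
Context {R : realType} d (T : measurableType d).
Notation mu := (@lebesgue_measure R).

(** The process frozen at the left end of cells of length 1/(n+1) is measurable on each of countably
    many strips, and by continuity it converges to the process. *)
Lemma continuous_process_measurable (Z : R -> T -> R) :
  (forall x, measurable_fun setT (Z x)) -> (forall w, continuous (Z ^~ w)) ->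
  measurable_fun setT (fun z : R * T => Z z.1 z.2).
Proof.
move=> mZ cZ.
pose g n (i : int) : R := i%:~R / n.+1%:R.
pose F n (z : R * T) := Z (g n (Num.floor (z.1 * n.+1%:R))) z.2.
suff [mF cF] : (forall n, measurable_fun setT (F n)) /\
    (forall z : R * T, F n z @[n --> \oo] --> Z z.1 z.2).
  exact: (@measurable_fun_cvg _ _ _ setT F (fun z => Z z.1 z.2) mF (fun z _ => cF z)).
split.
  move=> n _ B mB; rewrite setTI.
  rewrite (_ : _ @^-1` _ = \bigcup_(i : int)
    (`[i%:~R / n.+1%:R, (i + 1)%:~R / n.+1%:R[%classic `*` (Z (g n i) @^-1` B))).
    apply: countable_bigcupT_measurable => [|i].
      exact: countableP.
    apply: measurableX; first exact: measurable_itv.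
    by rewrite -[X in measurable X]setTI; exact: mZ.
  apply/seteqP; split => [[x w] /= Bx|[x w] [i _] /=[]].
    exists (Num.floor (x * n.+1%:R)) => //; split => //=.
    by rewrite in_itv/= ler_pdivrMr// ltr_pdivlMr// floor_itv.
  rewrite in_itv/= ler_pdivrMr// ltr_pdivlMr// => h Bi.
  by rewrite /F/= (floor_def h).
move=> [x w] /=.
have cg : g n (Num.floor (x * n.+1%:R)) @[n --> \oo] --> x.
  apply/cvgrPdist_le => e e0; near=> n.
  have /andP[h1 h2] := floor_itv (x * n.+1%:R).
  have n0 : 0 < n.+1%:R :> R by [].
  have en : 1 <= e * n.+1%:R.
    rewrite -ler_pdivrMl// mulr1.
    have : (Num.truncn e^-1).+1%:R <= n%:R :> R.
      by rewrite ler_nat; near: n; exact: nbhs_infty_ge.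
    have := truncnS_gt e^-1; rewrite -(natr1 n); lra.
  have -> : x - g n (Num.floor (x * n.+1%:R)) =
      (x * n.+1%:R - (Num.floor (x * n.+1%:R))%:~R) / n.+1%:R.
    by rewrite /g mulrBl mulfK.
  rewrite normrM normfV ger0_norm ?subr_ge0// (ger0_norm (ltW n0)) ler_pdivrMr//.
  by apply: le_trans en; move: h2; rewrite intrD; lra.
exact: (cvg_comp _ _ cg (@cZ w x)).
Unshelve. all: end_near. Qed.

Context (P : probability T R).

Lemma tonelli_weight (D : set R) (h : R -> R) (Z : R -> T -> R) (C : R) :
  0 <= C -> measurable D -> measurable_fun D h -> (forall x, D x -> 0 <= h x) ->
  (forall x w, 0 <= Z x w) -> (forall x, measurable_fun setT (Z x)) ->
  measurable_fun setT (fun z : R * T => Z z.1 z.2) ->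
  (forall x, D x -> (\int[P]_w (Z x w)%:E <= C%:E)%E) ->
  measurable_fun setT (fun w => \int[mu]_(x in D) (h x * Z x w)%:E)%E /\
  (\int[P]_w \int[mu]_(x in D) (h x * Z x w)%:E <= C%:E * \int[mu]_(x in D) (h x)%:E)%E.
Proof.
move=> C0 mD mh h0 Z0 mZx mZ ZC.
pose F (z : R * T) : \bar R := (h z.1 * Z z.1 z.2)%:E.
pose G := F \_ (D `*` setT).
have GE x w : G (x, w) = ((fun x => (h x * Z x w)%:E) \_ D) x.
  rewrite /G /F !patchE (_ : ((x, w) \in D `*` setT) = (x \in D))//.
  by apply/idP/idP; rewrite !inE => // -[].
have mDT : measurable (D `*` [set: T]) by exact: measurableX.
have mG : measurable_fun setT G.
  apply/(measurable_restrictT _ mDT).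
  apply/measurable_EFinP; apply: measurable_funM; last exact: measurable_funTS.
  apply: (measurable_comp mD _ mh); last exact: measurable_funTS measurable_fst.
  by move=> _ [[x w] [Dx _] <-].
have G0 z : (0 <= G z)%E.
  rewrite /G patchE; case: ifPn => // /set_mem[Dz _].
  by rewrite lee_fin mulr_ge0// h0.
have E1 w : (\int[mu]_(x in D) (h x * Z x w)%:E = \int[mu]_x G (x, w))%E.
  by rewrite integral_mkcond; apply: eq_integral => x _; rewrite GE.
split.
  under eq_fun do rewrite E1.
  exact: (@measurable_fun_fubini_tonelli_G _ _ (measurableTypeR R) T R mu G mG G0).
under eq_integral do rewrite E1.
rewrite -(@fubini_tonelli _ _ (measurableTypeR R) T R mu P G mG G0).
have CD : (C%:E * \int[mu]_(x in D) (h x)%:E = \int[mu]_x (C%:E * ((EFin \o h) \_ D) x))%E.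
  rewrite integral_mkcond.
  rewrite ge0_integralZl//.
  - by apply/(measurable_restrictT _ mD); apply/measurable_EFinP.
  - by move=> x _; rewrite patchE; case: ifPn => // /set_mem Dx; rewrite lee_fin h0.
rewrite CD; apply: ge0_le_integral => //.
- by move=> x _; apply: integral_ge0 => w _; exact: G0.
- exact: (@measurable_fun_fubini_tonelli_F _ _ (measurableTypeR R) T R P G mG G0).
- apply: measurable_funeM.
  by apply/(measurable_restrictT _ mD); apply/measurable_EFinP.
move=> x _; under eq_integral do rewrite GE patchE.
rewrite patchE; case: ifPn => [/set_mem Dx|_]; last by rewrite integral0 mule0.
under eq_integral do rewrite EFinM.
rewrite ge0_integralZl// ?lee_fin ?h0//.
- by rewrite muleC; apply: lee_wpmul2r; [rewrite lee_fin h0|exact: ZC].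
- exact/measurable_EFinP.
by move=> w _; rewrite lee_fin.
Qed.

End JointMeasurability.

(** * Moments of increments and of oscillations *)

Section IncrementMoments.
Context {R : realType}.
Notation mu := (@lebesgue_measure R).

Lemma continuous_max0 (f : R -> R) : (forall b, {within `[0, b], continuous f}) ->
  continuous (fun x : R => f (Num.max x 0)).
Proof.
move=> cf x; have /subspace_continuousP h := cf (`|x| + 1).
have mx : Num.max x 0 \in `[0, `|x| + 1].
  rewrite in_itv/= le_max lexx orbT/= ge_max addr_ge0// andbT.
  by rewrite (le_trans (ler_norm x))// lerDl.
apply: (cvg_comp (fun y : R => Num.max y 0) f _ (h _ mx)) => U /= hU.
have cm : (fun y : R => Num.max y 0) @ x --> Num.max x 0.
  by apply: continuous_max => //; exact: cvg_cst.
have hU' : \forall y \near x, `[0, `|x| + 1]%classic (Num.max y 0) -> U (Num.max y 0).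
  exact: cm _ hU.
near=> y.
have : `[0, `|x| + 1]%classic (Num.max y 0) -> U (Num.max y 0) by near: y; exact: hU'.
apply; rewrite /=.
rewrite in_itv/= le_max lexx orbT/= ge_max addr_ge0// andbT.
have : `|x - y| <= 1 by near: y; apply: (@cvgr_dist_le _ _ _ _ _ id x) => //; exact: cvg_id.
by rewrite ler_norml => /andP[h1 h2]; have := ler_norm x; lra.
Unshelve. all: end_near. Qed.

Lemma osc1_continuous (w : R -> R) : continuous w -> continuous (fun x : R => osc1 w (Num.max x 0)).
Proof.
move=> cw; apply: (@continuous_max0 (osc1 w)) => b.
have cW : {within `[0, b], continuous (Wbar w)} by exact: ac_continuous (ac_Wbar cw).
move=> x; apply: cvgB; last exact: cW.
by have /continuous_subspaceT := cw; apply.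
Qed.

(* Jensen's inequality, from the tangent line of [z ^+ 6] at the mean. *)
Lemma osc1_sixth_power_le (w : R -> R) x : continuous w ->
  ((osc1 w x ^+ 6)%:E <= \int[mu]_(y in `[x, (x + 1)%R]) ((w x - w y) ^+ 6)%:E)%E.
Proof.
move=> cw; set m := osc1 w x.
have c6 : continuous (fun y => (w x - w y) ^+ 6).
  move=> y; apply: (@continuous_comp _ _ _ (fun y => w x - w y) (fun z => z ^+ 6)).
    by apply: cvgB; [exact: cvg_cst|exact: cw].
  exact: exprn_continuous.
have iw : mu.-integrable `[x, x + 1] (EFin \o w) by exact: continuous_rint.
have i6 := continuous_rint x (x + 1) c6.
pose c0 := m ^+ 6 + 6 * m ^+ 5 * (w x - m).
have ic : mu.-integrable `[x, x + 1] (EFin \o (fun=> c0)).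
  by apply: continuous_rint => y; exact: cvg_cst.
have ia : mu.-integrable `[x, x + 1] (EFin \o (fun y => (- (6 * m ^+ 5)) * w y)).
  exact: rintZl.
have e : \int[mu]_(y in `[x, x + 1]) (c0 + (- (6 * m ^+ 5)) * w y) = m ^+ 6.
  rewrite RintegralD// RintegralZl// Rintegral_cst//=.
  rewrite lebesgue_measure_itv/= lte_fin ltrDl ltr01 -EFinB addrAC subrr add0r/= mulr1 -/(Wbar w x) /c0.
  have -> : Wbar w x = w x - m by rewrite /m /osc1; ring.
  by ring.
rewrite -e -EFin_Rintegral// lee_fin; apply: le_Rintegral => //; first exact: rintD.
move=> y _; rewrite /c0; set v := w x - w y.
have -> : w y = w x - v by rewrite /v; ring.
(* The sixth power minus its tangent is (v - m)^2 times v^4 + 2 v^3 m + 3 v^2 m^2 + 4 v m^3 + 5 m^4,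
   written here as a sum of squares. *)
rewrite -subr_ge0 (_ : _ - _ = (v - m) ^+ 2 *
  ((v ^+ 2 + v * m) ^+ 2 + 2 * (v * m + m ^+ 2) ^+ 2 + 3 * (m ^+ 2) ^+ 2)); last by ring.
apply: mulr_ge0; first exact: sqr_ge0.
by rewrite !addr_ge0 ?(mulr_ge0 (ler0n _ _)) ?sqr_ge0.
Qed.

Lemma inverse_square_integral_lty : (\int[mu]_(x in `]1%R, +oo[) (x ^- 2)%:E < +oo)%E.
Proof.
have l1 : (0 : R) < 1 by [].
have a := ac_powR_max (-1) l1.
pose p (x : R) : R := if 1 < x then x ^- 2 else 0.
have p0 x : 0 <= p x by rewrite /p; case: ifP => // _; rewrite invr_ge0 sqr_ge0.
have pE x : p x = - (if 1 < x then -1 * x `^ (-1 - 1) else 0).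
  rewrite /p; case: ifPn => x1; last by rewrite oppr0.
  rewrite mulN1r opprK (_ : -1 - 1 = - 2%:R); last by ring.
  by rewrite powRN powR_mulrn// ltW// (lt_trans _ x1).
have [_ mp] := ac_measurable a.
have mpH : measurable_fun (halfline R) p.
  rewrite (funext pE).
  by apply: measurableT_comp => //; apply: measurable_funS mp => //; exact: halfline_sub_ge0.
have sub1 : (`]1, +oo[%classic : set R) `<=` halfline R.
  by move=> x /=; rewrite !in_itv/= !andbT; apply: lt_trans.
have pE1 x : `]1, +oo[%classic x -> x ^- 2 = p x.
  by rewrite /= in_itv/= andbT /p => ->.
under eq_integral => x /set_mem/pE1 -> do [].
apply: (@le_lt_trans _ _ (1%:E)); last exact: ltry.
apply: (@le_trans _ _ (\int[mu]_(x in halfline R) (p x)%:E)%E).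
  apply: ge0_subset_integral => //; first exact/measurable_EFinP.
  by move=> x _; rewrite lee_fin.
apply: le_halfline_segments => // n.
have [i e] := a n%:R (ler0n _ n).
have ip : mu.-integrable `[0, n%:R] (EFin \o p).
  by apply: eq_rint (rintZl _ (-1) i) => // x _; rewrite mulN1r -pE.
have ip' : mu.-integrable `]0, n%:R] (EFin \o p).
  by apply: integrableS ip => //; exact: subset_itv_oc_cc.
rewrite -EFin_Rintegral// lee_fin Rintegral_itv_obnd_cbnd//.
have -> : \int[mu]_(x in `[0, n%:R]) p x =
    - \int[mu]_(x in `[0, n%:R]) (if 1 < x then -1 * x `^ (-1 - 1) else 0).
  under eq_Rintegral do rewrite pE -mulN1r.
  by rewrite RintegralZl// mulN1r.
have m1 : Num.max (0 : R) 1 = 1 by rewrite max_r.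
move: e; rewrite /= m1 powR1 => e.
have := powR_ge0 (Num.max n%:R 1) (-1 : R); lra.
Qed.

End IncrementMoments.

(** * Almost sure finiteness of the weighted sixth moments *)

Section MomentChannels.
Context {R : realType} d (T : measurableType d) (P : probability T R) (W : R -> T -> R).
Notation mu := (@lebesgue_measure R).
Hypothesis bm : brownian_motion P W.
Hypothesis cW : forall w, continuous (W ^~ w).

Let mW x : measurable_fun setT (W x).
Proof. by case: bm. Qed.

Let W0 w : W 0 w = 0.
Proof. by case: bm. Qed.

Lemma measurable_path_lipschitz (Phi : (R -> R) -> R) : path_lipschitz Phi ->
  measurable_fun setT (fun w => Phi (W ^~ w)).
Proof.
move=> lip _; apply: (measurability _ (RGenOInfty.measurableE R)) => // _ [_ [b ->] <-].
rewrite setTI (_ : _ @^-1` _ = [set w | b < Phi (W ^~ w)]).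
  exact: (measurable_path_open mW cW W0 (path_open_gt lip)).
by apply/seteqP; split => w; rewrite /= in_itv/= andbT.
Qed.

Lemma path_lipschitz_incr c (x : R) : path_lipschitz (fun w => incr w c (Num.max x 0)).
Proof.
set z := Num.max x 0; have z0 : 0 <= z by rewrite le_max lexx orbT.
exists (Num.truncn (z + 1)).+1, 2; split => // w v e e0 cw cv wv.
have h y : 0 <= y <= z + 1 -> `|v y - w y| <= e.
  move=> /andP[y0 yz]; apply: wv; rewrite y0/= (le_trans yz)// ltW// truncnS_gt //.
have zz : 0 <= z <= z by rewrite z0 lexx.
case: c => /=; first exact: (step1_dist h zz).
exact: (osc1_dist (ltW e0) cv cw h zz).
Qed.

Lemma incr_process_continuous c w : continuous (fun x : R => incr (W ^~ w) c (Num.max x 0)).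
Proof.
case: c => /=; last exact: (osc1_continuous (@cW w)).
apply: (@continuous_max0 _ (step1 (W ^~ w))) => b; apply: continuous_subspaceT => x.
apply: cvgB; last exact: cW.
apply: (cvg_comp (fun y : R => y + 1) (W ^~ w) _ (@cW w (x + 1))).
by apply: cvgD; [exact: cvg_id|exact: cvg_cst].
Qed.

(** For the oscillation, Jensen's inequality gives an average over y in [x, x+1], and Tonelli
    reduces its expectation to increments over a time of at most 1. *)
Lemma incr_sixth_moment c (x : R) : 0 <= x ->
  (\int[P]_w (incr (W ^~ w) c x ^+ 6)%:E <= (2 * 16 ^+ 3)%:E)%E.
Proof.
move=> x0; case: c => /=.
  by apply: (increment_sixth_moment bm) => //; rewrite lerDl.
have m6 y : measurable_fun setT (fun w => (W x w - W y w) ^+ 6).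
  by apply: measurable_funX; exact: measurable_funB.
have c6 w : continuous (fun y => (W x w - W y w) ^+ 6).
  move=> y; apply: (@continuous_comp _ _ _ (fun y => W x w - W y w) (fun z => z ^+ 6)).
    by apply: cvgB; [exact: cvg_cst|exact: cW].
  exact: exprn_continuous.
have p6 (z : R) : 0 <= z ^+ 6 by rewrite (exprM _ 3 2) sqr_ge0.
have C0 : 0 <= 2 * 16 ^+ 3 :> R by rewrite mulr_ge0// exprn_ge0.
have mitv : measurable (`[x, x + 1]%classic : set R) by exact: measurable_itv.
have [||||||mI leI] := @tonelli_weight _ _ _ P `[x, x + 1]%classic (fun=> 1)
    (fun y w => (W x w - W y w) ^+ 6) _ C0 mitv.
- exact: measurable_cst.
- by [].
- by move=> *; exact: p6.
- exact: m6.
- exact: continuous_process_measurable m6 c6.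
- move=> y /=; rewrite in_itv/= => /andP[xy yx].
  have -> : (\int[P]_w ((W x w - W y w) ^+ 6)%:E = \int[P]_w ((W y w - W x w) ^+ 6)%:E)%E.
    by apply: eq_integral => w _; congr (_%:E); ring.
  exact: (increment_sixth_moment bm).
rewrite integral_cst//= lebesgue_measure_itv/= lte_fin ltrDl ltr01 in leI.
apply: (@le_trans _ _ (\int[P]_w \int[mu]_(y in `[x, (x + 1)%R]) (1 * (W x w - W y w) ^+ 6)%:E)%E).
  apply: ge0_le_integral => //.
  - by move=> w _; rewrite lee_fin.
  - apply/measurable_EFinP; apply: measurable_funX.
    have := measurable_path_lipschitz (path_lipschitz_incr false x).
    by rewrite max_l.
  - move=> w _; under eq_integral do rewrite mul1r.
    exact: osc1_sixth_power_le.
by apply: le_trans leI _; rewrite -EFinB addrAC subrr add0r mule1 mule1.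
Qed.

(** The moment bound is uniform in x and x^(-2) is integrable at infinity, so the weighted integral
    has finite expectation and is finite almost surely. *)
Lemma moment_channels_ae : {ae P, forall w, forall c,
  mu.-integrable `]1, +oo[ (EFin \o (fun x => x ^- 2 * (1 + incr (W ^~ w) c x ^+ 6)))}.
Proof.
suff h c : {ae P, forall w, mu.-integrable `]1, +oo[
    (EFin \o (fun x => x ^- 2 * (1 + incr (W ^~ w) c x ^+ 6)))}.
  by apply: filterS2 (h true) (h false) => w h1 h2 [].
have p6 (z : R) : 0 <= z ^+ 6 by rewrite (exprM _ 3 2) sqr_ge0.
(* The maximum yields a continuous process on the whole line, as joint measurability asks; the
   integration sees only x > 1. *)
pose Z x w := 1 + incr (W ^~ w) c (Num.max x 0) ^+ 6.
have Z0 x w : 0 <= Z x w by rewrite addr_ge0.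
have mI x : measurable_fun setT (fun w => incr (W ^~ w) c (Num.max x 0)).
  exact: measurable_path_lipschitz (path_lipschitz_incr c x).
have mZ x : measurable_fun setT (Z x).
  by apply: measurable_funD => //; apply: measurable_funX.
have cZ w : continuous (Z ^~ w).
  move=> x; apply: cvgD; first exact: cvg_cst.
  apply: (cvg_comp _ (fun z : R => z ^+ 6) (@incr_process_continuous c w x)).
  exact: exprn_continuous.
have C0 : 0 <= 1 + 2 * 16 ^+ 3 :> R by rewrite addr_ge0// mulr_ge0// exprn_ge0.
have D0 (x : R) : `]1, +oo[%classic x -> 0 < x.
  by rewrite /= in_itv/= andbT; apply: lt_trans.
have mD : measurable (`]1, +oo[%classic : set R) by exact: measurable_itv.
have mh : measurable_fun (`]1, +oo[%classic : set R) (fun x => x ^- 2).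
  apply: (@eq_measurable_fun _ _ _ _ _ (fun x => x `^ (- 2%:R))).
    by move=> x /set_mem/D0 x0; rewrite powRN powR_mulrn// ltW.
  exact: measurable_funTS (measurable_powR _).
have [|||||mJ leJ] := @tonelli_weight _ _ _ P _ (fun x => x ^- 2) Z _ C0 mD mh.
- by move=> x _; rewrite invr_ge0 sqr_ge0.
- exact: Z0.
- exact: mZ.
- exact: continuous_process_measurable.
- move=> x /D0 x0; rewrite /Z (max_l (ltW x0)).
  under eq_integral do rewrite EFinD.
  have m6 : measurable_fun setT (fun w => (incr (W ^~ w) c x ^+ 6)%:E).
    by apply/measurable_EFinP/measurable_funX; have := mI x; rewrite (max_l (ltW x0)).
  rewrite ge0_integralD//; last by move=> w _; rewrite lee_fin.
  rewrite integral_cst// -[X in (_ * X + _)%E]/(P setT) probability_setT mule1 EFinD leeD2l//.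
  exact: incr_sixth_moment (ltW x0).
have JI : P.-integrable setT (fun w => \int[mu]_(x in `]1%R, +oo[) (x ^- 2 * Z x w)%:E)%E.
  apply/integrableP; split => //.
  under eq_integral => w _.
    rewrite gee0_abs; last first.
      by apply: integral_ge0 => x _; rewrite lee_fin mulr_ge0// invr_ge0 sqr_ge0.
    over.
  apply: le_lt_trans leJ _; apply: lte_mul_pinfty => //.
  exact: inverse_square_integral_lty.
apply: filterS (integrable_ae measurableT JI) => w /(_ Logic.I) fJ.
suff : mu.-integrable `]1, +oo[ (EFin \o (fun x => x ^- 2 * Z x w)).
  by apply: eq_rint => // x /D0 x0; rewrite /Z max_l// ltW.
apply/integrableP; split.
  apply/measurable_EFinP; apply: measurable_funM => //.
  exact: measurable_funTS (continuous_measurable_fun (cZ w)).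
under eq_integral => x _.
  rewrite /= ger0_norm; last by rewrite mulr_ge0// invr_ge0 sqr_ge0.
  over.
by move: fJ; rewrite fin_numElt => /andP[].
Qed.

End MomentChannels.

(** * Scaling *)

Section LebesgueScaling.
Context {R : realType}.
Notation mu := (@lebesgue_measure R).
Variable l : R.
Hypothesis l0 : 0 < l.

Let phi : R -> measurableTypeR R := fun x => l * x.

Let mphi : measurable_fun setT phi.
Proof. exact: measurable_funM. Qed.

Let lambda : {nonneg R} := NngNum (ltW l0).

Let nu : {measure set (measurableTypeR R) -> \bar R}.
Proof. by refine (pushforward mu phi : {measure set _ -> \bar R}); exact: mphi. Defined.

(** Both measures agree on intervals, and uniqueness of Lebesgue measure does the rest. *)
Lemma lebesgue_measure_scale (A : set R) : measurable A ->
  mscale lambda nu A = mu A.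
Proof.
move=> mA; apply/esym/lebesgue_measure_unique => //= _ [[a b]] _ <-.
rewrite /mscale/= /nu/= /pushforward (_ : phi @^-1` `]a, b] = `]a / l, b / l]%classic).
  rewrite !lebesgue_measure_itv/= !lte_fin ltr_pM2r ?invr_gt0//.
  by case: ifP => // _; rewrite ?mule0// -EFinB -EFinM; congr (_%:E); field; rewrite gt_eqF.
by apply/seteqP; split => x; rewrite /phi/= !in_itv/= ltr_pdivrMr// ler_pdivlMr// (mulrC x).
Qed.

Lemma ge0_integral_scale (D : set R) (g : R -> \bar R) : measurable D ->
  measurable_fun D g -> (forall x, D x -> (0 <= g x)%E) ->
  (\int[mu]_(x in D) g x = l%:E * \int[mu]_(x in phi @^-1` D) g (l * x)%R)%E.
Proof.
move=> mD mg g0.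
transitivity (\int[mscale lambda nu]_(x in D) g x)%E.
  by apply: eq_measure_integral => //= A mA AD; exact/esym/lebesgue_measure_scale.
rewrite ge0_integral_mscale//; congr (_ * _)%E.
by rewrite ge0_integral_pushforward// => x /set_mem; exact: g0.
Qed.

Lemma rint_scale (D : set R) (f : R -> R) : measurable D -> mu.-integrable D (EFin \o f) ->
  mu.-integrable (phi @^-1` D) (EFin \o (fun x => f (l * x))) /\
  \int[mu]_(x in phi @^-1` D) f (l * x) = l^-1 * \int[mu]_(x in D) f x.
Proof.
move=> mD /[dup] ifD /integrableP[mf fi].
have mD' : measurable (phi @^-1` D) by rewrite -[X in measurable X]setTI; exact: mphi.
have mfl : measurable_fun (phi @^-1` D) (EFin \o (fun x => f (l * x))).
  by apply: (measurable_comp mD _ mf); [move=> _ [x Dx <-]|exact: measurable_funTS].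
have il : mu.-integrable (phi @^-1` D) (EFin \o (fun x => f (l * x))).
  apply/integrableP; split => //.
  rewrite (@ge0_integral_scale D (fun x => `|(f x)%:E|)%E) // in fi; last first.
    exact: measurableT_comp.
  set J := (X in (_ * X < _)%E) in fi; rewrite -[X in (X < _)%E]/J.
  by move: fi; case: J => [r||]; rewrite ?ltry// gt0_muley// lte_fin.
split => //.
have e : (\int[mu]_(x in D) (f x)%:E = l%:E * \int[mu]_(x in phi @^-1` D) (f (l * x))%:E)%E.
  pose fl x := (f (l * x))%:E.
  have ep : (\int[mu]_(x in D) (EFin \o f)^\+ x = l%:E * \int[mu]_(x in phi @^-1` D) fl^\+ x)%E.
    by rewrite (@ge0_integral_scale D _ mD (measurable_funepos mf))//; congr (_ * _)%E; apply: eq_integral => x _; rewrite !funeposE.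
  have en : (\int[mu]_(x in D) (EFin \o f)^\- x = l%:E * \int[mu]_(x in phi @^-1` D) fl^\- x)%E.
    by rewrite (@ge0_integral_scale D _ mD (measurable_funeneg mf))//; congr (_ * _)%E; apply: eq_integral => x _; rewrite !funenegE.
  transitivity (\int[mu]_(x in D) (EFin \o f)^\+ x - \int[mu]_(x in D) (EFin \o f)^\- x)%E.
    exact: integralE.
  have fp : (\int[mu]_(x in phi @^-1` D) fl^\+ x)%E \is a fin_num.
    exact: integrable_fin_num (integrable_funepos _ il).
  rewrite ep en -(muleBr _ (fin_num_adde_defr _ fp))//; congr (_ * _)%E.
  exact/esym/integralE.
rewrite /Rintegral e fineM//; last exact: integrable_fin_num il.
by rewrite mulKf ?gt_eqF.
Qed.

End LebesgueScaling.

Section BrownianScaling.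
Context {R : realType}.
Notation mu := (@lebesgue_measure R).

Lemma normal_prob_scale (c s : R) (A : set R) : 0 < c -> 0 < s -> measurable A ->
  normal_prob 0 s ((fun x => c * x) @^-1` A) = normal_prob 0 (c * s) A.
Proof.
move=> c0 s0 mA; rewrite /normal_prob.
have mp (m : R) : measurable_fun setT (EFin \o normal_pdf 0 m).
  by apply/measurable_EFinP; exact: measurable_normal_pdf.
have p0 (m : R) x : (0 <= (EFin \o normal_pdf 0 m) x)%E by rewrite lee_fin normal_pdf_ge0.
have mcA : measurable ((fun x => c * x) @^-1` A).
  rewrite -[X in measurable X]setTI.
  by have : measurable_fun setT (fun x : R => c * x) by [exact: measurable_funM]; apply.
rewrite [RHS](ge0_integral_scale c0 mA (measurable_funTS (mp _)))//.
rewrite -ge0_integralZl//; [|exact: measurable_funTS (measurableT_comp (mp _) _)|by rewrite lee_fin ltW].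
apply: eq_integral => x _; rewrite /= -EFinM; congr (_%:E).
rewrite !normal_pdfE ?mulf_neq0 ?gt_eqF// /normal_fun !subr0 mulrA.
congr (_ * expR _); last first.
  by field; rewrite !gt_eqF.
rewrite /normal_peak (_ : (c * s) ^+ 2 * pi *+ 2 = c ^+ 2 * (s ^+ 2 * pi *+ 2)); last by ring.
rewrite sqrtrM ?sqr_ge0// sqrtr_sqr gtr0_norm//.
by rewrite invfM mulrA divff ?mul1r// gt_eqF.
Qed.

Lemma brownian_motion_scale d (T : measurableType d) (P : probability T R) (W : R -> T -> R) (l : R) :
  brownian_motion P W -> (forall w, continuous (W ^~ w)) -> 0 < l ->
  brownian_motion P (fun t w => Num.sqrt l * W (t / l) w).
Proof.
move=> [mW W0 _ hN hI] cW l0; set c := Num.sqrt l.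
have c0 : 0 < c by rewrite sqrtr_gt0.
have mc (A : set R) : measurable A -> measurable ((fun x => c * x) @^-1` A).
  move=> mA; rewrite -[X in measurable X]setTI.
  by have : measurable_fun setT (fun x : R => c * x) by [exact: measurable_funM]; apply.
have eE s t (A : set R) : [set w | c * W (t / l) w - c * W (s / l) w \in A] =
    [set w | W (t / l) w - W (s / l) w \in (fun x => c * x) @^-1` A].
  by apply/seteqP; split => w /=; rewrite !inE/= mulrBr.
split.
- by move=> t; apply: measurable_funM => //; exact: mW.
- by move=> w; rewrite mul0r W0 mulr0.
- move=> w; apply: continuous_subspaceT => x.
  apply: cvgM; first exact: cvg_cst.
  apply: (cvg_comp (fun y : R => y / l) (W ^~ w) _ (@cW w (x / l))).
  by apply: cvgM; [exact: cvg_id|exact: cvg_cst].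
- move=> s t s0 st A mA.
  have sl : 0 <= s / l by rewrite divr_ge0// ltW.
  have stl : s / l < t / l by rewrite ltr_pM2r// invr_gt0.
  have -> : Num.sqrt (t - s) = c * Num.sqrt (t / l - s / l).
    rewrite /c -(sqrtrM _ (ltW l0)); congr (Num.sqrt _).
    by field; rewrite gt_eqF.
  rewrite eE (hN _ _ sl stl _ (mc _ mA)).
  by apply: normal_prob_scale mA; rewrite // sqrtr_gt0 subr_gt0.
- move=> n tt A t0 ti mA.
  under eq_bigcapr do rewrite eE.
  rewrite (hI n (fun i => tt i / l) (fun i => (fun x => c * x) @^-1` A i)).
  + by apply: eq_bigr => i _; rewrite eE.
  + by rewrite divr_ge0// ltW.
  + by move=> i; rewrite ltr_pM2r// invr_gt0.
  + by move=> i; exact: mc.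
Qed.

End BrownianScaling.

(** * Integration by parts and scaling of bumps *)

Section BumpScaling.
Context {R : realType}.
Notation mu := (@lebesgue_measure R).
Notation H := (halfline R).
Implicit Types (w f df : R -> R) (x l r : R) (k : nat).

Lemma Rintegral_halfline_vanish (g : R -> R) M :
  (forall x, 0 < x -> M < x -> g x = 0) ->
  \int[mu]_(x in H) g x = \int[mu]_(x in `]0, M]) g x.
Proof.
move=> g0.
have e : H `&` `]0, M]%classic = `]0, M]%classic :> set R.
  by apply/setIidPr => x /=; rewrite !in_itv/= => /andP[->].
rewrite -[in RHS]e Rintegral_mkcondr; apply: eq_Rintegral => x /set_mem /=.
rewrite in_itv/= andbT => x0; rewrite patchE; case: ifPn => // /negP nx.
by rewrite g0// ltNge; apply/negP => xM; apply: nx; rewrite inE/= in_itv/= x0.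
Qed.

Lemma coef_rint k l r f df (v : R -> R) : bumpf k l r f df -> measurable_fun H v ->
  (forall M, exists2 C : R, 0 <= C & forall x, 0 <= x <= M -> `|v x| <= C) ->
  mu.-integrable H (EFin \o (fun x => coef k false f df x * v x)).
Proof.
move=> b mv bv; have [C C0 hC] := bv r.
have [l0 fe h0] := b.
have [mf mdf] := finen_measurable fe.
have mH : measurable H by exact: measurable_itv.
apply: (@rint_le _ _ _ mu _ mH _ (fun x => (2 * C) * envelope k f df x)).
- apply: measurable_funM => //; rewrite /coef.
  apply: measurable_funD.
    by apply: measurable_funM; [apply: measurable_funM => //; apply: measurable_funM|exact: gk_measurable].
  by apply: measurable_funM; [exact: measurable_funX|exact: dgk_measurable].
- move=> x /=; rewrite in_itv/= andbT => x0.
  have [xr|rx] := leP x r.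
    rewrite normrM (_ : 2 * C * _ = 2 * envelope k f df x * C); last by ring.
    by apply: ler_pM => //; [exact: (coef_le_envelope k false)|apply: hC; rewrite (ltW x0)].
  have [fx dx] := h0 x (ltW x0) (introT orP (or_intror rx)).
  rewrite /coef fx dx expr0n/= !(mulr0, mul0r, addr0) normr0.
  by rewrite mulr_ge0 ?envelope_ge0// mulr_ge0.
- exact: rintZl (bumpf_envelope_rint b).
Qed.

(** Integrate by parts: f^2 gk Wbar vanishes near 0 and beyond r, and [Wbar] has derivative
    [step1 w], so the averages cancel and minus the integral of (f^2 gk)' W remains. This form
    scales, whereas the unit window of [Wbar] does not. *)
Lemma bump_wiener k l r f df w : continuous w -> bumpf k l r f df ->
  mu.-integrable H (EFin \o (fun x => coef k false f df x * w x)) /\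
  chanI k w true f df - chanI k w false f df = - \int[mu]_(x in H) (coef k false f df x * w x).
Proof.
move=> cw b; have [l0 fe h0] := b; have [a f0 _ _ _] := fe.
have mH : measurable H by exact: measurable_itv.
have aW := ac_Wbar cw; have [mW _] := ac_measurable aW.
have mWH : measurable_fun H (Wbar w) by apply: measurable_funS mW => //; exact: halfline_sub_ge0.
have iw : mu.-integrable H (EFin \o (fun x => coef k false f df x * w x)).
  apply: coef_rint b _ _; last by move=> M; exact: continuous_bounded_segment.
  exact: measurable_funTS (continuous_measurable_fun cw).
have iW : mu.-integrable H (EFin \o (fun x => coef k false f df x * Wbar w x)).
  apply: coef_rint b mWH _ => M; have [C C0 hC] := continuous_bounded_segment (M + 1) cw.
  by exists C => //; exact: Wbar_bound.
split => //.
pose M := `|r| + 1; have M0 : 0 < M by rewrite ltr_wpDl.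
have rM : r < M by rewrite (le_lt_trans (ler_norm r))// ltrDl.
have [fM _] := h0 M (ltW M0) (introT orP (or_intror rM)).
have l20 : 0 < l / 2 by rewrite divr_gt0.
(* [gk] is frozen below l/2, where f vanishes, so that the product is absolutely continuous down to
   0. *)
have aG := ac_mul (ac_mul (ac_sqr a) (ac_powR_max (- ak k) l20)) aW.
have [iG eG] := aG M (ltW M0).
move: eG; rewrite /= fM f0 expr0n/= !mul0r add0r => eG.
have ib c := bumpf_chan_rint c cw b.
have e0 : \int[mu]_(x in H) (chan k w true f df x + coef k false f df x * Wbar w x) = 0.
  rewrite (@Rintegral_halfline_vanish _ M); last first.
    move=> x x0 Mx; have [fx dx] := h0 x (ltW x0) (introT orP (or_intror (lt_trans rM Mx))).
    by rewrite /chan /coef fx dx expr0n/= !(mulr0, mul0r, addr0).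
  apply: etrans (esym eG); rewrite -Rintegral_itv_obnd_cbnd; last first.
    by apply: integrableS iG => //; exact: subset_itv_oc_cc.
  apply: eq_Rintegral => x; rewrite inE/= in_itv/= => /andP[x0 _].
  rewrite /chan /coef /gk /dgk /=.
  case: (ltP (l / 2) x) => [lx|xl].
    by ring.
  have xl' : x < l by apply: le_lt_trans xl _; rewrite ltr_pdivrMr// ltr_pMr// ltr1n.
  have [fx dx] := h0 x (ltW x0) (introT orP (or_introl xl')).
  by rewrite fx dx expr0n/= !(mulr0, mul0r, addr0).
have i1 : mu.-integrable H (EFin \o (fun x => chan k w true f df x)) by exact: ib.
move: e0; rewrite RintegralD//.
have -> : chanI k w false f df = \int[mu]_(x in H) (coef k false f df x * w x) -
    \int[mu]_(x in H) (coef k false f df x * Wbar w x).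
  rewrite -RintegralB//; apply: eq_Rintegral => x _.
  by rewrite /chan /coef /osc1 mulrBr.
rewrite -/(chanI k w true f df); lra.
Qed.

Section Scale.
Context (k : nat) (l r : R) (f df : R -> R) (c : R).
Hypothesis c0 : 0 < c.
Hypothesis b : bumpf k l r f df.

Let h x := f (c^-1 * x).
Let dh x := c^-1 * df (c^-1 * x).

Let ci0 : 0 < c^-1.
Proof. by rewrite invr_gt0. Qed.

Let halfline_scale : (fun x => c^-1 * x) @^-1` H = H.
Proof. by apply/seteqP; split => x /=; rewrite !in_itv/= !andbT pmulr_rgt0. Qed.

Let scale_int (g : R -> R) : mu.-integrable H (EFin \o g) ->
  mu.-integrable H (EFin \o (fun x => g (c^-1 * x))) /\
  \int[mu]_(x in H) g (c^-1 * x) = c * \int[mu]_(x in H) g x.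
Proof.
have mH : measurable H by exact: measurable_itv.
move=> ig; have := rint_scale ci0 mH ig; rewrite halfline_scale => -[i1 e1].
by split => //; rewrite e1 invrK.
Qed.

Let powR_scale x a : 0 < x -> x `^ a = c `^ a * (c^-1 * x) `^ a.
Proof.
move=> x0; have z0 : 0 <= c^-1 * x by rewrite mulr_ge0// ltW.
by rewrite -powRM ?(ltW c0)// mulrA divff ?mul1r// gt_eqF.
Qed.

Let ac_scale : ac h dh.
Proof.
have [_ [a _ _ _ _] _] := b => x x0.
have z0 : 0 <= c^-1 * x by rewrite mulr_ge0// ltW.
have [i e] := a _ z0.
have m1 : measurable (`[0, c^-1 * x]%classic : set R) by exact: measurable_itv.
have E : (fun y => c^-1 * y) @^-1` `[0, c^-1 * x]%classic = `[0, x]%classic :> set R.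
  by apply/seteqP; split => y /=; rewrite !in_itv/= pmulr_rge0// ler_pM2l.
have := rint_scale ci0 m1 i; rewrite E => -[i1 e1].
have mx : measurable (`[0, x]%classic : set R) by exact: measurable_itv.
split; first exact: rintZl.
by rewrite /h mulr0 e RintegralZl// e1 invrK mulrA mulVf ?mul1r// gt_eqF.
Qed.

Lemma bump_scale : bumpf k (c * l) (c * r) h dh.
Proof.
have [l0 [a f0 i1 i2 i3] h0] := b.
have mH : measurable H by exact: measurable_itv.
split; first by rewrite mulr_gt0.
  split; first exact: ac_scale.
  - by rewrite /h mulr0.
  - apply: eq_rint (rintZl _ (c^-1 ^+ 2) (scale_int i1).1) => // x _.
    by rewrite /dh exprMn.
  - apply: eq_rint (rintZl _ (c `^ ((2 * k + 1)%:R^-1)) (scale_int i2).1) => // x.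
    by rewrite /= in_itv/= andbT => x0; rewrite /pot [in RHS](powR_scale _ x0) mulrA.
  - exact: (scale_int i3).1.
move=> x x0 hx; have z0 : 0 <= c^-1 * x by rewrite mulr_ge0// ltW.
have hz : (c^-1 * x < l) || (r < c^-1 * x).
  by rewrite mulrC ltr_pdivrMr// ltr_pdivlMr// -!(mulrC c).
by have [fx dx] := h0 _ z0 hz; rewrite /h /dh fx dx mulr0.
Qed.

(** In the noise term differentiation contributes 1/c, which the Jacobian cancels; c^(-alpha) comes
    from the weight and sqrt c from the path. *)
Lemma qform_scale w cc t : continuous w ->
  qform k (fun y => Num.sqrt c * w (c^-1 * y)) (fun=> true) cc t h dh =
  cc * (c `^ (- ak k) * Num.sqrt c) * (chanI k w true f df - chanI k w false f df)
  - c^-1 * \int[mu]_(x in H) (df x ^+ 2)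
  - c * c `^ ((2 * k + 1)%:R^-1) * \int[mu]_(x in H) (pot k x * f x ^+ 2)
  - t * (c * normsq f).
Proof.
move=> cw; have [l0 [a f0 i1 i2 i3] h0] := b.
have mH : measurable H by exact: measurable_itv.
have cw' : continuous (fun y => Num.sqrt c * w (c^-1 * y)).
  move=> x; apply: cvgM; first exact: cvg_cst.
  apply: (cvg_comp (fun y : R => c^-1 * y) w _ (@cw (c^-1 * x))).
  by apply: cvgM; [exact: cvg_cst|exact: cvg_id].
have [iw ew] := bump_wiener cw b.
rewrite /qform /= (bump_wiener cw' bump_scale).2 ew.
have -> : normsq h = c * normsq f by exact: (scale_int i3).2.
have -> : energy2 k h dh = c^-1 * \int[mu]_(x in H) (df x ^+ 2) +
    c * c `^ ((2 * k + 1)%:R^-1) * \int[mu]_(x in H) (pot k x * f x ^+ 2).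
  have [j1 e1] := scale_int i1; have [j2 e2] := scale_int i2.
  rewrite /energy2.
  transitivity (\int[mu]_(x in H) (c^-1 ^+ 2 * df (c^-1 * x) ^+ 2 +
      c `^ ((2 * k + 1)%:R^-1) * (pot k (c^-1 * x) * f (c^-1 * x) ^+ 2))).
    apply: eq_Rintegral => x; rewrite inE/= in_itv/= andbT => x0.
    by rewrite /dh exprMn /pot [in LHS](powR_scale _ x0) mulrA.
  rewrite RintegralD//; [|exact: rintZl|exact: rintZl].
  rewrite RintegralZl// RintegralZl// e1 e2.
  by field; rewrite gt_eqF.
have -> : \int[mu]_(x in H) (coef k false h dh x * (Num.sqrt c * w (c^-1 * x))) =
    c `^ (- ak k) * Num.sqrt c * \int[mu]_(x in H) (coef k false f df x * w x).
  have [j e] := scale_int iw.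
  transitivity (\int[mu]_(x in H) (c^-1 * c `^ (- ak k) * Num.sqrt c *
      (coef k false f df (c^-1 * x) * w (c^-1 * x)))).
    apply: eq_Rintegral => x; rewrite inE/= in_itv/= andbT => x0.
    rewrite /coef /gk /dgk (powR_scale (- ak k) x0) (powR_scale (- ak k - 1) x0).
    have -> : c `^ (- ak k - 1) = c `^ (- ak k) * c^-1.
      by rewrite powRD ?(gt_eqF c0) ?implybT// powR_inv1// ltW.
    by rewrite /h /dh; ring.
  rewrite RintegralZl// e; field.
  by rewrite gt_eqF.
by ring.
Qed.

End Scale.

End BumpScaling.

(** * Tail events *)

Section TracyWidomEvent.
Context {R : realType}.
Notation mu := (@lebesgue_measure R).
Notation H := (halfline R).
Implicit Types (w f df : R -> R) (t beta : R) (k : nat).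

(** One of the two parts of g has infinite integral, so the extended integral is infinite, and
    [fine] sends both infinities to 0; if both parts diverge, the difference is -oo by
    convention. *)
Lemma Rintegral_not_integrable (D : set R) (g : R -> R) : measurable D ->
  measurable_fun D g -> ~ mu.-integrable D (EFin \o g) -> \int[mu]_(x in D) g x = 0.
Proof.
move=> mD mg ng; have mgE : measurable_fun D (EFin \o g) by exact/measurable_EFinP.
rewrite /Rintegral -[X in fine X]/(\int[mu]_(x in D) (EFin \o g) x)%E integralE.
have : ((\int[mu]_(x in D) (EFin \o g)^\+ x)%E = +oo \/ (\int[mu]_(x in D) (EFin \o g)^\- x)%E = +oo)%E.
  apply: contrapT => /not_orP[/eqP p /eqP m]; apply: ng; apply/integrableP; split => //.
  rewrite (_ : (\int[mu]_(x in D) `|(EFin \o g) x| = \int[mu]_(x in D) ((EFin \o g)^\+ x + (EFin \o g)^\- x))%E).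
    rewrite ge0_integralD//; [|exact: measurable_funepos|exact: measurable_funeneg].
    by apply: lte_add_pinfty; rewrite ltey.
  by apply: eq_integral => x _; rewrite -[LHS]/((abse \o (EFin \o g)) x) fune_abse.
have := @integral_ge0 _ _ _ mu D ((EFin \o g)^\+)%E (fun x _ => funepos_ge0 _ x).
have := @integral_ge0 _ _ _ mu D ((EFin \o g)^\-)%E (fun x _ => funeneg_ge0 _ x).
case: (\int[mu]_(x in D) (EFin \o g)^\- x)%E => [b||]//;
  by case: (\int[mu]_(x in D) (EFin \o g)^\+ x)%E => [a||]//= _ _ [].
Qed.

Lemma Lstar_finen k f df : Lstar k f df -> L2norm1 f ->
  [/\ finen k f df, energy k f df = energy2 k f df & normsq f = 1].
Proof.
move=> [hf he] hn.
have f0 : f 0 = 0.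
  by have [_ ->] := hf 0 (lexx _); rewrite set_itv1 Rintegral_set1.
have a : ac f df by move=> x x0; have [i e] := hf x x0; rewrite f0 add0r; split.
have [mf mdf] := ac_measurable a.
have mG : measurable (`[0, +oo[%classic : set R) by exact: measurable_itv.
have mH : measurable H by exact: measurable_itv.
have mpG : measurable_fun (`[0, +oo[%classic : set R) (fun x => pot k x * f x ^+ 2).
  apply: measurable_funM; last exact: measurable_funX.
  exact: measurable_funTS (measurable_powR _).
have md2 : measurable_fun (`[0, +oo[%classic : set R) (fun x => df x ^+ 2) by exact: measurable_funX.
have mf2 : measurable_fun (`[0, +oo[%classic : set R) (fun x => f x ^+ 2) by exact: measurable_funX.
have sq0 (g : R -> R) x : 0 <= g x ^+ 2 by exact: sqr_ge0.
have p0 x : 0 <= pot k x * f x ^+ 2 by rewrite mulr_ge0 ?pot_ge0 ?sqr_ge0.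
have iE : mu.-integrable `[0, +oo[ (EFin \o (fun x => df x ^+ 2 + pot k x * f x ^+ 2)).
  apply/rint_ltyP => //; first exact: measurable_funD.
  by move=> x _; rewrite addr_ge0.
have i1 : mu.-integrable `[0, +oo[ (EFin \o (fun x => df x ^+ 2)).
  by apply: rint_le iE => // x _; rewrite ger0_norm// lerDl.
have i2 : mu.-integrable `[0, +oo[ (EFin \o (fun x => pot k x * f x ^+ 2)).
  by apply: rint_le iE => // x _; rewrite ger0_norm// lerDr.
have i3 : mu.-integrable `[0, +oo[ (EFin \o (fun x => f x ^+ 2)).
  by apply/rint_ltyP => //; rewrite hn ltry.
have toH (g : R -> R) : mu.-integrable `[0, +oo[ (EFin \o g) -> mu.-integrable H (EFin \o g).
  by apply: integrableS => //; exact: halfline_sub_ge0.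
split.
- by split => //; exact: toH.
- by rewrite /energy /energy2 -Rintegral_itv_obnd_cbnd//; exact: toH.
- rewrite /normsq Rintegral_itv_obnd_cbnd; last exact: toH.
  by rewrite /Rintegral hn.
Qed.

Lemma finen_Lstar k f df : finen k f df -> normsq f = 1 -> Lstar k f df /\ L2norm1 f.
Proof.
move=> fe n1; have [a f0 i1 i2 i3] := fe.
have mH : measurable H by exact: measurable_itv.
split; last first.
  rewrite /L2norm1 -integral_itv_obnd_cbnd; last exact: measurable_int i3.
  by rewrite -EFin_Rintegral// -[X in X%:E]/(normsq f) n1.
split.
  by move=> x x0; have [i e] := a x x0; rewrite f0 add0r in e.
have iE : mu.-integrable H (EFin \o (fun x => df x ^+ 2 + pot k x * f x ^+ 2)) by exact: rintD.
rewrite -integral_itv_obnd_cbnd; last exact: measurable_int iE.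
by rewrite -EFin_Rintegral// ltry.
Qed.

(** If the norm vanished, f would be 0 almost everywhere, both channels with it since each of their
    terms has a factor f, and [qform] would be minus an energy. *)
Lemma qform_gt0_normsq k w a cc t f df : continuous w -> finen k f df ->
  0 < qform k w a cc t f df -> 0 < normsq f.
Proof.
move=> cw fe q0; rewrite lt_neqAle normsq_ge0 andbT; apply/eqP => n0.
have [_ _ _ _ i3] := fe; have [mf _] := finen_measurable fe.
have mH : measurable H by exact: measurable_itv.
have fae : ae_eq mu H (EFin \o (fun x => f x ^+ 2)) (cst 0%E).
  apply/ae_eq_integral_abs => //; first exact: measurable_int i3.
  under eq_integral => x _ do rewrite /= ger0_norm ?sqr_ge0//.
  by rewrite -EFin_Rintegral// -[X in X%:E]/(normsq f) -n0.
have c0 c : chanI k w c f df = 0.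
  rewrite /chanI /Rintegral (@ae_eq_integral _ _ _ mu H (cst 0%E)) ?integral0//.
    by apply/measurable_EFinP; exact: chan_measurable.
  apply: filterS fae => x fx Hx; have /eqP := fx Hx.
  rewrite /= eqe sqrf_eq0 => /eqP f0.
  by rewrite /chan f0 expr0n/= !(mul0r, mulr0, addr0); case: c.
move: q0; rewrite /qform !c0 !if_same subrr mulr0 -n0 mulr0 subr0 sub0r oppr_gt0.
by rewrite ltNge energy2_ge0.
Qed.

(** From left to right [a] records which of the two integrals converge; from right to left f is
    normalized, which keeps this pattern. A divergent integral has the value 0 on both sides. *)
Lemma TW_event k beta (B t : R) w : 0 < B -> continuous w ->
  (t%:E < B%:E * TW k beta w)%E <-> exists a, in_class k a (2 / Num.sqrt beta) (t / B) w.
Proof.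
move=> B0 cw; set cc := 2 / Num.sqrt beta.
rewrite -lte_pdivrMl// -EFinM (mulrC _ t).
split.
  move=> /ereal_sup_gt[_ [f [df [hL hn ->]]]]; rewrite lte_fin -/cc => ht.
  have [fe eE n1] := Lstar_finen hL hn.
  exists (fun c => `[< mu.-integrable H (EFin \o chan k w c f df) >]); exists f, df.
  split => //; first by move=> c; split => /asboolP.
  have cI c : (if `[< mu.-integrable H (EFin \o chan k w c f df) >] then chanI k w c f df else 0)
      = chanI k w c f df.
    case: asboolP => // nc; apply/esym/Rintegral_not_integrable => //.
    exact: chan_measurable.
  rewrite /qform !cI n1 mulr1 -eE.
  by move: ht; rewrite /stoch_int -/(chanI k w true f df) -/(chanI k w false f df) subr_gt0.
move=> [a [f [df [fe ia q0]]]].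
have n0 := qform_gt0_normsq cw fe q0.
pose e := (Num.sqrt (normsq f))^-1.
have e2 : e ^+ 2 = (normsq f)^-1 by rewrite exprVn sqr_sqrtr// ltW.
pose ef x := e * f x; pose edf x := e * df x.
have e20 : 0 < e ^+ 2 by rewrite e2 invr_gt0.
have fe' : finen k ef edf := finenZ e fe.
have n1 : normsq ef = 1 by rewrite (normsqZ e fe) e2 mulVf// gt_eqF.
have [hL hn] := finen_Lstar fe' n1.
have [_ eE _] := Lstar_finen hL hn.
apply: (@lt_le_trans _ _ (cc * stoch_int k ef edf w
    - energy k ef edf)%:E); last first.
  by apply: ereal_sup_ubound; exists ef, edf.
have cI c : (if a c then chanI k w c f df else 0) = chanI k w c f df.
  case: ifPn => // /negP nc; apply/esym/Rintegral_not_integrable => //.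
    exact: chan_measurable.
  by move=> /ia.
have cZ c : chanI k w c ef edf = e ^+ 2 * chanI k w c f df.
  have [ac'|nac] := boolP (a c); first by apply: chanIZ; apply/ia.
  rewrite -[X in _ * X]cI (negbTE nac) mulr0.
  apply: Rintegral_not_integrable => //; first exact: chan_measurable.
  move=> iZ; move/negP : nac; apply; apply/ia.
  apply: eq_rint (rintZl _ (e ^- 2) iZ) => // x _.
  by rewrite chanZ mulrA mulVf ?mul1r// gt_eqF.
rewrite lte_fin eE (energy2Z e fe) /stoch_int -/(chanI k w true ef edf) -/(chanI k w false ef edf) !cZ.
move: q0; rewrite /qform !cI => q0.
have := mulr_gt0 e20 q0.
have -> : e ^+ 2 * (cc * (chanI k w true f df - chanI k w false f df) - energy2 k f df - t / B * normsq f)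
  = cc * (e ^+ 2 * chanI k w true f df - e ^+ 2 * chanI k w false f df)
    - e ^+ 2 * energy2 k f df - t / B * (e ^+ 2 * normsq f) by ring.
by rewrite e2 mulVf ?gt_eqF// mulr1 subr_gt0.
Qed.

End TracyWidomEvent.

(** * Extending paths to negative times *)

Section Extension.
Context {R : realType} d (T : measurableType d) (P : probability T R) (W : R -> T -> R).
Notation mu := (@lebesgue_measure R).
Hypothesis bm : brownian_motion P W.

(** The continuity clause of [brownian_motion] stops at 0. Freezing the path before 0 gives
    continuity on the whole line and leaves [TW] unchanged, which reads positive times. *)
Definition extend0 (x : R) (w : T) : R := W (Num.max x 0) w.

Lemma extend0_continuous w : continuous (extend0 ^~ w).
Proof.
have [_ _ cW _ _] := bm; apply: (@continuous_max0 _ (W ^~ w)) => b.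
apply: continuous_subspaceW (cW w) => x /=.
by rewrite !in_itv/= andbT => /andP[].
Qed.

Lemma extend0_brownian : brownian_motion P extend0.
Proof.
have [mW W0 _ hN hI] := bm; split.
- by move=> t; exact: mW.
- by move=> w; rewrite /extend0 max_l.
- by move=> w; apply: continuous_subspaceT; exact: extend0_continuous.
- move=> s t s0 st A mA; rewrite /extend0 !max_l ?(le_trans s0 (ltW st))//.
  exact: hN.
- move=> n tt A t0 ti mA.
  have tt0 i : 0 <= tt i by elim: i => // i h; rewrite (le_trans h)// ltW.
  have e i : [set w | extend0 (tt i.+1) w - extend0 (tt i) w \in A i] =
      [set w | W (tt i.+1) w - W (tt i) w \in A i] by rewrite /extend0 !max_l.
  under eq_bigcapr do rewrite e.
  by rewrite hI//; apply: eq_bigr => i _; rewrite e.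
Qed.

Lemma TW_extend0 k (beta : R) w : TW k beta (extend0 ^~ w) = TW k beta (W ^~ w).
Proof.
have e x : 0 <= x -> extend0 x w = W x w by move=> x0; rewrite /extend0 max_l.
have eS f df : stoch_int k f df (extend0 ^~ w) = stoch_int k f df (W ^~ w).
  rewrite /stoch_int; congr (_ - _); apply: eq_Rintegral => x;
    rewrite inE/= in_itv/= andbT => x0; rewrite !e ?addr_ge0// ?(ltW x0)//.
  congr (_ * (_ - _)); apply: eq_Rintegral => y; rewrite inE/= in_itv/= => /andP[xy _].
  by rewrite e// (le_trans (ltW x0)).
by rewrite /TW; under eq_set do under eq_exists do under eq_exists do rewrite eS.
Qed.

End Extension.

Section AlmostSure.
Context {R : realType} d (T : measurableType d) (P : probability T R) (W : R -> T -> R).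
Hypothesis bm : brownian_motion P W.
Hypothesis cW : forall w, continuous (W ^~ w).

Definition bump_event k (cc t : R) : set (R -> R) :=
  [set w | exists l r f df, bumpf k l r f df /\ 0 < qform k w (fun=> true) cc t f df].

(** The tail event is the union of the four classes, hence measurable. Off the null set where a
    weighted sixth moment diverges, both channels of every test function converge, so only one class
    is left, and it equals the bump event. *)
Lemma TW_event_probability k (beta B t : R) : 0 < B ->
  P [set w | (t%:E < B%:E * TW k beta (W ^~ w))%E] =
  P [set w | bump_event k (2 / Num.sqrt beta) (t / B) (W ^~ w)].
Proof.
move=> B0; have [mW W0 _ _ _] := bm.
set cc := 2 / Num.sqrt beta; set E := [set w | _ < _]%E; set U := [set w | bump_event _ _ _ _].
pose C a1 a2 := [set w | in_class k (fun c => if c then a1 else a2) cc (t / B) (W ^~ w)].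
have mC a1 a2 : measurable (C a1 a2) by exact: measurable_in_class.
have EC : E = C true true `|` C true false `|` C false true `|` C false false.
  apply/seteqP; split => w.
    move=> /(TW_event _ _ _ B0 (@cW w))[a].
    have -> : a = (fun c => if c then a true else a false) by apply/funext => -[].
    by rewrite -/cc; case: (a true); case: (a false) => h; rewrite /C/=; tauto.
  by move=> h; apply/(TW_event _ _ _ B0 (@cW w)); case: h => [[[h|h]|h]|h]; eexists; exact: h.
have mE : measurable E by rewrite EC; do 3 apply: measurableU => //.
(* With both channels required to converge, no spike condition remains. *)
have UC : U = C true true.
  apply/seteqP; split => w.
    by move=> h; apply/(in_classP _ _ _ _ (@cW w)); split => // -[].
  by move=> /(in_classP _ _ _ _ (@cW w))[].
have [N [mN N0 hN]] := moment_channels_ae bm cW.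
have sub : E `<=` U `|` N.
  move=> w Ew; have [Nw|nNw] := pselect (N w); first by right.
  left; have hw : forall c, lebesgue_measure.-integrable `]1, +oo[
      (EFin \o (fun x => x ^- 2 * (1 + incr (W ^~ w) c x ^+ 6))).
    by apply: contrapT => nh; apply: nNw; exact: hN.
  move/(TW_event _ _ _ B0 (@cW w)) : Ew => [a [f [df [fe ia q0]]]].
  rewrite UC; exists f, df; split => //.
    by move=> c; split => // _; [case: c|exact: (chan_rint_moment (@cW w) fe (hw c))].
  have <- : a = (fun c => if c then true else true).
    by apply/funext => c; rewrite if_same; apply/ia; exact: (chan_rint_moment (@cW w) fe (hw c)).
  exact: q0.
have US : U `<=` E by rewrite UC EC => w h; left; left; left.
apply/eqP; rewrite eq_le; apply/andP; split.
  apply: (@le_trans _ _ (P (U `|` N))).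
    by apply: le_measure; rewrite ?inE//; apply: measurableU => //; rewrite UC.
  by rewrite measureU0// UC.
by apply: le_measure; rewrite ?inE// UC.
Qed.

End AlmostSure.

(** * Comparing the two values of beta *)

Section Comparison.
Context {R : realType}.
Notation mu := (@lebesgue_measure R).
Notation H := (halfline R).
Context (k : nat) (beta1 beta2 s : R).
Hypotheses (b10 : 0 < beta1) (b12 : beta1 < beta2).
Hypotheses (s_ge : (4 * k + 3)%:R^-1 <= s) (s_le : s <= (4 * k + 2)%:R / (4 * k + 3)%:R).

Definition scale_exponent : R := (s - 2^-1) / (ak k + 2^-1).
Definition scale_factor : R := (beta1 / beta2) `^ scale_exponent.

Let b20 : 0 < beta2.
Proof. exact: lt_trans b12. Qed.

Let K : R := k%:R.
Let K0 : 0 <= K.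
Proof. exact: ler0n. Qed.

Let odd_natE : (2 * k + 1)%:R = 2 * K + 1 :> R.
Proof. by rewrite (natrD _ (2 * k)) natrM. Qed.

Let four_natE (n : nat) : (4 * k + n)%:R = 4 * K + n%:R :> R.
Proof. by rewrite (natrD _ (4 * k)) natrM. Qed.

Let exponentE : scale_exponent = (2 * s - 1) * (2 * K + 1) / (4 * K + 1).
Proof.
rewrite /scale_exponent /ak odd_natE -/K; field.
by rewrite !gt_eqF//; have := K0; lra.
Qed.

Let s_bounds : 1 <= s * (4 * K + 3) /\ s * (4 * K + 3) <= 4 * K + 2.
Proof.
have h : 0 < 4 * K + 3 by have := K0; lra.
move: s_ge s_le; rewrite !four_natE => h1 h2; split.
  by move: h1; rewrite -[X in X <= _]mul1r ler_pdivrMr.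
by move: h2; rewrite ler_pdivlMr.
Qed.

(** Clearing denominators gives s (4k+3) <= 4k+2: the upper bound on s belongs to the kinetic
    term. *)
Let double_exponent_le : 2 * scale_exponent <= s.
Proof.
have h : 0 < 4 * K + 1 by have := K0; lra.
rewrite exponentE mulrA ler_pdivrMr//; have [_] := s_bounds; lra.
Qed.

(** Clearing denominators gives 1 <= s (4k+3): the lower bound on s belongs to the potential. *)
Let exponent_ge : 0 <= s + (2 * k + 1)%:R^-1 * scale_exponent.
Proof.
have h : 0 < 4 * K + 1 by have := K0; lra.
have -> : s + (2 * k + 1)%:R^-1 * scale_exponent = (s * (4 * K + 3) - 1) / (4 * K + 1).
  rewrite exponentE odd_natE; field.
  by rewrite !gt_eqF//; have := K0; lra.
by rewrite divr_ge0 ?(ltW h)// subr_ge0; have [] := s_bounds.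
Qed.

Let powE (a x : R) : 0 < a -> a `^ x = expR (x * ln a).
Proof. by move=> a0; rewrite /powR gt_eqF. Qed.

Let sqrtE (a : R) : 0 < a -> Num.sqrt a = expR (2^-1 * ln a).
Proof. by move=> a0; rewrite -powR12_sqrt ?ltW// powE. Qed.

Let D : R := ln beta1 - ln beta2.

Let D0 : D < 0.
Proof. by rewrite subr_lt0 ltr_ln. Qed.

Let factorE : scale_factor = expR (scale_exponent * D).
Proof. by rewrite /scale_factor powE ?divr_gt0// ln_div. Qed.

Lemma scale_factor_gt0 : 0 < scale_factor.
Proof. by rewrite factorE expR_gt0. Qed.

Let lnE : ln scale_factor = scale_exponent * D.
Proof. by rewrite factorE expRK. Qed.

Let noise_scale : beta1 `^ s * (2 / Num.sqrt beta1) *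
    (scale_factor `^ (- ak k) * Num.sqrt scale_factor) =
  scale_factor * (beta2 `^ s * (2 / Num.sqrt beta2)).
Proof.
rewrite !sqrtE ?scale_factor_gt0// !powE ?scale_factor_gt0// lnE factorE -!expRN.
rewrite (_ : expR (s * ln beta1) * _ * _ = 2 *
  expR (s * ln beta1 + - (2^-1 * ln beta1) + (- ak k * (scale_exponent * D) + 2^-1 * (scale_exponent * D)))).
  rewrite [RHS](_ : _ = 2 * expR (scale_exponent * D + (s * ln beta2 + - (2^-1 * ln beta2)))).
    congr (_ * expR _).
    have e : scale_exponent * (ak k + 2^-1) = s - 2^-1.
      rewrite /scale_exponent mulfVK// gt_eqF// ltr_wpDl//; exact: ak_ge0.
    have -> : s * ln beta1 = (s - 2^-1) * ln beta1 + 2^-1 * ln beta1 by ring.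
    have -> : s * ln beta2 = (s - 2^-1) * ln beta2 + 2^-1 * ln beta2 by ring.
    by rewrite -e /D; field.
  by rewrite !expRD; ring.
by rewrite !expRD; ring.
Qed.

Let kinetic_scale : beta1 `^ s * scale_factor^-1 <= scale_factor * beta2 `^ s.
Proof.
rewrite !powE// factorE -expRN -!expRD ler_expR -subr_ge0.
rewrite (_ : _ - _ = (2 * scale_exponent - s) * D); last by rewrite /D; ring.
by apply: mulr_le0; [rewrite subr_le0 double_exponent_le|exact: ltW].
Qed.

Let potential_scale : beta1 `^ s * (scale_factor * scale_factor `^ ((2 * k + 1)%:R^-1))
  <= scale_factor * beta2 `^ s.
Proof.
rewrite !powE ?scale_factor_gt0// lnE factorE -!expRD ler_expR -subr_ge0.
set p := _%:R^-1.
rewrite (_ : _ - _ = - ((s + p * scale_exponent) * D)); last by rewrite /D; ring.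
by rewrite oppr_ge0; apply: mulr_ge0_le0; [exact: exponent_ge|exact: ltW].
Qed.

Lemma bump_event_scale (t : R) (w : R -> R) : continuous w ->
  bump_event k (2 / Num.sqrt beta2) (t / beta2 `^ s) w ->
  bump_event k (2 / Num.sqrt beta1) (t / beta1 `^ s)
    (fun y => Num.sqrt scale_factor * w (y / scale_factor)).
Proof.
move=> cw [l [r [f [df [b q0]]]]]; have c0 := scale_factor_gt0.
rewrite (_ : (fun y => _) = fun y => Num.sqrt scale_factor * w (scale_factor^-1 * y)); last first.
  by apply/funext => y; rewrite (mulrC y).
exists (scale_factor * l), (scale_factor * r), (fun x => f (scale_factor^-1 * x)),
  (fun x => scale_factor^-1 * df (scale_factor^-1 * x)); split; first exact: bump_scale.
rewrite (qform_scale c0 b _ _ cw).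
have [_ [_ _ i1 i2 _] _] := b.
move: q0; rewrite /qform /= /energy2 RintegralD//.
set S := chanI _ _ _ _ _ - _; set A := \int[mu]_(x in H) _; set V := \int[mu]_(x in H) _.
set N := normsq f; set B1 := beta1 `^ s; set B2 := beta2 `^ s => q0.
have A0 : 0 <= A by apply: Rintegral_ge0 => x _; exact: sqr_ge0.
have V0 : 0 <= V by apply: Rintegral_ge0 => x _; rewrite mulr_ge0 ?pot_ge0 ?sqr_ge0.
have B10 : 0 < B1 by rewrite powR_gt0.
have B20 : 0 < B2 by rewrite powR_gt0.
rewrite -(pmulr_rgt0 _ B10).
apply: lt_le_trans (mulr_gt0 (mulr_gt0 c0 B20) q0) _.
have h1 := ler_wpM2r A0 kinetic_scale; have h2 := ler_wpM2r V0 potential_scale.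
have h3 : B1 * (t / B1) = t by rewrite mulrC divfK// gt_eqF.
have h4 : B2 * (t / B2) = t by rewrite mulrC divfK// gt_eqF.
have h5 := congr1 (fun z => z * S) noise_scale.
rewrite -/B1 -/B2 in h1 h2 h5.
(* Multiplied by beta1^s, the new form exceeds c beta2^s times the old one by a kinetic gain and a
   potential gain; the noise terms cancel, and so do the thresholds, both equal to c N t. *)
rewrite -subr_ge0 (_ : _ - _ = (scale_factor * B2 * A - B1 * scale_factor^-1 * A)
  + (scale_factor * B2 * V - B1 * (scale_factor * scale_factor `^ ((2 * k + 1)%:R^-1)) * V)
  + (B1 * (2 / Num.sqrt beta1) * (scale_factor `^ (- ak k) * Num.sqrt scale_factor) * S
     - scale_factor * (B2 * (2 / Num.sqrt beta2)) * S)
  + scale_factor * N * (B2 * (t / B2) - B1 * (t / B1))); last by ring.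
by rewrite h3 h4 h5 !subrr mulr0 !addr0 addr_ge0// subr_ge0.
Qed.

End Comparison.

Theorem theorem3 (R : realType)
    (d1 : measure_display) (Omega1 : measurableType d1) (P1 : probability Omega1 R)
    (W1 : R -> Omega1 -> R)
    (d2 : measure_display) (Omega2 : measurableType d2) (P2 : probability Omega2 R)
    (W2 : R -> Omega2 -> R)
    (k : nat) (beta1 beta2 s : R) :
  brownian_motion P1 W1 -> brownian_motion P2 W2 ->
  0 < beta1 -> beta1 < beta2 ->
  (4 * k + 3)%:R^-1 <= s -> s <= (4 * k + 2)%:R / (4 * k + 3)%:R ->
  forall t : R,
    (P2 [set w | t%:E < (beta2 `^ s)%:E * TW k beta2 (fun x => W2 x w)]
     <= P1 [set w | t%:E < (beta1 `^ s)%:E * TW k beta1 (fun x => W1 x w)])%E.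
Proof.
move=> bm1 bm2 b10 b12 s_ge s_le t.
have b20 := lt_trans b10 b12.
under eq_set do rewrite -TW_extend0.
under [X in (_ <= P1 X)%E]eq_set do rewrite -TW_extend0.
have e1 := extend0_brownian bm1; have e2 := extend0_brownian bm2.
have c1 := extend0_continuous bm1; have c2 := extend0_continuous bm2.
rewrite (TW_event_probability e1 c1) ?powR_gt0//.
rewrite (TW_event_probability e2 c2) ?powR_gt0//.
set c := scale_factor k beta1 beta2 s.
have c0 : 0 < c by exact: scale_factor_gt0.
have eS := brownian_motion_scale e2 c2 c0.
set S := (fun t w => Num.sqrt c * _) in eS.
have cS w : continuous (S ^~ w).
  move=> x; apply: cvgM; first exact: cvg_cst.
  apply: (cvg_comp (fun y : R => y / c) (extend0 W2 ^~ w) _ (@c2 w (x / c))).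
  by apply: cvgM; [exact: cvg_id|exact: cvg_cst].
set U := bump_event k (2 / Num.sqrt beta1) (t / beta1 `^ s).
have oU : path_open U by exact: (@path_open_bump R k (fun=> true)).
have [mS S0 _ _ _] := eS; have [mE E0 _ _ _] := e2; have [mF F0 _ _ _] := e1.
(* The two Brownian motions live on different spaces. Equality in law carries the event of [W1] over
   to the rescaled path [S] on the space of [W2], where it contains the other event. *)
have -> : P1 [set w | U (extend0 W1 ^~ w)] = P2 [set w | U (S ^~ w)].
  have [V [sV UV]] := path_open_event oU.
  have [_ _] := brownian_same_law e1 eS sV.
  rewrite (_ : [set w | V (extend0 W1 ^~ w)] = [set w | U (extend0 W1 ^~ w)]); last first.
    by apply/seteqP; split => w /=; apply UV; [exact: c1|exact: F0|exact: c1|exact: F0].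
  rewrite (_ : [set w | V (S ^~ w)] = [set w | U (S ^~ w)])//.
  by apply/seteqP; split => w /=; apply UV; [exact: cS|exact: S0|exact: cS|exact: S0].
apply: le_measure; rewrite ?inE.
- exact: (measurable_path_open mE c2 E0 (@path_open_bump R k (fun=> true) _ _)).
- exact: (measurable_path_open mS cS S0 oU).
- by move=> w /=; exact: (@bump_event_scale _ k beta1 beta2 s b10 b12 s_ge s_le t _ (@c2 w)).
Qed.
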